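(* Let $S\in\mathbf{H}(\mathcal{T})$ be a Schur multiplier and let $\mathbf{H}(S)$ be the associated de Branges–Rovnyak space. For $1\le j\le q$, $F\in\mathbf{H}(S)$, $d\in\mathcal{C}_2$ set $$A_jF=(F-F^\wedge(0))\alpha_j,\quad B_jd=(S-S^\wedge(0))d\alpha_j,\quad CF=F^\wedge(0),\quad Dd=S^\wedge(0)d.$$ Then the following statements hold. (I) For each $j=1,\dots,q$ these formulae define a bounded linear operator $$V_j=\begin{pmatrix}A_j&B_j\\ C&D\end{pmatrix}:\begin{pmatrix}\mathbf{H}(S)\\ \mathcal{C}_2\end{pmatrix}\longrightarrow\begin{pmatrix}\mathbf{H}(S)\\ \mathcal{C}_2\end{pmatrix},$$ which satisfies $$V_jV_j^*=\begin{pmatrix}\hat M_{\alpha_j^*\alpha_j}&0\\ 0&I\end{pmatrix}.$$ In particular, $\mathbf{H}(S)$ is $A_j$-invariant for $j=1,\dots,q$. (II) For every $F\in\mathbf{H}(S)$, $c\in\mathcal{C}$, $d\in\mathcal{C}_2$ and $1\le j,\ell\le q$: $$A_\ell F=(A_jF)\alpha_j^*\alpha_\ell,\qquad B_\ell d=(B_jd)\alpha_j^*\alpha_\ell,$$ $$A_j(Fc)=(A_jF)\alpha_j^*c\,\alpha_j,\qquad B_j(dc)=(B_jd)\alpha_j^*c\,\alpha_j,$$ $$C(Fc)=(CF)c,\qquad D(dc)=(Dd)c.$$ (III) Let $S=\sum_{w\in\mathcal{F}_q}w^*S_{[w]}$, with $S_{[w]}\in\mathcal{C}$, be the pointwise absolutely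 convergent expansion of $S$. Then for every $d\in\mathcal{C}_2$ it holds that $S_{[\emptyset]}d=Dd$, and $$S_{[w]}d=w\,(CA^vB_jd)\,v^*\alpha_j^*\qquad\text{for all }w,v\in\mathcal{F}_q\text{ with }|w|=|v|+1\text{ and all }1\le j\le q,$$ where $A^{\alpha_{i_1}\cdots\alpha_{i_k}}:=A_{i_k}\cdots A_{i_1}$ and $A^{\emptyset}:=I$.
   Context: Tree setting. Let $q\ge 1$ be an integer and $\mathcal{T}$ a homogeneous tree of order $q$, i.e. an acyclic, undirected, connected graph such that every node belongs to exactly $q+1$ edges. An infinite path from $t$ is a sequence of nodes $(t_0=t,t_1,t_2,\dots)$ with consecutive nodes joined by an edge and $t_{k+1}\neq t_k\neq t_{k+2}$ for all $k$. Two infinite paths $(t_k),(s_k)$ are equivalent if there are $m,n\ge 0$ with $t_{m+k}=s_{n+k}$ for all $k\ge 0$; equivalence classes are boundary points. Fix a boundary point $\infty_{\mathcal{T}}$; each node $t$ has a unique representative path of $\infty_{\mathcal{T}}$ starting at $t$. For nodes $t,s$ with representative paths $(t_k),(s_k)$ of $\infty_{\mathcal{T}}$, take the minimal $m,n$ with $t_{m+k}=s_{n+k}$ for all $k\ge0$, and set $s\wedge t:=t_m=s_n$, $\operatorname{dist}(s,t):=m+n$. Write $s\preceq t$ if $\operatorname{dist}(s,s\wedge t)\le\operatorname{dist}(t,s\wedge t)$ and $s\asymp t$ if equality holds. Fix maps (primitive shifts) $\alpha_1,\dots,\alpha_q:\mathcal{T}\to\mathcal{T}$, acting on the right, with $\{t\alpha_1,\dots,t\alpha_q\}=\{s: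 t\preceq s,\ \operatorname{dist}(t,s)=1\}$ for every $t$. Let $\mathcal{F}_q$ be the free semigroup with unit $\emptyset$ generated by $\alpha_1,\dots,\alpha_q$; $|\emptyset|=0$, $|\alpha_{i_1}\cdots\alpha_{i_n}|=n$; $w\in\mathcal{F}_q$ acts on nodes by $t\mapsto tw$. Operators. $\ell_2(\mathcal{T})$ is the Hilbert space of square-summable functions $f:\mathcal{T}\to\mathbb{C}$ with standard basis $\chi_t$; $\mathbf{X}(\mathcal{T})$ is the algebra of bounded linear operators on it, with operator norm $\|\cdot\|$. Each $w\in\mathcal{F}_q$ is also regarded as the operator $(wf)(t)=f(tw)$ in $\mathbf{X}(\mathcal{T})$, with adjoint $w^*$. $S\in\mathbf{X}(\mathcal{T})$ is causal if for every node $s$ and $f\in\ell_2(\mathcal{T})$ with $f(t)=0$ for all $t\preceq s$, one has $(Sf)(t)=0$ for all $t\preceq s$. $\mathbf{H}(\mathcal{T})$ is the algebra of causal operators and $\mathcal{C}=\{S\in\mathbf{X}(\mathcal{T}): S,S^*\in\mathbf{H}(\mathcal{T})\}$ is the algebra of constants. Each $S\in\mathbf{H}(\mathcal{T})$ has coefficients $S_{[w]}\in\mathcal{C}$ ($w\in\mathcal{F}_q$) given by $(S_{[w]}\chi_t)(s)=(S\chi_t)(sw)$ if $t\asymp s$ and $0$ otherwise, and $S=\sum_{w\in\mathcal{F}_q}w^*S_{[w]}$ pointwise absolutely (for every $f,t$ the series evaluated at $f$ and $t$ converges absolutely to $(Sf)(t)$). Point evaluation at $0$. For $F\in\mathbf{H}(\mathcal{T})$,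 $F^\wedge(0)=F_{[\emptyset]}$ (this is the value at $c=0$ of the point evaluation $F^\wedge(c)=\sum_{n\ge0}(c\alpha)^n\sum_{|w|=n}w^*F_{[w]}$, where $c\alpha=\sum_jc_j\alpha_j$ for a row $c=(c_1\ \dots\ c_q)\in\mathcal{C}^q$). Hilbert–Schmidt spaces. $\mathbf{H}_2(\mathcal{T})=\{F\in\mathbf{H}(\mathcal{T}):\|F\|_2^2:=\operatorname{trace}(F^*F)<\infty\}$ with $\langle F,G\rangle_2=\operatorname{trace}(G^*F)$, a Hilbert space; $\mathcal{C}_2=\mathcal{C}\cap\mathbf{H}_2(\mathcal{T})$, a closed subspace. For $S\in\mathbf{H}(\mathcal{T})$, $M_S$ is the operator $F\mapsto SF$ on $\mathbf{H}_2(\mathcal{T})$. $\hat M_Q$ denotes right multiplication $F\mapsto FQ$; $\hat M_{\alpha_j^*\alpha_j}$ in (I) acts on $\mathbf{H}(S)$ (note $\alpha_j^*\alpha_j\in\mathcal{C}$, and $\mathbf{H}(S)$ is invariant under right multiplication by elements of $\mathcal{C}$). Schur multipliers. A Schur multiplier is $S\in\mathbf{H}(\mathcal{T})$ with $\|S\|\le1$. With $\mathcal{B}_S=I-M_SM_S^*$ on $\mathbf{H}_2(\mathcal{T})$ and $\pi_S$ the orthogonal projection of $\mathbf{H}_2(\mathcal{T})$ onto $\ker\mathcal{B}_S$, the de Branges–Rovnyak space associated with $S$ is the Hilbert space $\mathbf{H}(S)=\sqrt{\mathcal{B}_S}\,\mathbf{H}_2(\mathcal{T})$ with norm $\|\sqrt{\mathcal{B}_S}F\|_{\mathbf{H}(S)}=\|(I-\pi_S)F\|_2$.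 The direct sum $\begin{pmatrix}\mathbf{H}(S)\\ \mathcal{C}_2\end{pmatrix}$ is the Hilbert space orthogonal sum. *)

(* Defs.v *)
From HB Require Import structures.
From mathcomp Require Import all_boot all_order all_algebra.
From mathcomp Require Import complex.
From mathcomp Require Import mathcomp_extra boolp classical_sets functions.
From mathcomp Require Import cardinality fsbigop reals ereal interval_inference.
From mathcomp Require Import ring.
From mathcomp Require Import topology normedtype sequences esum.

Set Implicit Arguments.
Unset Strict Implicit.
Unset Printing Implicit Defensive.

Import Order.TTheory GRing.Theory Num.Theory.

Local Open Scope classical_set_scope.
Local Open Scope ring_scope.

Section Tree.
Variables (T : choiceType) (q : nat).
Implicit Types (e : rel T) (xi : set (nat -> T)) (s t : T) (p : nat -> T).

(* A graph is its adjacency relation e on the node type; a ucycle is a closed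
   path without repeated nodes, and those of size 2 only run back and forth
   along one edge. *)
Definition homogeneous_tree e : Prop :=
  [/\ symmetric e,
      irreflexive e,
      (forall s t, exists2 c : seq T, path e s c & t = last s c),
      (forall c : seq T, ucycle e c -> (size c <= 2)%N) &
      (forall t, ([set s | e t s] #= `I_q.+1)%card)].

Definition infinite_path e p : Prop :=
  forall k, [&& e (p k) (p k.+1), p k.+1 != p k & p k != p k.+2].

Definition path_equiv p p' : Prop :=
  exists m n, forall k, p (m + k)%N = p' (n + k)%N.

Definition boundary_point e xi : Prop :=
  exists2 p, infinite_path e p &
    xi = [set p' | infinite_path e p' /\ path_equiv p p'].

(* The representative path of the boundary point xi that starts at t. *)
Definition path_to xi t : nat -> T :=
  xget (fun=> t) [set p | xi p /\ p 0%N = t].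

Definition merging xi s t : set (nat * nat) :=
  [set mn | forall k, path_to xi t (mn.1 + k)%N = path_to xi s (mn.2 + k)%N].

Definition min_merging xi s t : nat * nat :=
  xget (0%N, 0%N) [set mn | merging xi s t mn /\
    forall mn', merging xi s t mn' -> (mn.1 <= mn'.1)%N /\ (mn.2 <= mn'.2)%N].

Definition meet xi s t : T := path_to xi t (min_merging xi s t).1.

Definition dist xi s t : nat :=
  ((min_merging xi s t).1 + (min_merging xi s t).2)%N.

Definition preceq xi s t : bool :=
  (dist xi s (meet xi s t) <= dist xi t (meet xi s t))%N.

Definition asymp xi s t : bool :=
  dist xi s (meet xi s t) == dist xi t (meet xi s t).

Definition primitive_shifts xi (alpha : 'I_q -> T -> T) : Prop :=
  forall t, range (alpha^~ t) = [set s | preceq xi t s /\ dist xi t s = 1%N].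

(* The free semigroup on the shifts is seq 'I_q; it acts on the right, so the
   first letter of the word acts first. *)
Definition act (alpha : 'I_q -> T -> T) (t : T) (w : seq 'I_q) : T :=
  foldl (fun s j => alpha j s) t w.

End Tree.

Section Sums.
Variables (R : realType) (I : choiceType).

Definition abs_summable (f : I -> R[i]) : Prop :=
  (\esum_(i in [set: I]) (Normc.normc (f i))%:E < +oo)%E.

Definition rsum (f : I -> R) : R :=
  fine (\esum_(i in [set: I]) (Num.max (f i) 0)%:E) -
  fine (\esum_(i in [set: I]) (Num.max (- f i) 0)%:E).

(* Unordered sum; only meaningful on absolutely summable families. *)
Definition csum (f : I -> R[i]) : R[i] :=
  Complex (rsum (fun i => complex.Re (f i))) (rsum (fun i => complex.Im (f i))).

End Sums.

(* A pre-Hilbert space carried by a subset hdom of an ambient vector space; hip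
   is only relevant on hdom.  Operators on it are functions on the ambient space,
   of which only the restriction to hdom matters. *)
Record prehilbert (R : realType) (V : lmodType R[i]) := Prehilbert {
  hdom : set V;
  hip : V -> V -> R[i] }.

Section Hilbert.
Variables (R : realType) (V : lmodType R[i]) (H : prehilbert V).
Implicit Types (A B P : V -> V) (K : set V).

Definition hnorm (x : V) : R := Num.sqrt (complex.Re (hip H x x)).

Definition bounded_op A : Prop :=
  [/\ (forall x, hdom H x -> hdom H (A x)),
      (forall (a : R[i]) x y, hdom H x -> hdom H y ->
         A (a *: x + y) = a *: A x + A y) &
      exists M : R, forall x, hdom H x -> hnorm (A x) <= M * hnorm x].

Definition opnorm A : R :=
  sup [set hnorm (A x) | x in [set x | hdom H x /\ hnorm x <= 1]].

Definition is_adjoint A B : Prop :=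
  (forall y, hdom H y -> hdom H (B y)) /\
  (forall x y, hdom H x -> hdom H y -> hip H (A x) y = hip H x (B y)).

Definition adjoint A : V -> V := xget (fun=> 0) [set B | is_adjoint A B].

Definition is_pos_sqrt B P : Prop :=
  [/\ bounded_op P,
      (forall x, hdom H x -> 0 <= hip H (P x) x) &
      (forall x, hdom H x -> P (P x) = B x)].

Definition pos_sqrt B : V -> V := xget (fun=> 0) [set P | is_pos_sqrt B P].

Definition is_orth_proj K P : Prop :=
  forall x, hdom H x -> K (P x) /\ (forall y, K y -> hip H (x - P x) y = 0).

Definition orth_proj K : V -> V := xget (fun=> 0) [set P | is_orth_proj K P].

End Hilbert.

Definition hsum (R : realType) (V W : lmodType R[i])
    (H : prehilbert V) (K : prehilbert W) : prehilbert (V * W)%type :=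
  Prehilbert [set x | hdom H x.1 /\ hdom K x.2]
             (fun x y => hip H x.1 y.1 + hip K x.2 y.2).

Section L2.
Variables (R : realType) (T : choiceType).

(* R[i]^o is R[i] seen as a vector space over itself. *)
Definition l2pred : {pred T -> R[i]^o} :=
  fun f => (\esum_(t in [set: T]) (Normc.normc (f t) ^+ 2)%:E < +oo)%E.

Record l2 := L2 { l2val :> T -> R[i]^o; l2valP : l2val \in l2pred }.

HB.instance Definition _ := [isSub for l2val].
HB.instance Definition _ := [Choice of l2 by <:].

Lemma l2pred_submod : submod_closed l2pred.
Proof.
split=> [|a f g lf lg]; rewrite unfold_in /l2pred.
  by rewrite esum1 ?ltry// => t _; rewrite Normc.normc0 expr0n.
set A := 2 * Normc.normc a ^+ 2.
have A0 : 0 <= A by rewrite mulr_ge0 ?sqr_ge0.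
have sumZ (h : T -> R[i]^o) (c : R) : 0 <= c -> h \in l2pred ->
    (\esum_(t in [set: T]) (c * Normc.normc (h t) ^+ 2)%:E < +oo)%E.
  move=> c0 lh; apply: (@le_lt_trans _ _
      (c%:E * \esum_(t in [set: T]) (Normc.normc (h t) ^+ 2)%:E)%E).
    apply: ub_ereal_sup => _ [F [finF FT] <-].
    rewrite (eq_fsbigr (fun t => (c%:E * (Normc.normc (h t) ^+ 2)%:E)%E)); last first.
      by move=> t _; rewrite EFinM.
    rewrite -ge0_mule_fsumr; last by move=> t; rewrite lee_fin sqr_ge0.
    rewrite lee_wpmul2l ?lee_fin// -esum_fset//; last first.
      by move=> t _; rewrite lee_fin sqr_ge0.
    apply: esum_ge; exists F => //.
    by rewrite esum_fset// => t _; rewrite lee_fin sqr_ge0.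
  by rewrite lte_mul_pinfty // lee_fin.
apply: (@le_lt_trans _ _ (\esum_(t in [set: T])
   ((A * Normc.normc (f t) ^+ 2)%:E + (2 * Normc.normc (g t) ^+ 2)%:E))%E).
  apply: le_esum => t _; rewrite -EFinD lee_fin.
  have -> : (a *: f + g) t = a * f t + g t by [].
  have := le_normcD (a * f t) (g t); rewrite Normc.normcM.
  set x := Normc.normc a; set y := Normc.normc (f t); set z := Normc.normc (g t).
  move=> le; apply: (@le_trans _ _ ((x * y + z) ^+ 2)).
    by rewrite ler_sqr ?nnegrE ?(le_trans _ le) //; case: (_ + _) => u v /=; exact: sqrtr_ge0.
  rewrite /A -/x -mulrA -exprMn -subr_ge0.
  suff -> : 2 * (x * y) ^+ 2 + 2 * z ^+ 2 - (x * y + z) ^+ 2 = (x * y - z) ^+ 2.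
    exact: sqr_ge0.
  ring.
rewrite esumD; last 2 first.
- by move=> t _; rewrite lee_fin mulr_ge0 ?sqr_ge0.
- by move=> t _; rewrite lee_fin mulr_ge0 ?sqr_ge0.
by apply: lte_add_pinfty; apply: sumZ.
Qed.

HB.instance Definition _ :=
  GRing.isSubmodClosed.Build R[i] (T -> R[i]^o) l2pred l2pred_submod.
HB.instance Definition _ := [SubChoice_isSubLmodule of l2 by <:].

(* The function f as an element of l2, or 0 if f is not square summable. *)
Definition to_l2 (f : T -> R[i]^o) : l2 := insubd (0 : l2) f.

Definition chi (t : T) : l2 := to_l2 (fun s => (s == t)%:R).

Definition L2space : prehilbert l2 :=
  Prehilbert [set: l2] (fun f g => csum (fun t => f t * (g t)^*)).

End L2.

Section Operators.
Variables (R : realType) (T : choiceType) (q : nat).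
Variables (xi : set (nat -> T)) (alpha : 'I_q -> T -> T).

Local Notation op := (l2 R T -> l2 R T).
Local Notation L2space := (L2space R T).
Local Notation chi := (chi R).

Implicit Types (A F G S c d : op) (w v : seq 'I_q) (j : 'I_q).

(* The algebra X(T). *)
Definition bounded_operator A : Prop := bounded_op L2space A.

Definition adj A : op := adjoint L2space A.

Definition word_op w : op := fun f => to_l2 (fun t => f (act alpha t w)).

Definition shift_op j : op := word_op [:: j].

Definition causal A : Prop :=
  forall s (f : l2 R T), (forall t, preceq xi t s -> f t = 0) ->
    forall t, preceq xi t s -> A f t = 0.

(* The algebra H(T). *)
Definition causal_operator A : Prop := bounded_operator A /\ causal A.

(* The algebra of constants C. *)
Definition constant_operator A : Prop :=
  causal_operator A /\ causal_operator (adj A).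

(* The coefficient S_[w]: the constant with the given matrix entries. *)
Definition coef S w : op :=
  xget (fun=> 0) [set A | constant_operator A /\
    forall s t, A (chi t) s =
      if asymp xi t s then S (chi t) (act alpha s w) else 0].

Definition ptwise_abs_expansion S (X : seq 'I_q -> op) : Prop :=
  forall (f : l2 R T) (t : T),
    let a w : R[i] := adj (word_op w) (X w f) t in
    abs_summable a /\ csum a = S f t.

(* F^(0), the point evaluation at 0. *)
Definition eval0 F : op := coef F [::].

Definition trace_entry A (t : T) : R[i] := hip L2space (A (chi t)) (chi t).

Definition trace_class A : Prop := abs_summable (trace_entry A).

Definition trace A : R[i] := csum (trace_entry A).

(* trace_class is only applied to adj F \o F, whose diagonal entries are
   nonnegative, so that it says that the trace of adj F \o F is finite. *)
Definition H2 : prehilbert op :=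
  Prehilbert [set F | causal_operator F /\ trace_class (adj F \o F)]
             (fun F G => trace (adj G \o F)).

Definition C2 : prehilbert op :=
  Prehilbert [set F | constant_operator F /\ hdom H2 F] (hip H2).

Definition schur_multiplier S : Prop :=
  causal_operator S /\ opnorm L2space S <= 1.

Definition mulop S : op -> op := fun F => S \o F.

Definition defect S : op -> op :=
  fun F => F - mulop S (adjoint H2 (mulop S) F).

Definition sqrt_defect S : op -> op := pos_sqrt H2 (defect S).

Definition ker_proj S : op -> op :=
  orth_proj H2 [set F | hdom H2 F /\ defect S F = 0].

(* A preimage of F under sqrt_defect S, for F in its range. *)
Definition sqrt_preim S F : op :=
  xget 0 [set G | hdom H2 G /\ sqrt_defect S G = F].

(* The de Branges-Rovnyak space; the inner product is the one that induces the
   norm |sqrt_defect S G| = |G - ker_proj S G|_2. *)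
Definition dBR S : prehilbert op :=
  Prehilbert (sqrt_defect S @` hdom H2)
    (fun F G =>
       let F' := sqrt_preim S F in let G' := sqrt_preim S G in
       hip H2 (F' - ker_proj S F') (G' - ker_proj S G')).

Definition colA j F : op := (F - eval0 F) \o shift_op j.
Definition colB S j d : op := (S - eval0 S) \o d \o shift_op j.
Definition colC F : op := eval0 F.
Definition colD S d : op := eval0 S \o d.

Definition colV S j (x : op * op) : op * op :=
  (colA j x.1 + colB S j x.2, colC x.1 + colD S x.2).

(* A^v = A_{i_k} ... A_{i_1} for v = i_1 ... i_k. *)
Definition colA_word v F : op := foldl (fun G i => colA i G) F v.

End Operators.

(* Main.v *)
Require Import Defs.
From mathcomp Require Import all_boot all_order all_algebra.
From mathcomp Require Import complex finmap.
From mathcomp Require Import zify ring lra.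
From mathcomp Require Import boolp classical_sets functions cardinality fsbigop.
From mathcomp Require Import reals ereal topology normedtype sequences esum.

Set Implicit Arguments.
Unset Strict Implicit.
Unset Printing Implicit Defensive.

Import Order.TTheory GRing.Theory Num.Theory.
Import numFieldNormedType.Exports.

Local Open Scope classical_set_scope.
Local Open Scope ring_scope.

(** Grading the nodes by their level, the signed distance to a fixed horocycle, turns
    the tree into matrix combinatorics ([tree_leveled]). Causal operators are the
    bounded lower triangular matrices, constants are the block diagonal ones
    ([causal_operatorP], [constant_operatorP]), F^(0) is the block diagonal of F, and
    S_[w] is the block diagonal of w S ([coef_block_diag]). The causal Hilbert-Schmidt
    operators are the square-summable lower triangular matrices, a closed subspace of
    a space of square-summable families, and right multiplication by a bounded
    operator has right multiplication by its adjoint as adjoint ([H2_ip_compr]).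

    Write M for left multiplication by S, M' for its adjoint and P for the square root
    of 1 - M M'. Two facts about the range space H(S) of P carry the argument. An
    element F belongs to it as soon as |(G, F)| <= c |P G| for all G, and then its norm
    is at most c ([range_symmetric]); and its inner product satisfies
    (F, P P G)_H(S) = (F, G)_2 ([range_reproducing]).

    Write beta_j for the adjoint of alpha_j. For (F, d) in the direct sum put
    Y = F + S d. Then V_j (F, d) consists of (Y - Y^(0)) alpha_j and Y^(0) ([colVE]), and
    the inner product of the first of these with G is that of Y with G beta_j. The point
    is to compare M' with right multiplication by beta_j: for a constant y in C_2,
      M' (G beta_j + y) - (M' (G beta_j + y))^(0) = (M' G) beta_j,
    because both sides are strictly lower triangular and every strictly lower
    triangular H equals (H alpha_j) beta_j ([M'_adj_shift]). This identity gives
      |P (G beta_j)|^2 + |(M' (G beta_j))^(0)|^2 <= |P G|^2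
    ([energy]), hence the invariance of H(S) and the boundedness of V_j. It also gives,
    with K = G beta_j + y, the formula
      V_j^* (P P G, y) = (P P K, (M' K)^(0))
    ([adj_colV]); applying V_j to the right-hand side yields
    ((P P G) beta_j alpha_j, y). As the vectors (P P G, y) separate points, this is
    the coisometry relation ([colV_coisometry]).

    The identities of the second part reduce to alpha_j beta_j = I and to the
    compatibility of block diagonals with constants; that H(S) is stable under right
    multiplication by constants holds because these commute with M M', hence with its
    unique positive root P ([pos_sqrtP]). The third part is read off from matrix
    entries ([expansion], [coef_realisation]). *)

(** * Levels of a homogeneous tree *)

Section TreeLevels.
Local Open Scope nat_scope.
Variables (T : choiceType) (q : nat) (e : rel T) (xi : set (nat -> T)).
Hypothesis treeT : homogeneous_tree q e.
Hypothesis bd : boundary_point e xi.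

Let e_sym : symmetric e. Proof. by case: treeT. Qed.
Let e_irr : irreflexive e. Proof. by case: treeT. Qed.

(** Cutting a shortest closed walk out of a given one yields a simple cycle. *)
Lemma no_closed_walk (L : nat) (x : nat -> T) : 0 < L ->
  (forall k, k < L -> e (x k) (x k.+1)) ->
  (forall k, k.+1 < L -> x k != x k.+2) -> x 0 != x L.
Proof.
elim/ltn_ind: L x => L IH x L0 xe xb; apply/eqP => x0L.
have [[i [j [ij jL ijL xij]]]|H] := pselect (exists i j,
    [/\ i < j, j <= L, j - i < L & x i = x j]).
  have /eqP := IH (j - i) ijL (fun k => x (i + k)) ltac:(lia)
    (fun k kj => ltac:(rewrite /= addnS; apply: xe; lia))
    (fun k kj => ltac:(rewrite /= !addnS; apply: xb; lia)).
  by rewrite addn0 subnKC ?(ltnW ij).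
case: L L0 {IH} xe xb x0L H => // n _ xe xb x0L H.
have uc : ucycle e (mkseq x n.+1).
  apply/andP; split.
    rewrite /mkseq /= x0L.
    have -> : rcons [seq x i | i <- iota 1 n] (x n.+1) = [seq x i | i <- iota 1 n.+1].
      by rewrite -[in RHS](addn1 n) iotaD map_cat /= cats1 add1n.
    rewrite -x0L; apply/(pathP (x 0)) => i; rewrite size_map size_iota => iL.
    rewrite (nth_map 0) ?size_iota// nth_iota//.
    have -> : nth (x 0) (x 0 :: [seq x i | i <- iota 1 n.+1]) i = x i.
      case: i iL => // i iL; rewrite [LHS](nth_map 0) ?size_iota ?nth_iota//; lia.
    exact: xe.
  rewrite map_inj_in_uniq ?iota_uniq// => i j; rewrite !mem_iota => iL jL xij.
  apply: contrapT => /eqP; rewrite neq_ltn => /orP[] ltij; apply: H.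
    by exists i, j; split => //; lia.
  by exists j, i; split => //; lia.
have [_ _ _ /(_ _ uc)] := treeT; rewrite size_mkseq => + _.
case: n {uc} x0L xe xb H => [|[|n]]// x0L xe xb _.
  by have := xe 0 isT; rewrite -x0L e_irr.
by have := xb 0 isT; rewrite x0L eqxx.
Qed.

Lemma infinite_path_inj p : infinite_path e p -> injective p.
Proof.
move=> ip; suff H i j : i < j -> p i != p j.
  move=> i j pij; apply: contrapT => /eqP; rewrite neq_ltn.
  by case/orP => /H; rewrite pij eqxx.
move=> ij; have := @no_closed_walk (j - i) (fun k => p (i + k)) ltac:(lia).
rewrite addn0 subnKC ?(ltnW ij)//; apply.
  by move=> k _; rewrite addnS; case/and3P: (ip (i + k)).
by move=> k _; rewrite !addnS; case/and3P: (ip (i + k)).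
Qed.

Lemma infinite_path_shift p n :
  infinite_path e p -> infinite_path e (fun k => p (n + k)).
Proof. by move=> ip k; rewrite !addnS; exact: ip. Qed.

(** Two distinct equivalent paths from the same node would enclose a closed walk:
   down the first one from a common later node to the fork, and up the second. *)
Lemma infinite_path_unique p p' : infinite_path e p -> infinite_path e p' ->
  path_equiv p p' -> p 0 = p' 0 -> p = p'.
Proof.
move=> ip ip' [m [n pp']] p00; apply/funext => k.
elim/ltn_ind: k => -[//|i] IH; apply: contrapT => /eqP neq.
have pi : p i = p' i by apply: IH.
pose a := m + i.+1; pose b := n + i.+1.
have ab : p a = p' b by rewrite /a /b pp'.
have ai : i < a by rewrite /a; lia.
have bi : i < b by rewrite /b; lia.
move: a b ab ai bi => a b ab ai bi.
(* back along p from p a to the fork p i, then along p' to p' b = p a *)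
pose x k := if k <= a - i then p (a - k) else p' (i + (k - (a - i))).
have xE k : a - i <= k -> x k = p' (i + (k - (a - i))).
  move=> ak; rewrite /x; case: leqP => // ka.
  have -> : k = a - i by lia.
  by rewrite subnn addn0 -pi; congr p; lia.
have := @no_closed_walk ((a - i) + (b - i)) x ltac:(lia).
have -> : x 0 != x (a - i + (b - i)) = false.
  apply/negP/negP/eqP; rewrite (xE (_ + _)); last by lia.
  rewrite /x leq0n subn0 ab; congr p'; lia.
move=> H; suff: false by []; apply: H => k kL.
  have [ka|ka] := ltnP k (a - i).
    rewrite /x ka (ltnW ka) e_sym.
    have -> : a - k = (a - k.+1).+1 by lia.
    by case/and3P: (ip (a - k.+1)).
  rewrite !xE; try lia.
  have -> : i + (k.+1 - (a - i)) = (i + (k - (a - i))).+1 by lia.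
  by case/and3P: (ip' (i + (k - (a - i)))).
have [ka|ka] := ltnP k.+1 (a - i).
  rewrite /x ka ifT; last by lia.
  have -> : a - k = (a - k.+2).+2 by lia.
  by rewrite eq_sym; case/and3P: (ip (a - k.+2)).
have [ka'|ka'] := ltnP k (a - i); last first.
  rewrite !xE; try lia.
  have -> : i + (k.+2 - (a - i)) = (i + (k - (a - i))).+2 by lia.
  by case/and3P: (ip' (i + (k - (a - i)))).
rewrite (xE k.+2); last by lia.
rewrite /x (ltnW ka').
have -> : a - k = i.+1 by lia.
by have -> : i + (k.+2 - (a - i)) = i.+1 by lia.
Qed.

Lemma path_equiv_sym (p p' : nat -> T) : path_equiv p p' -> path_equiv p' p.
Proof. by move=> [m [n H]]; exists n, m => k; rewrite H. Qed.

Lemma path_equiv_trans (p1 p2 p3 : nat -> T) :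
  path_equiv p1 p2 -> path_equiv p2 p3 -> path_equiv p1 p3.
Proof.
move=> [m [n H]] [m' [n' H']]; exists (m + m'), (n' + n) => k.
by rewrite -addnA H addnCA H' addnA.
Qed.

Lemma xiP p p' : xi p -> xi p' -> path_equiv p p'.
Proof.
have [r ir ->] := bd => -[ip rp] [ip' rp'].
exact: path_equiv_trans (path_equiv_sym rp) rp'.
Qed.

Lemma xi_infinite p : xi p -> infinite_path e p.
Proof. by have [r ir ->] := bd => -[]. Qed.

Lemma xi_equiv p p' : infinite_path e p' -> path_equiv p p' -> xi p -> xi p'.
Proof.
have [r ir ->] := bd => ip' pp' [ip rp]; split => //.
exact: path_equiv_trans rp pp'.
Qed.

Lemma xi_shift p n : xi p -> xi (fun k => p (n + k)).
Proof.
move=> xp; apply: (xi_equiv _ _ xp); first exact/infinite_path_shift/xi_infinite.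
by exists n, 0.
Qed.

Lemma xi_cons s p : e s (p 0) -> s != p 1 -> xi p ->
  xi (fun k => if k is k'.+1 then p k' else s).
Proof.
move=> esp sp xp; have ip := xi_infinite xp.
apply: (xi_equiv _ _ xp); last by exists 0, 1.
case=> [|k]; last exact: ip.
by rewrite esp sp andbT /=; apply: contraTneq esp => ->; rewrite e_irr.
Qed.

Lemma xi_from t : exists p, xi p /\ p 0 = t.
Proof.
have [r ir rE] := bd.
have xr : xi r by rewrite rE; split => //; exists 0, 0.
have [_ _ conn _ _] := treeT; have [c] := conn (r 0) t.
elim/last_ind: c t => [|c s IH] t /=; first by move=> _ ->; exists r.
rewrite rcons_path last_rcons => /andP[ec es] ->.
have [p [xp p0]] := IH _ ec erefl; rewrite -p0 in es.
have [->|sp] := eqVneq s (p 1).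
  by exists (fun k => p (1 + k)); split => //; exact: xi_shift.
exists (fun k => if k is k'.+1 then p k' else s); split => //.
by apply: xi_cons => //; rewrite e_sym.
Qed.

Definition parent (t : T) : T := path_to xi t 1.

Lemma path_toP t : xi (path_to xi t) /\ path_to xi t 0 = t.
Proof.
rewrite /path_to; case: xgetP => [p ->//|H]; have [p pP] := xi_from t.
by case: (H p).
Qed.

Lemma path_to_unique t p : xi p -> p 0 = t -> path_to xi t = p.
Proof.
move=> xp p0; have [xt t0] := path_toP t.
by apply: infinite_path_unique; rewrite ?t0 ?p0//; [exact: xi_infinite..|exact: xiP].
Qed.

Lemma path_toE t k : path_to xi t k = iter k parent t.
Proof.
elim: k t => [|k IH] t; first by case: (path_toP t).
rewrite iterSr -IH; have [xt t0] := path_toP t.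
by rewrite (@path_to_unique (parent t) (fun k => path_to xi t (1 + k)))//; exact: xi_shift.
Qed.

Lemma iter_parent_inj t m n : iter m parent t = iter n parent t -> m = n.
Proof.
rewrite -!path_toE; have [xt _] := path_toP t.
exact/infinite_path_inj/xi_infinite.
Qed.

Lemma edge_parent t : e t (parent t).
Proof.
have [xt t0] := path_toP t.
by have /and3P[+ _ _] := xi_infinite xt 0; rewrite t0.
Qed.

Lemma neighboursP s t : e t s -> s != parent t -> parent s = t.
Proof.
move=> ets st; have [xt t0] := path_toP t.
rewrite /parent (@path_to_unique s (fun k => if k is k'.+1 then path_to xi t k' else s))//.
by apply: xi_cons => //; rewrite t0 e_sym.
Qed.

Lemma parent_merge s t : exists m n, iter m parent t = iter n parent s.
Proof.
have [[xs _] [xt _]] := (path_toP s, path_toP t).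
have [m [n H]] := xiP xt xs; exists m, n.
by rewrite -!path_toE; have := H 0; rewrite !addn0.
Qed.

Lemma mergingE s t m n : merging xi s t (m, n) <-> iter m parent t = iter n parent s.
Proof.
split => [/(_ 0)|E k]; first by rewrite /= !path_toE !addn0.
by rewrite /= !path_toE addnC iterD E -iterD addnC.
Qed.

Lemma merge_diff s t m n m' n' : iter m parent t = iter n parent s ->
  iter m' parent t = iter n' parent s -> m + n' = m' + n.
Proof.
move=> E E'; apply: (@iter_parent_inj t).
by rewrite addnC iterD E -iterD addnC iterD -E' -iterD addnC.
Qed.

Lemma min_mergingP s t : let mn := min_merging xi s t in
  iter mn.1 parent t = iter mn.2 parent s /\
  forall m n, iter m parent t = iter n parent s -> mn.1 <= m /\ mn.2 <= n.
Proof.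
rewrite /min_merging; case: xgetP => [[m n] _ [/mergingE H mnmin]|].
  by split => // m' n' /mergingE /mnmin.
have [m0 [n0 E0]] := parent_merge s t.
have ex : exists m, `[< exists n, iter m parent t = iter n parent s >].
  by exists m0; apply/asboolP; exists n0.
case: (ex_minnP ex) => m /asboolP[n E] mmin /(_ (m, n)) []; split.
  exact/mergingE.
move=> [m' n'] /mergingE E'; have mm' : m <= m'.
  by apply: mmin; apply/asboolP; exists n'.
by have := merge_diff E E'; split => //=; lia.
Qed.

Lemma min_mergingE s t m n : iter m parent t = iter n parent s -> m = 0 \/ n = 0 ->
  min_merging xi s t = (m, n).
Proof.
move=> E mn; have [/= E' /(_ _ _ E)] := min_mergingP s t.
case: (min_merging xi s t) E' => m' n' /= E' [mm nn].
by have := merge_diff E E'; case: mn => ?; subst => ?; congr (_, _); lia.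
Qed.

Lemma dist_meet s t : dist xi s (meet xi s t) = (min_merging xi s t).2 /\
  dist xi t (meet xi s t) = (min_merging xi s t).1.
Proof.
have [E _] := min_mergingP s t.
rewrite /dist /meet path_toE; split.
  by rewrite (@min_mergingE s _ 0 (min_merging xi s t).2 E (or_introl erefl)).
by rewrite (@min_mergingE t _ 0 (min_merging xi s t).1 erefl (or_introl erefl)).
Qed.

Lemma preceqP s t m n : iter m parent t = iter n parent s -> preceq xi s t = (n <= m).
Proof.
move=> E; rewrite /preceq; have [-> ->] := dist_meet s t.
have [E' _] := min_mergingP s t; have := merge_diff E E'; lia.
Qed.

Lemma asympP s t m n : iter m parent t = iter n parent s -> asymp xi s t = (n == m).
Proof.
move=> E; rewrite /asymp; have [-> ->] := dist_meet s t.
have [E' _] := min_mergingP s t; have := merge_diff E E'; lia.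
Qed.

(** The signed distance to the horocycle of a fixed node. *)
Lemma level_exists : exists lev : T -> int, forall s t m n,
  iter m parent t = iter n parent s -> (lev t - m%:Z = lev s - n%:Z)%R.
Proof.
have [r ir rE] := bd; pose t0 := r 0.
have H t : exists mn, iter mn.1 parent t = iter mn.2 parent t0.
  by have [m [n E]] := parent_merge t0 t; exists (m, n).
pose mn t := xget (0, 0) [set mn | iter mn.1 parent t = iter mn.2 parent t0].
have mnP t : iter (mn t).1 parent t = iter (mn t).2 parent t0.
  by rewrite /mn; case: xgetP => [? _ //|/=]; have [x Px] := H t; move=> /(_ x).
exists (fun t => (mn t).1%:Z - (mn t).2%:Z)%R => s t m n E.
have Es := mnP s; have Et := mnP t.
move: (mn s) (mn t) Es Et => [a b] [c d] /= Es Et.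
have E1 : iter (a + m) parent t = iter (n + b) parent t0.
  by rewrite iterD E -iterD addnC iterD Es -iterD.
have := merge_diff E1 Et; lia.
Qed.

Variable alpha : 'I_q -> T -> T.
Hypothesis alphaP : primitive_shifts xi alpha.

Lemma children_alpha t s : parent s = t <-> exists j, alpha j t = s.
Proof.
have sE := alphaP t; have -> : (exists j, alpha j t = s) = range (alpha^~ t) s.
  by apply/propext; split => -[j]; exists j.
rewrite sE /= /dist; split => [E|[]].
  have E1 : iter 1 parent s = iter 0 parent t by [].
  by rewrite (preceqP E1) (min_mergingE E1 (or_intror erefl)).
rewrite /preceq; have [-> ->] := dist_meet t s.
have [] := min_mergingP t s; case: (min_merging xi t s) => m n /= E _ nm mn1.
have [mE nE] : m = 1 /\ n = 0 by lia.
by move: E; rewrite mE nE.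
Qed.

(** A node has q children since it has q + 1 neighbours, so the q shifts reach each
   of them once. *)
Lemma alpha_inj t : injective (alpha^~ t).
Proof.
have [_ _ _ _ /(_ t) card] := treeT.
have nbE : [set s | e t s] = range (alpha^~ t) `|` [set parent t].
  apply/seteqP; split => s /=.
    move=> ets; have [->|sp] := eqVneq s (parent t); first by right.
    by left; have /children_alpha[j <-] := neighboursP ets sp; exists j.
  case=> [[j _ /(ex_intro (fun j => alpha j t = s) j)/children_alpha <-]|->].
    by rewrite e_sym; exact: edge_parent.
  exact: edge_parent.
move: card; rewrite nbE.
pose c := undup [seq alpha j t | j <- enum 'I_q].
have -> : range (alpha^~ t) `|` [set parent t] = [set` [fset x | x in parent t :: c]%fset].
  apply/seteqP; split => s /=; rewrite !inE mem_undup.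
    case=> [[j _ <-]|->]; last by rewrite eqxx.
    by apply/orP; right; apply/mapP; exists j; rewrite ?mem_enum.
  by case/orP => [/eqP ->|/mapP[j _ ->]]; [right|left; exists j].
move=> /card_eq_fsetP; rewrite card_fseq => cE.
have cq : q <= size c.
  by rewrite -ltnS -cE; exact: size_undup.
have : uniq [seq alpha j t | j <- enum 'I_q].
  by rewrite -[uniq _]negbK -ltn_size_undup -leqNgt size_map size_enum_ord.
by move=> u; apply/injectiveP; exact: u.
Qed.

End TreeLevels.

(** All that the operator theory uses of the tree: nodes are graded by level, and the
   shifts are injective maps raising the level by one whose ranges partition the
   nodes. *)
Record leveled (T : choiceType) (q : nat) (xi : set (nat -> T)) (alpha : 'I_q -> T -> T)
    (lev : T -> int) (par : T -> T) : Prop := Leveled {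
  preceq_lev : forall s t, preceq xi s t = (lev s <= lev t);
  asymp_lev : forall s t, asymp xi s t = (lev s == lev t);
  lev_alpha : forall j t, lev (alpha j t) = lev t + 1;
  par_alpha : forall j t, par (alpha j t) = t;
  alpha_par : forall t, exists j, alpha j (par t) = t;
  alpha_inj2 : forall t i j, alpha i t = alpha j t -> i = j }.

Lemma tree_leveled (T : choiceType) (q : nat) (e : rel T) (xi : set (nat -> T))
    (alpha : 'I_q -> T -> T) :
  homogeneous_tree q e -> boundary_point e xi -> primitive_shifts xi alpha ->
  exists lev par, leveled xi alpha lev par.
Proof.
move=> treeT bd alphaP; have [lev levP] := level_exists treeT bd.
have par_alpha j t : parent xi (alpha j t) = t.
  by apply/(children_alpha treeT bd alphaP); exists j.
exists lev, (parent xi); split => //.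
- move=> s t; have [m [n E]] := parent_merge treeT bd s t.
  by rewrite (preceqP treeT bd E); have := levP _ _ _ _ E; lia.
- move=> s t; have [m [n E]] := parent_merge treeT bd s t.
  by rewrite (asympP treeT bd E); have := levP _ _ _ _ E; lia.
- move=> j t; have E : iter 1 (parent xi) (alpha j t) = iter 0 (parent xi) t.
    by rewrite /= par_alpha.
  by have := levP _ _ _ _ E; lia.
- by move=> t; apply/(children_alpha treeT bd alphaP).
- by move=> t i j; exact: (alpha_inj treeT bd alphaP).
Qed.

(** * Unordered sums *)

Section NonnegSums.
Variable R : realType.

Definition nnsummable (I : choiceType) (a : I -> R) : Prop :=
  (\esum_(i in [set: I]) (a i)%:E < +oo)%E.

Definition nnsum (I : choiceType) (a : I -> R) : R :=
  fine (\esum_(i in [set: I]) (a i)%:E).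

Section OneIndex.
Variable (I : choiceType).
Implicit Types a b : I -> R.

Lemma nnsumE a : (forall i, 0 <= a i) -> nnsummable a ->
  (\esum_(i in [set: I]) (a i)%:E)%E = (nnsum a)%:E.
Proof.
move=> a0 sa; rewrite /nnsum fineK// ge0_fin_numE// esum_ge0// => i _.
by rewrite lee_fin.
Qed.

Lemma nnsum0 : nnsum (fun _ : I => 0) = 0.
Proof. by rewrite /nnsum esum1. Qed.

Lemma nnsum_ge0 a : (forall i, 0 <= a i) -> 0 <= nnsum a.
Proof. by move=> a0; apply/fine_ge0/esum_ge0 => i _; rewrite lee_fin. Qed.

Lemma nnsummable_le a b : (forall i, a i <= b i) -> nnsummable b -> nnsummable a.
Proof. by move=> ab; apply/le_lt_trans/le_esum => i _; rewrite lee_fin. Qed.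

Lemma nnsum_le a b : (forall i, 0 <= a i) -> (forall i, a i <= b i) ->
  nnsummable b -> nnsum a <= nnsum b.
Proof.
move=> a0 ab sb; rewrite -lee_fin -!nnsumE//; last 2 first.
- by move=> i; exact: le_trans (ab i).
- exact: nnsummable_le sb.
by apply: le_esum => i _; rewrite lee_fin.
Qed.

Lemma nnsummableD a b : (forall i, 0 <= a i) -> (forall i, 0 <= b i) ->
  nnsummable a -> nnsummable b -> nnsummable (fun i => a i + b i).
Proof.
move=> a0 b0 sa sb; rewrite /nnsummable.
under eq_esum do rewrite EFinD.
rewrite esumD; try by move=> i _; rewrite lee_fin.
exact: lte_add_pinfty.
Qed.

Lemma nnsumD a b : (forall i, 0 <= a i) -> (forall i, 0 <= b i) ->
  nnsummable a -> nnsummable b -> nnsum (fun i => a i + b i) = nnsum a + nnsum b.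
Proof.
move=> a0 b0 sa sb; apply: EFin_inj; rewrite EFinD -!nnsumE//; last 2 first.
- by move=> i; rewrite addr_ge0.
- exact: nnsummableD.
under eq_esum do rewrite EFinD.
by rewrite esumD// => i _; rewrite lee_fin.
Qed.

Lemma esumZ a (c : R) : (forall i, 0 <= a i) -> 0 <= c ->
  (\esum_(i in [set: I]) (c * a i)%:E = c%:E * \esum_(i in [set: I]) (a i)%:E)%E.
Proof.
move=> a0 c0.
have le (d : R) (b : I -> R) : (forall i, 0 <= b i) -> 0 <= d ->
    (\esum_(i in [set: I]) (d * b i)%:E <= d%:E * \esum_(i in [set: I]) (b i)%:E)%E.
  move=> b0 d0; apply: ge_ereal_sup => _ [F [finF FT] <-].
  rewrite (eq_fsbigr (fun t => (d%:E * (b t)%:E)%E)); last by move=> t _; rewrite EFinM.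
  rewrite -ge0_mule_fsumr; last by move=> t; rewrite lee_fin.
  by rewrite lee_wpmul2l ?lee_fin//; apply: esum_ge; exists F.
apply/eqP; rewrite eq_le le//=.
have [c00|/negbTE cn0] := eqVneq c 0.
  rewrite c00.
  by rewrite mul0e esum_ge0// => i _; rewrite mul0r.
have {cn0 c0}c0 : 0 < c by rewrite lt_neqAle eq_sym cn0.
rewrite -(@lee_pmul2l _ (c^-1)%:E) ?lte_fin ?invr_gt0//.
rewrite muleA -EFinM mulVf ?gt_eqF// mul1e.
have := le c^-1 (fun i => c * a i).
under [X in _ -> _ -> (X <= _)%E]eq_esum do rewrite mulrA mulVf ?gt_eqF// mul1r.
by apply=> [i|]; rewrite ?mulr_ge0// ?invr_ge0 ltW.
Qed.

Lemma nnsummableZ a (c : R) : (forall i, 0 <= a i) -> 0 <= c ->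
  nnsummable a -> nnsummable (fun i => c * a i).
Proof.
by move=> a0 c0 sa; rewrite /nnsummable esumZ// nnsumE// -EFinM ltry.
Qed.

Lemma nnsumZ a (c : R) : (forall i, 0 <= a i) -> 0 <= c -> nnsummable a ->
  nnsum (fun i => c * a i) = c * nnsum a.
Proof. by move=> a0 c0 sa; rewrite /nnsum esumZ// nnsumE// -EFinM. Qed.

Lemma esum_single (a : I -> \bar R) i0 : (0 <= a i0)%E ->
  (forall i, i != i0 -> a i = 0%E) -> \esum_(i in [set: I]) a i = a i0.
Proof.
move=> a0 ai; rewrite -(esum_set1 a0) [RHS]esum_mkcond; apply: eq_esum => i _.
case: ifPn => //; rewrite notin_setE/= => /eqP; exact: ai.
Qed.

Lemma nnsum_single a i0 : 0 <= a i0 -> (forall i, i != i0 -> a i = 0) ->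
  nnsummable a /\ nnsum a = a i0.
Proof.
move=> a0 ai; rewrite /nnsummable /nnsum (@esum_single _ i0) ?lee_fin ?ltry//.
by move=> i /ai ->.
Qed.

Lemma nnsum_ge a i0 : (forall i, 0 <= a i) -> nnsummable a -> a i0 <= nnsum a.
Proof.
move=> a0 sa; pose b i := if i == i0 then a i else 0.
have [] := @nnsum_single b i0; rewrite /b ?eqxx//; first by move=> i /negPf ->.
move=> _ <-; apply: nnsum_le => // i; case: ifP => //.
Qed.

Lemma nnsum_eq0 a : (forall i, 0 <= a i) -> nnsummable a -> nnsum a = 0 ->
  forall i, a i = 0.
Proof.
by move=> a0 sa sa0 i; apply/eqP; rewrite eq_le a0 andbT -sa0 nnsum_ge.
Qed.

(** The positive and negative parts that define a real sum may be replaced by any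
   decomposition into summable nonnegative families. *)
Lemma rsumB a b : (forall i, 0 <= a i) -> (forall i, 0 <= b i) ->
  nnsummable a -> nnsummable b -> rsum (fun i => a i - b i) = nnsum a - nnsum b.
Proof.
move=> a0 b0 sa sb; rewrite /rsum -/(nnsum _) -/(nnsum _).
set p := fun i => _; set m := (X in _ - nnsum X).
have p0 i : 0 <= p i by rewrite /p le_max lexx orbT.
have m0 i : 0 <= m i by rewrite /m le_max lexx orbT.
have sp : nnsummable p.
  by apply: nnsummable_le sa => i; rewrite /p ge_max a0 andbT gerBl.
have sm : nnsummable m.
  by apply: nnsummable_le sb => i; rewrite /m ge_max b0 andbT opprB gerBl.
suff : nnsum (fun i => p i + b i) = nnsum (fun i => a i + m i).
  rewrite !nnsumD//; lra.
congr nnsum; apply/funext => i; rewrite /p /m.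
by case: (leP (a i - b i) 0) => h; case: leP => h'; lra.
Qed.

End OneIndex.

Section TwoIndices.
Variables (I J : choiceType).

(** Tonelli: no summability is required of extended nonnegative sums. *)
Lemma esum_pair (f : I * J -> R) : (forall p, 0 <= f p) ->
  (\esum_(p in [set: I * J]) (f p)%:E =
   \esum_(i in [set: I]) \esum_(j in [set: J]) (f (i, j))%:E)%E.
Proof.
move=> f0; rewrite (@esum_esum _ _ _ [set: I] (fun=> [set: J])
  (fun i j => (f (i, j))%:E)); last by move=> *; rewrite lee_fin.
have -> : [set: I] `*`` (fun=> [set: J]) = [set: I * J].
  by apply/seteqP; split.
by apply: eq_esum => -[].
Qed.

Lemma nnsum_pair (f : I * J -> R) : (forall p, 0 <= f p) -> nnsummable f ->
  [/\ forall i, nnsummable (fun j => f (i, j)),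
      nnsummable (fun i => nnsum (fun j => f (i, j))) &
      nnsum f = nnsum (fun i => nnsum (fun j => f (i, j)))].
Proof.
move=> f0 sf; have E := esum_pair f0.
have s1 i : nnsummable (fun j => f (i, j)).
  apply: le_lt_trans sf; rewrite E.
  have -> : (\esum_(j in [set: J]) (f (i, j))%:E =
      \esum_(k in [set i]) \esum_(j in [set: J]) (f (k, j))%:E)%E.
    by rewrite esum_set1// esum_ge0// => *; rewrite lee_fin.
  rewrite esum_mkcond; apply: le_esum => k _; case: ifP => // _.
  by rewrite esum_ge0// => *; rewrite lee_fin.
have E' : (\esum_(p in [set: I * J]) (f p)%:E =
    \esum_(i in [set: I]) (nnsum (fun j => f (i, j)))%:E)%E.
  by rewrite E; apply: eq_esum => i _; rewrite nnsumE.
by split => //; rewrite /nnsummable /nnsum -E'.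
Qed.

Lemma nnsummable_pair (f : I * J -> R) : (forall p, 0 <= f p) ->
  (forall i, nnsummable (fun j => f (i, j))) ->
  nnsummable (fun i => nnsum (fun j => f (i, j))) -> nnsummable f.
Proof.
move=> f0 s1 s2; apply: le_lt_trans s2; rewrite esum_pair//.
by apply: le_esum => i _; rewrite nnsumE.
Qed.

Lemma esum_swap (f : I * J -> R) :
  (\esum_(p in [set: J * I]) (f (p.2, p.1))%:E = \esum_(p in [set: I * J]) (f p)%:E)%E.
Proof.
rewrite (reindex_esum [set: J * I] _ (fun x => (x.2, x.1)))//; split => //=.
  by move=> [i j] [k l] /= _ _ [-> ->].
by move=> [i j] _; exists (j, i).
Qed.

Lemma nnsum_inj (e : J -> I) (a : I -> R) : injective e -> (forall i, 0 <= a i) ->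
  nnsummable a -> nnsummable (fun j => a (e j)) /\ nnsum (fun j => a (e j)) <= nnsum a.
Proof.
move=> einj a0 sa.
have H : (\esum_(j in [set: J]) (a (e j))%:E <= \esum_(i in [set: I]) (a i)%:E)%E.
  rewrite -(@esum_image _ _ _ [set: J] e (fun i => (a i)%:E)); last by move=> ? ? _ _ /einj.
  rewrite esum_mkcond; apply: le_esum => i _; case: ifP => //; rewrite lee_fin//.
have sae := le_lt_trans H sa; split => //.
by rewrite -lee_fin -!nnsumE.
Qed.

End TwoIndices.

End NonnegSums.

Section ComplexSums.
Variable R : realType.
Local Notation C := R[i].
Local Notation normc := (Normc.normc).
Local Notation "x %:C" := (real_complex R x).

Lemma normc_ge0 (z : C) : 0 <= normc z.
Proof. by case: z => x y; exact: sqrtr_ge0. Qed.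

Lemma normc_conj (z : C) : normc z^* = normc z.
Proof. by case: z => x y /=; rewrite sqrrN. Qed.

Lemma normc_real (x : R) : normc x%:C = `|x|.
Proof. by rewrite /= expr0n addr0 sqrtr_sqr. Qed.

Lemma sqr_normcE (z : C) : normc z ^+ 2 = complex.Re z ^+ 2 + complex.Im z ^+ 2.
Proof. by case: z => x y /=; rewrite sqr_sqrtr// addr_ge0 ?sqr_ge0. Qed.

Lemma Re_le_normc (z : C) : `|complex.Re z| <= normc z.
Proof.
rewrite -ler_sqr ?nnegrE ?normr_ge0 ?normc_ge0// sqr_normcE real_normK ?num_real//.
by rewrite lerDl sqr_ge0.
Qed.

Lemma Im_le_normc (z : C) : `|complex.Im z| <= normc z.
Proof.
rewrite -ler_sqr ?nnegrE ?normr_ge0 ?normc_ge0// sqr_normcE real_normK ?num_real//.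
by rewrite lerDr sqr_ge0.
Qed.

Lemma normc_le (z : C) : normc z <= `|complex.Re z| + `|complex.Im z|.
Proof.
rewrite -ler_sqr ?nnegrE ?addr_ge0 ?normr_ge0 ?normc_ge0// sqr_normcE.
rewrite sqrrD !real_normK ?num_real// addrAC lerDl mulrn_wge0// mulr_ge0//.
Qed.

Lemma mulc_conj (z : C) : z * z^* = (normc z ^+ 2)%:C.
Proof.
rewrite sqr_normcE; case: z => x y; apply/eqP; rewrite eq_complex /=.
by apply/andP; split; apply/eqP; ring.
Qed.

Section OneIndex.
Variable I : choiceType.
Implicit Types (f g : I -> C).

Let pos (a : I -> R) i := Num.max (a i) 0.
Let neg (a : I -> R) i := Num.max (- a i) 0.

Lemma rsum_posneg (a : I -> R) (b : I -> R) : (forall i, `|a i| <= b i) -> nnsummable b ->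
  exists p m, [/\ forall i, a i = p i - m i, forall i, 0 <= p i <= b i,
    forall i, 0 <= m i <= b i, nnsummable p /\ nnsummable m &
    rsum a = nnsum p - nnsum m].
Proof.
move=> ab sb; exists (pos a), (neg a).
have pb i : 0 <= pos a i <= b i.
  rewrite le_max lexx orbT ge_max (le_trans (normr_ge0 (a i)))// andbT.
  exact: le_trans (ler_norm _) (ab i).
have nb i : 0 <= neg a i <= b i.
  rewrite le_max lexx orbT ge_max (le_trans (normr_ge0 (a i)))// andbT.
  by apply: le_trans (ab i); rewrite -normrN ler_norm.
split => //; last by split; apply: nnsummable_le sb => i;
  [case/andP: (pb i)|case/andP: (nb i)].
by move=> i; rewrite /pos /neg; case: (leP (a i) 0) => h; case: leP => h'; lra.
Qed.

Lemma rsumD (a b : I -> R) : nnsummable (fun i => `|a i|) -> nnsummable (fun i => `|b i|) ->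
  rsum (fun i => a i + b i) = rsum a + rsum b.
Proof.
move=> sa sb.
have [p [m [am p0 m0 [sp sm] ->]]] := rsum_posneg (fun i => lexx _) sa.
have [p' [m' [bm p0' m0' [sp' sm'] ->]]] := rsum_posneg (fun i => lexx _) sb.
have -> : (fun i => a i + b i) = fun i => (p i + p' i) - (m i + m' i).
  by apply/funext => i; rewrite am bm; ring.
have p1 i : 0 <= p i by case/andP: (p0 i).
have p1' i : 0 <= p' i by case/andP: (p0' i).
have m1 i : 0 <= m i by case/andP: (m0 i).
have m1' i : 0 <= m' i by case/andP: (m0' i).
rewrite rsumB; do ?[by move=> i; rewrite addr_ge0|exact: nnsummableD].
by rewrite !nnsumD//; ring.
Qed.

Lemma rsumN (a : I -> R) : rsum (fun i => - a i) = - rsum a.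
Proof.
rewrite /rsum opprB; congr (_ - fine _); apply: eq_esum => i _.
by rewrite opprK.
Qed.

Lemma rsumZ (a : I -> R) c : nnsummable (fun i => `|a i|) ->
  rsum (fun i => c * a i) = c * rsum a.
Proof.
wlog c0 : c / 0 <= c => [H|] sa.
  have [c0|c0] := leP 0 c; first exact: H.
  rewrite -[c]opprK mulNr -(H (- c))//; last by lra.
  by rewrite -rsumN; congr rsum; apply/funext => i; rewrite !mulNr.
have [p [m [am p0 m0 [sp sm] ->]]] := rsum_posneg (fun i => lexx _) sa.
have p1 i : 0 <= p i by case/andP: (p0 i).
have m1 i : 0 <= m i by case/andP: (m0 i).
have -> : (fun i => c * a i) = fun i => (c * p i) - (c * m i).
  by apply/funext => i; rewrite am; ring.
rewrite rsumB; do ?[by move=> i; rewrite mulr_ge0|exact: nnsummableZ].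
by rewrite !nnsumZ//; ring.
Qed.

Lemma rsum_nneg (a : I -> R) : (forall i, 0 <= a i) -> nnsummable a -> rsum a = nnsum a.
Proof.
move=> a0 sa; rewrite -[RHS]subr0 -[X in _ - X](@nnsum0 R I) -rsumB//.
- by congr rsum; apply/funext => i; rewrite subr0.
- by rewrite /nnsummable esum1 ?ltry.
Qed.

Lemma normr_rsum (a : I -> R) (b : I -> R) : (forall i, `|a i| <= b i) -> nnsummable b ->
  `|rsum a| <= nnsum b.
Proof.
move=> ab sb; have [p [m [am p0 m0 [sp sm] ->]]] := rsum_posneg ab sb.
have p1 i : 0 <= p i by case/andP: (p0 i).
have m1 i : 0 <= m i by case/andP: (m0 i).
have := nnsum_ge0 p1; have := nnsum_ge0 m1.
have : nnsum p <= nnsum b by apply: nnsum_le => // i; case/andP: (p0 i).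
have : nnsum m <= nnsum b by apply: nnsum_le => // i; case/andP: (m0 i).
rewrite ler_norml => *; lra.
Qed.

Lemma abs_summable_le f (b : I -> R) : (forall i, normc (f i) <= b i) ->
  nnsummable b -> abs_summable f.
Proof. exact: nnsummable_le. Qed.

Lemma abs_summable_Re f : abs_summable f -> nnsummable (fun i => `|complex.Re (f i)|).
Proof. by apply: nnsummable_le => i; exact: Re_le_normc. Qed.

Lemma abs_summable_Im f : abs_summable f -> nnsummable (fun i => `|complex.Im (f i)|).
Proof. by apply: nnsummable_le => i; exact: Im_le_normc. Qed.

Lemma abs_summableZ (a : C) f : abs_summable f -> abs_summable (fun i => a * f i).
Proof.
move=> sf; rewrite /abs_summable; under eq_esum do rewrite Normc.normcM.
by apply: (nnsummableZ (a := fun i => normc (f i))) => // *; exact: normc_ge0.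
Qed.

Lemma eq_csum f g : (forall i, f i = g i) -> csum f = csum g.
Proof. by move=> fg; have -> : f = g by exact/funext. Qed.

Lemma csumD f g : abs_summable f -> abs_summable g ->
  csum (fun i => f i + g i) = csum f + csum g.
Proof.
move=> sf sg; rewrite /csum.
have -> : (fun i => complex.Re (f i + g i)) = (fun i => complex.Re (f i) + complex.Re (g i)).
  by apply/funext => i; case: (f i) (g i) => ? ? [].
have -> : (fun i => complex.Im (f i + g i)) = (fun i => complex.Im (f i) + complex.Im (g i)).
  by apply/funext => i; case: (f i) (g i) => ? ? [].
rewrite (rsumD (abs_summable_Re sf) (abs_summable_Re sg)).
by rewrite (rsumD (abs_summable_Im sf) (abs_summable_Im sg)).
Qed.

Lemma csumZ (a : C) f : abs_summable f -> csum (fun i => a * f i) = a * csum f.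
Proof.
move=> sf; case: a => x y; rewrite /csum.
have sR := abs_summable_Re sf; have sI := abs_summable_Im sf.
have sZ (c : R) (b : I -> R) : nnsummable (fun i => `|b i|) -> nnsummable (fun i => `|c * b i|).
  move=> sb; rewrite (_ : (fun i => _) = (fun i => `|c| * `|b i|)).
    exact: nnsummableZ.
  by apply/funext => i; rewrite normrM.
have -> : (fun i => complex.Re (Complex x y * f i)) =
    (fun i => x * complex.Re (f i) + (- y) * complex.Im (f i)).
  by apply/funext => i; case: (f i) => u v /=; rewrite mulNr.
have -> : (fun i => complex.Im (Complex x y * f i)) =
    (fun i => x * complex.Im (f i) + y * complex.Re (f i)).
  by apply/funext => i; case: (f i) => u v.
rewrite !rsumD; do ?exact: sZ.
rewrite !rsumZ//; apply/eqP; rewrite eq_complex /= mulNr !eqxx //.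
Qed.

Lemma csum_conj f : csum (fun i => (f i)^*) = (csum f)^*.
Proof.
rewrite /csum; apply/eqP; rewrite eq_complex /=; apply/andP; split; apply/eqP.
  by congr rsum; apply/funext => i; case: (f i).
by rewrite -rsumN; congr rsum; apply/funext => i; case: (f i).
Qed.

Lemma csum_nneg (a : I -> R) : (forall i, 0 <= a i) -> nnsummable a ->
  csum (fun i => (a i)%:C) = (nnsum a)%:C.
Proof.
move=> a0 sa; rewrite /csum /= rsum_nneg//; congr Complex.
have := @rsum_nneg (fun=> 0 : R); rewrite /nnsum /nnsummable esum1// => -> //.
Qed.

Lemma normc_csum f : abs_summable f ->
  normc (csum f) <= 2 * nnsum (fun i => normc (f i)).
Proof.
move=> sf; apply: le_trans (normc_le _) _; rewrite /csum /=.
rewrite [2 * _](_ : _ = nnsum (fun i => normc (f i)) + nnsum (fun i => normc (f i))); last by ring.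
apply: lerD; apply: normr_rsum => //.
  by move=> i; exact: Re_le_normc.
by move=> i; exact: Im_le_normc.
Qed.

Lemma csum_single f i0 : (forall i, i != i0 -> f i = 0) ->
  abs_summable f /\ csum f = f i0.
Proof.
move=> f0; split.
  have [] // := @nnsum_single R I (fun i => normc (f i)) i0 (normc_ge0 _).
  by move=> i /f0 ->; exact: Normc.normc0.
have H (a : I -> R) : (forall i, i != i0 -> a i = 0) -> rsum a = a i0.
  move=> a0; rewrite /rsum -/(nnsum _) -/(nnsum _).
  have [_ ->] := @nnsum_single R I (fun i => Num.max (a i) 0) i0 ltac:(by rewrite /= le_max lexx orbT)
    ltac:(by move=> i /a0 -> /=; rewrite maxxx).
  have [_ ->] := @nnsum_single R I (fun i => Num.max (- a i) 0) i0 ltac:(by rewrite /= le_max lexx orbT)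
    ltac:(by move=> i /a0 -> /=; rewrite oppr0 maxxx).
  by case: (leP (a i0) 0) => h; case: leP => h'; lra.
by rewrite /csum !H; [case: (f i0)|move=> i /f0 ->..].
Qed.

Lemma csum0 : csum (fun _ : I => 0 : C) = 0.
Proof.
have := @csum_nneg (fun=> 0) (fun=> lexx 0); rewrite /nnsummable /nnsum esum1// => -> //.
Qed.

End OneIndex.

Section TwoIndices.
Variables I J : choiceType.

Lemma rsum_pair (f : I * J -> R) : nnsummable (fun p => `|f p|) ->
  rsum f = rsum (fun i => rsum (fun j => f (i, j))).
Proof.
move=> sf; have [p [m [fE p0 m0 [sp sm] ->]]] := rsum_posneg (fun i => lexx _) sf.
have p1 i : 0 <= p i by case/andP: (p0 i).
have m1 i : 0 <= m i by case/andP: (m0 i).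
have [p2 p3 ->] := nnsum_pair p1 sp; have [m2 m3 ->] := nnsum_pair m1 sm.
rewrite -rsumB//; try by move=> i; apply: nnsum_ge0.
congr rsum; apply/funext => i; rewrite -rsumB//.
by congr rsum; apply/funext => j; rewrite fE.
Qed.

(** Fubini, by applying Tonelli to the positive and negative parts of the real and
    imaginary parts. *)
Lemma csum_pair (f : I * J -> C) : abs_summable f ->
  [/\ forall i, abs_summable (fun j => f (i, j)),
      abs_summable (fun i => csum (fun j => f (i, j))) &
      csum f = csum (fun i => csum (fun j => f (i, j)))].
Proof.
move=> sf; have [s1 s2 _] := nnsum_pair (fun=> normc_ge0 _) sf.
split => //; last first.
  by rewrite /csum (rsum_pair (abs_summable_Re sf)) (rsum_pair (abs_summable_Im sf)).
apply: (@abs_summable_le _ _ (fun i => 2 * nnsum (fun j => normc (f (i, j))))).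
  by move=> i; exact: (normc_csum (s1 i)).
apply: nnsummableZ => // i; apply: nnsum_ge0 => j; exact: normc_ge0.
Qed.

Lemma abs_summable_swap (f : I * J -> C) : abs_summable f ->
  abs_summable (fun p : J * I => f (p.2, p.1)).
Proof. by rewrite /abs_summable (esum_swap (fun p => normc (f p))). Qed.

Lemma csum_swap (f : I * J -> C) : csum (fun p : J * I => f (p.2, p.1)) = csum f.
Proof.
rewrite /csum /rsum.
by rewrite !(esum_swap (fun p => Num.max (complex.Re (f p)) 0))
  !(esum_swap (fun p => Num.max (complex.Im (f p)) 0))
  !(esum_swap (fun p => Num.max (- complex.Re (f p)) 0))
  !(esum_swap (fun p => Num.max (- complex.Im (f p)) 0)).
Qed.

End TwoIndices.
End ComplexSums.

(** * Inner product spaces *)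

Section RealLimits.
Variable R : realType.
Implicit Types a b : nat -> R.

Lemma le0_cvg0 (x : R) a : a @ \oo --> (0 : R) -> (forall n, x <= a n) -> x <= 0.
Proof.
move=> a0 xa; rewrite -(cvg_lim _ a0)//; apply: limr_ge; first exact: cvgP a0.
by apply: nearW => n; exact: xa.
Qed.

Lemma cvg0D a b : a @ \oo --> (0 : R) -> b @ \oo --> (0 : R) ->
  (fun n => a n + b n) @ \oo --> (0 : R).
Proof. by move=> a0 b0; rewrite -[X in _ --> X](addr0 (0 : R)); apply: cvgD. Qed.

Lemma cvg0Z a (c : R) : a @ \oo --> (0 : R) -> (fun n => c * a n) @ \oo --> (0 : R).
Proof. by move=> a0; rewrite -[X in _ --> X](mulr0 c); apply: cvgMr. Qed.

Lemma cvg0_harmonic : (fun n => n.+1%:R^-1 : R) @ \oo --> (0 : R).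
Proof. exact: cvg_harmonic. Qed.

End RealLimits.

Lemma addr_idem_eq0 (V : zmodType) (x : V) : x = x + x -> x = 0.
Proof. by move=> /esym/eqP; rewrite -subr_eq0 addrK => /eqP. Qed.

Section InnerProduct.
Variables (R : realType) (V : lmodType R[i]) (H : prehilbert V).
Local Notation C := R[i].
Local Notation normc := (Normc.normc).
Local Notation "x %:C" := (real_complex R x).
Local Notation dom := (hdom H).
Local Notation ip := (hip H).
Local Notation nrm := (hnorm H).

Record inner_product_space : Prop := InnerProductSpace {
  ips_dom0 : dom 0;
  ips_dom : forall (a : C) x y, dom x -> dom y -> dom (a *: x + y);
  ips_lin : forall (a : C) x y z, dom x -> dom y -> dom z ->
    ip (a *: x + y) z = a * ip x z + ip y z;
  ips_conj : forall x y, dom x -> dom y -> ip y x = (ip x y)^*;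
  ips_ge0 : forall x, dom x -> 0 <= ip x x;
  ips_eq0 : forall x, dom x -> ip x x = 0 -> x = 0 }.

Hypothesis ipH : inner_product_space.

Lemma dom0 : dom 0. Proof. exact: ips_dom0. Qed.

Lemma domD x y : dom x -> dom y -> dom (x + y).
Proof. by move=> dx dy; rewrite -[x]scale1r; exact: ips_dom. Qed.

Lemma domZ (a : C) x : dom x -> dom (a *: x).
Proof. by move=> dx; rewrite -[_ *: _]addr0; apply: ips_dom => //; exact: dom0. Qed.

Lemma domN x : dom x -> dom (- x).
Proof. by move=> dx; rewrite -scaleN1r; exact: domZ. Qed.

Lemma domB x y : dom x -> dom y -> dom (x - y).
Proof. by move=> dx dy; apply: domD => //; exact: domN. Qed.

Hint Resolve dom0 domD domZ domN domB : core.

Lemma ipDl x y z : dom x -> dom y -> dom z -> ip (x + y) z = ip x z + ip y z.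
Proof. by move=> dx dy dz; rewrite -[x]scale1r ips_lin// mul1r scale1r. Qed.

Lemma ip0l z : dom z -> ip 0 z = 0.
Proof.
by move=> dz; apply: addr_idem_eq0; rewrite -(ipDl dom0 dom0 dz) addr0.
Qed.

Lemma ipZl (a : C) x z : dom x -> dom z -> ip (a *: x) z = a * ip x z.
Proof. by move=> dx dz; rewrite -[_ *: _]addr0 ips_lin// ip0l// addr0. Qed.

Lemma ipNl x z : dom x -> dom z -> ip (- x) z = - ip x z.
Proof. by move=> dx dz; rewrite -scaleN1r ipZl// mulN1r. Qed.

Lemma ipBl x y z : dom x -> dom y -> dom z -> ip (x - y) z = ip x z - ip y z.
Proof. by move=> dx dy dz; rewrite ipDl// ?ipNl//; exact: domN. Qed.

Lemma ipDr x y z : dom x -> dom y -> dom z -> ip z (x + y) = ip z x + ip z y.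
Proof.
move=> dx dy dz; rewrite ips_conj//; last exact: domD.
by rewrite ipDl// rmorphD/= -!ips_conj.
Qed.

Lemma ip0r z : dom z -> ip z 0 = 0.
Proof. by move=> dz; rewrite ips_conj// ip0l// conjC0. Qed.

Lemma ipZr (a : C) x z : dom x -> dom z -> ip z (a *: x) = a^* * ip z x.
Proof.
move=> dx dz; rewrite ips_conj//; last exact: domZ.
by rewrite ipZl// rmorphM/= -ips_conj.
Qed.

Lemma ipNr x z : dom x -> dom z -> ip z (- x) = - ip z x.
Proof. by move=> dx dz; rewrite -scaleN1r ipZr// rmorphN1 mulN1r. Qed.

Lemma ipBr x y z : dom x -> dom y -> dom z -> ip z (x - y) = ip z x - ip z y.
Proof. by move=> dx dy dz; rewrite ipDr// ?ipNr//; exact: domN. Qed.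

Lemma nrm_ge0 x : 0 <= nrm x. Proof. exact: sqrtr_ge0. Qed.

Lemma sqr_nrm x : dom x -> nrm x ^+ 2 = complex.Re (ip x x).
Proof.
by move=> dx; rewrite sqr_sqrtr//; have := ips_ge0 ipH dx; rewrite lecE /= => /andP[].
Qed.

Lemma ipxx x : dom x -> ip x x = (nrm x ^+ 2)%:C.
Proof.
move=> dx; rewrite sqr_nrm//; have := ips_ge0 ipH dx.
by rewrite lecE /=; case: (ip x x) => a b /= /andP[/eqP ->].
Qed.

Lemma nrm0 : nrm 0 = 0.
Proof. by rewrite /hnorm ip0l// sqrtr0. Qed.

Lemma nrm_eq0 x : dom x -> nrm x = 0 -> x = 0.
Proof.
by move=> dx nx; apply: (ips_eq0 ipH) => //; rewrite ipxx// nx expr0n.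
Qed.

Lemma nrm_le0 x : dom x -> nrm x <= 0 -> x = 0.
Proof. by move=> dx nx; apply: nrm_eq0 => //; apply: le_anti; rewrite nx nrm_ge0. Qed.

Lemma ip_ext x y : dom x -> dom y -> (forall z, dom z -> ip x z = ip y z) -> x = y.
Proof.
move=> dx dy xy; apply/eqP; rewrite -subr_eq0; apply/eqP.
by apply: (ips_eq0 ipH); [exact: domB|rewrite ipBl ?xy ?subrr//; exact: domB].
Qed.

Lemma nrmZ (a : C) x : dom x -> nrm (a *: x) = normc a * nrm x.
Proof.
move=> dx; apply/eqP; rewrite -(@eqrXn2 _ 2)// ?mulr_ge0 ?nrm_ge0 ?normc_ge0//.
apply/eqP/complexI; rewrite -ipxx; last exact: domZ.
rewrite ipZl//; last exact: domZ.
rewrite ipZr// mulrA mulc_conj ipxx//.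
by rewrite exprMn [in RHS]rmorphM.
Qed.

Lemma nrmN x : dom x -> nrm (- x) = nrm x.
Proof.
by move=> dx; rewrite -scaleN1r nrmZ// normcN Normc.normc1 mul1r.
Qed.

Lemma nrmBC x y : dom x -> dom y -> nrm (x - y) = nrm (y - x).
Proof. by move=> dx dy; rewrite -opprB nrmN//; exact: domB. Qed.

Lemma Re_ipC x y : dom x -> dom y -> complex.Re (ip y x) = complex.Re (ip x y).
Proof. by move=> dx dy; rewrite ips_conj//; case: (ip x y). Qed.

Lemma sqr_nrmD x y : dom x -> dom y ->
  nrm (x + y) ^+ 2 = nrm x ^+ 2 + nrm y ^+ 2 + 2 * complex.Re (ip x y).
Proof.
move=> dx dy; rewrite !sqr_nrm//; last exact: domD.
rewrite ipDl ?ipDr//; try exact: domD.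
have ReD (u v : C) : complex.Re (u + v) = complex.Re u + complex.Re v by case: u v => ? ? [].
by rewrite !ReD (Re_ipC dx dy); ring.
Qed.

Lemma sqr_nrmB x y : dom x -> dom y ->
  nrm (x - y) ^+ 2 = nrm x ^+ 2 + nrm y ^+ 2 - 2 * complex.Re (ip x y).
Proof.
move=> dx dy; rewrite sqr_nrmD//; last exact: domN.
by rewrite nrmN// ipNr//; case: (ip x y) => a b /=; ring.
Qed.

(** Cauchy-Schwarz, from the positivity of |x - t b y|^2 with b the inner product. *)
Lemma normc_ip x y : dom x -> dom y -> normc (ip x y) <= nrm x * nrm y.
Proof.
move=> dx dy; have [y0|y0] := eqVneq (nrm y) 0.
  by rewrite y0 (nrm_eq0 dy y0) ip0r// Normc.normc0 mulr0.
have yp : 0 < nrm y by rewrite lt_neqAle eq_sym y0 nrm_ge0.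
rewrite -ler_sqr ?nnegrE ?mulr_ge0 ?nrm_ge0 ?normc_ge0//.
(* x - t b y is x minus its projection to the line of y *)
set b := ip x y; pose t := (nrm y ^+ 2)^-1.
have := sqr_ge0 (nrm (x - (t%:C * b) *: y)).
rewrite sqr_nrmB//; last exact: domZ.
rewrite nrmZ// ipZr// -/b.
have -> : complex.Re ((t%:C * b)^* * b) = t * normc b ^+ 2.
  by rewrite sqr_normcE; case: b => u v /=; ring.
rewrite Normc.normcM normc_real ger0_norm ?invr_ge0 ?sqr_ge0//.
rewrite -(@ler_pM2r _ (nrm y ^+ 2)) ?exprn_gt0// mul0r.
have -> : (nrm x ^+ 2 + (t * normc b * nrm y) ^+ 2 - 2 * (t * normc b ^+ 2)) * nrm y ^+ 2
  = nrm x ^+ 2 * nrm y ^+ 2 - normc b ^+ 2.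
  by rewrite /t; field.
by rewrite subr_ge0 exprMn.
Qed.

Lemma nrmD x y : dom x -> dom y -> nrm (x + y) <= nrm x + nrm y.
Proof.
move=> dx dy; rewrite -ler_sqr ?nnegrE ?addr_ge0 ?nrm_ge0// sqr_nrmD// sqrrD.
have := normc_ip dx dy; have := Re_le_normc (ip x y); have := ler_norm (complex.Re (ip x y)).
rewrite -mulr_natl; lra.
Qed.

Lemma nrmB_tri z x y : dom x -> dom y -> dom z -> nrm (x - y) <= nrm (x - z) + nrm (z - y).
Proof.
by move=> dx dy dz; have -> : x - y = (x - z) + (z - y); [rewrite addrA subrK|apply: nrmD; exact: domB].
Qed.

(** Convergence and completeness with an explicit rate, so that limits never have to
   be taken inside the space itself. *)
Definition hcvg (u : nat -> V) x : Prop :=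
  exists2 a : nat -> R, a @ \oo --> (0 : R) & forall n, nrm (u n - x) <= a n.

Definition hcomplete : Prop := forall (u : nat -> V) (a : nat -> R),
  (forall n, dom (u n)) -> a @ \oo --> (0 : R) ->
  (forall m n, (n <= m)%N -> nrm (u m - u n) <= a n) ->
  exists x, dom x /\ forall n, nrm (u n - x) <= a n.

Lemma hcvg_ip0 u x y : (forall n, dom (u n)) -> dom x -> dom y -> hcvg u x ->
  (forall n, ip (u n) y = 0) -> ip x y = 0.
Proof.
move=> du dx dy [a a0 ua] uy; apply: Normc.eq0_normc; apply: le_anti.
rewrite normc_ge0 andbT; apply: (@le0_cvg0 _ _ (fun n => nrm y * a n)).
  exact: cvg0Z.
move=> n; have -> : ip x y = ip (x - u n) y by rewrite ipBl// uy subr0.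
apply: le_trans (normc_ip _ _) _ => //; first exact: domB.
by rewrite mulrC ler_wpM2l ?nrm_ge0// nrmBC.
Qed.

End InnerProduct.

(** * Hilbert spaces *)

Section ReIm.
Variable R : realType.
Local Notation "x %:C" := (real_complex R x).
Implicit Types u v : R[i].

Lemma ReD u v : complex.Re (u + v) = complex.Re u + complex.Re v.
Proof. by case: u v => ? ? []. Qed.

Lemma ReN u : complex.Re (- u) = - complex.Re u.
Proof. by case: u. Qed.

Lemma ReB u v : complex.Re (u - v) = complex.Re u - complex.Re v.
Proof. by rewrite ReD ReN. Qed.

Lemma ReZ (t : R) u : complex.Re (t%:C * u) = t * complex.Re u.
Proof. by case: u => a b /=; rewrite mul0r subr0. Qed.

Lemma Rei u : complex.Re (Complex 0 1 * u) = - complex.Im u.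
Proof. by case: u => a b /=; rewrite mul0r mul1r sub0r. Qed.

Lemma conj_real (t : R) : (t%:C)^* = t%:C.
Proof. by apply/eqP; rewrite eq_complex /= oppr0 !eqxx. Qed.

Lemma ReIm_eq u v : complex.Re u = complex.Re v ->
  complex.Re (Complex 0 1 * u) = complex.Re (Complex 0 1 * v) -> u = v.
Proof. by rewrite !Rei; case: u v => a b [c d] /= -> /oppr_inj ->. Qed.

Lemma quadratic_ge0 (b r : R) : (forall t, 0 <= t ^+ 2 * b + 2 * t * r) -> 0 <= b -> r = 0.
Proof.
move=> H b0; have b1 : 0 < b + 1 by lra.
(* - r / b minimises; b + 1 keeps the denominator away from zero *)
have := H (- r / (b + 1)); rewrite -(@pmulr_lge0 _ ((b + 1) ^+ 2)) ?exprn_gt0//.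
have -> : ((- r / (b + 1)) ^+ 2 * b + 2 * (- r / (b + 1)) * r) * (b + 1) ^+ 2
   = - (r ^+ 2 * (b + 2)) by field; rewrite gt_eqF.
rewrite oppr_ge0 pmulr_lle0; last by lra.
by move=> r2; apply/eqP; rewrite -sqrf_eq0 eq_le r2 sqr_ge0.
Qed.

End ReIm.

Section Riesz.
Variables (R : realType) (V : lmodType R[i]) (H : prehilbert V).
Local Notation C := R[i].
Local Notation normc := (Normc.normc).
Local Notation "x %:C" := (real_complex R x).
Local Notation dom := (hdom H).
Local Notation ip := (hip H).
Local Notation nrm := (hnorm H).

Hypothesis ipH : inner_product_space H.
Hypothesis cH : hcomplete H.

Let d0 := dom0 ipH.
Let dD := domD ipH.
Let dZ := domZ ipH.
Let dN := domN ipH.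
Let dB := domB ipH.
Hint Resolve d0 dD dZ dN dB : core.

(** Riesz representation along a linear map [Q]: minimise |Q x|^2 - 2 Re (phi x).
   With [Q] the identity this is the usual theorem; with [Q] the inclusion of a
   closed subspace it gives projections; with [Q] a symmetric operator it describes
   the range of [Q]. *)
Lemma riesz_along (U : lmodType C) (D : set U) (Q : U -> V) (phi : U -> C) (c : R) :
  D 0 -> (forall a x y, D x -> D y -> D (a *: x + y)) ->
  (forall x, D x -> dom (Q x)) ->
  (forall a x y, D x -> D y -> Q (a *: x + y) = a *: Q x + Q y) ->
  (forall a x y, D x -> D y -> phi (a *: x + y) = a * phi x + phi y) ->
  0 <= c -> (forall x, D x -> normc (phi x) <= c * nrm (Q x)) ->
  exists (u : nat -> U) F, [/\ forall n, D (u n), dom F, hcvg H (Q \o u) F,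
    nrm F <= c & forall x, D x -> phi x = ip (Q x) F].
Proof.
move=> D0 Dlin Qd Ql pl c0 pb.
have Q0 : Q 0 = 0.
  by apply: addr_idem_eq0; rewrite -{2}[Q 0]scale1r -(Ql 1 0 0 D0 D0) scale1r addr0.
have p0 : phi 0 = 0.
  by apply: addr_idem_eq0; rewrite -{2}[phi 0]mul1r -(pl 1 0 0 D0 D0) scale1r addr0.
pose J x := nrm (Q x) ^+ 2 - 2 * complex.Re (phi x).
have Jge x : D x -> - c ^+ 2 <= J x.
  move=> Dx; have := pb x Dx; have := Re_le_normc (phi x); have := ler_norm (complex.Re (phi x)).
  have := sqr_ge0 (c - nrm (Q x)); rewrite /J sqrrB; lra.
have hi : has_inf [set J x | x in D].
  split; first by exists (J 0), 0.
  by exists (- c ^+ 2) => _ [x Dx <-]; exact: Jge.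
pose mu := inf [set J x | x in D].
have Jmu x : D x -> mu <= J x by move=> Dx; apply: ge_inf; [case: hi|exists x].
pose h n : R := n.+1%:R^-1.
have h0 n : 0 < h n by rewrite invr_gt0.
have h1 n : h n <= 1 by rewrite invf_le1// ler1n.
have hcv : h @ \oo --> (0 : R) := @cvg0_harmonic R.
(* the error is squared so that the parallelogram law gives the Cauchy rate 2 h *)
have /choice[u uP] n : exists x, D x /\ J x < mu + h n ^+ 2.
  have [_ [x Dx <-] Jx] := inf_adherent (exprn_gt0 2 (h0 n)) hi.
  by exists x.
have Du n : D (u n) by case: (uP n).
pose a n := 2 * h n.
have acv : a @ \oo --> (0 : R) by exact: cvg0Z.
have cauchy m n : (n <= m)%N -> nrm (Q (u m) - Q (u n)) <= a n.
  move=> nm; have hmn : h m <= h n by rewrite /h lef_pV2 ?posrE ?ltr0n// ler_nat ltnS.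
  have hsq : h m ^+ 2 <= h n ^+ 2 by rewrite ler_sqr ?nnegrE ?(ltW (h0 _))//.
  pose z := (2^-1)%:C *: u m + (2^-1)%:C *: u n.
  have DZ t x : D x -> D (t *: x) by move=> Dx; rewrite -[_ *: _]addr0; exact: Dlin.
  have QZ t x : D x -> Q (t *: x) = t *: Q x.
    by move=> Dx; rewrite -[_ *: _]addr0 Ql// Q0 addr0.
  have pZ t x : D x -> phi (t *: x) = t * phi x.
    by move=> Dx; rewrite -[_ *: _]addr0 pl// p0 addr0.
  have Dz : D z by apply: Dlin => //; exact: DZ.
  have Qz : Q z = (2^-1)%:C *: (Q (u m) + Q (u n)).
    by rewrite /z Ql ?QZ ?scalerDr//; exact: DZ.
  have pz : complex.Re (phi z) = 2^-1 * (complex.Re (phi (u m)) + complex.Re (phi (u n))).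
    by rewrite /z pl ?pZ ?ReD ?ReZ//; [ring|exact: DZ].
  have := Jmu z Dz; have [_] := uP m; have [_] := uP n.
  rewrite /J pz Qz nrmZ//; last by apply: domD => //; exact: Qd.
  rewrite normc_real ger0_norm ?invr_ge0// exprMn.
  move=> e1 e2 e3; rewrite /a -ler_sqr ?nnegrE ?nrm_ge0 ?mulr_ge0 ?(ltW (h0 _))// [in leRHS]exprMn.
  move: e1 e2 e3.
  rewrite sqr_nrmD ?sqr_nrmB//; do ?exact: Qd.
  set X := nrm (Q (u m)) ^+ 2; set Y := nrm (Q (u n)) ^+ 2; set Z := complex.Re (ip _ _).
  have -> : (2^-1 : R) ^+ 2 = 4^-1 by rewrite expr2 -invfM -natrM.
  have -> : (2 : R) ^+ 2 = 4 by rewrite -natrX.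
  lra.
have [F [dF uF]] := cH (fun n => Qd _ (Du n)) acv cauchy.
have key x : D x -> complex.Re (phi x) = complex.Re (ip (Q x) F).
  move=> Dx; have dQx := Qd x Dx.
  (* first variation of J at the minimising sequence in the direction x *)
  suff : complex.Re (ip (Q x) F) - complex.Re (phi x) = 0 by lra.
  apply: (@quadratic_ge0 _ (nrm (Q x) ^+ 2)); last exact: sqr_ge0.
  move=> t; rewrite -oppr_le0.
  apply: (@le0_cvg0 _ _ (fun n => h n + (2 * `|t| * nrm (Q x)) * a n)).
    by apply: cvg0D => //; exact: cvg0Z.
  move=> n; have Dn : D (t%:C *: x + u n) by exact: Dlin.
  have dQn := Qd _ (Du n).
  have := Jmu _ Dn; rewrite /J Ql// pl// ReD ReZ.
  rewrite sqr_nrmD// ?nrmZ//; last exact: domZ.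
  rewrite ipZl// ReZ normc_real exprMn real_normK ?num_real//.
  have [_] := uP n; rewrite /J.
  have hh : h n ^+ 2 <= h n by rewrite expr2 ler_piMl// ltW.
  have : `|t * (complex.Re (ip (Q x) (Q (u n))) - complex.Re (ip (Q x) F))| <= `|t| * (nrm (Q x) * a n).
    rewrite normrM ler_wpM2l// -ReB -ipBr//.
    apply: le_trans (Re_le_normc _) _; apply: le_trans (normc_ip ipH _ _) _ => //; first exact: domB.
    by rewrite ler_wpM2l ?nrm_ge0//; exact: uF.
  rewrite ler_norml => /andP[].
  set X := complex.Re (ip _ (Q (u n))); set Y := complex.Re (ip _ F).
  set N := nrm (Q x); set tt := t ^+ 2 * N ^+ 2.
  rewrite !mulrBr => l1 l2; lra.
have key2 x : D x -> phi x = ip (Q x) F.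
  move=> Dx; apply: ReIm_eq; first exact: key.
  have Dix : D (Complex 0 1 *: x + 0) by exact: Dlin.
  have := key _ Dix; rewrite Ql// pl// p0 Q0 !addr0 ipZl//; exact: Qd.
exists u, F; split => //; first by exists a.
have : nrm F ^+ 2 - c * nrm F <= 0.
  apply: (@le0_cvg0 _ _ (fun n => (nrm F + c) * a n)); first exact: cvg0Z.
  move=> n; have dQn := Qd _ (Du n).
  have e1 : complex.Re (ip (F - Q (u n)) F) <= a n * nrm F.
    apply: le_trans (ler_norm _) _; apply: le_trans (Re_le_normc _) _.
    apply: le_trans (normc_ip ipH _ _) _ => //; first exact: domB.
    by rewrite ler_wpM2r ?nrm_ge0// (nrmBC ipH)//; exact: uF.
  have e2 : complex.Re (ip (Q (u n)) F) <= c * nrm (Q (u n)).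
    rewrite -key2//; apply: le_trans (ler_norm _) _; apply: le_trans (Re_le_normc _) _; exact: pb.
  have e3 : nrm (Q (u n)) <= a n + nrm F.
    rewrite -[Q (u n)](subrK F); apply: le_trans (nrmD ipH _ _) _ => //; first exact: domB.
    by rewrite lerD2r; exact: uF.
  have e4 := ler_wpM2l c0 e3.
  have : nrm F ^+ 2 = complex.Re (ip (F - Q (u n)) F) + complex.Re (ip (Q (u n)) F).
    by rewrite -ReD -ipDl ?subrK -?sqr_nrm//; exact: domB.
  move: e4; rewrite !mulrDr !mulrDl; lra.
have := nrm_ge0 H F; rewrite le_eqVlt => /orP[/eqP <-//|F0].
by rewrite subr_le0 expr2 ler_pM2r.
Qed.

(** The projection of x represents the functional z -> (z, x) on the closed subspace. *)
Lemma projection_exists (K : set V) : K `<=` dom -> K 0 ->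
  (forall a x y, K x -> K y -> K (a *: x + y)) ->
  (forall u x, (forall n, K (u n)) -> dom x -> hcvg H u x -> K x) ->
  forall x, dom x -> exists y, K y /\ forall z, K z -> ip (x - y) z = 0.
Proof.
move=> Kd K0 Kl Kc x dx.
have [|||||u [y [Ku dy uy _ yP]]] := @riesz_along V K id (fun z => ip z x) (nrm x) K0 Kl.
- exact: Kd.
- by [].
- by move=> a z w Kz Kw; rewrite ips_lin//; exact: Kd.
- exact: nrm_ge0.
- by move=> z Kz; rewrite mulrC; apply: (normc_ip ipH) => //; exact: Kd.
exists y; split; first exact: Kc uy.
move=> z Kz; have dz := Kd _ Kz; rewrite ips_conj//; last exact: domB.
by rewrite ipBr// -yP// subrr conjC0.
Qed.

Lemma orth_projP (K : set V) : K `<=` dom -> K 0 ->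
  (forall a x y, K x -> K y -> K (a *: x + y)) ->
  (forall u x, (forall n, K (u n)) -> dom x -> hcvg H u x -> K x) ->
  is_orth_proj H K (orth_proj H K).
Proof.
move=> Kd K0 Kl Kc; rewrite /orth_proj; case: xgetP => [P _ //|no].
have /choice[P PP] x : exists y, dom x -> K y /\ forall z, K z -> ip (x - y) z = 0.
  have [dx|ndx] := pselect (dom x); last by exists 0.
  by have [y yP] := projection_exists Kd K0 Kl Kc dx; exists y.
by case: (no P).
Qed.

Section Bounded.
Variable A : V -> V.
Hypothesis bA : bounded_op H A.

Lemma bop_dom x : dom x -> dom (A x). Proof. by case: bA => + _ _; apply. Qed.

Lemma bopD x y : dom x -> dom y -> A (x + y) = A x + A y.
Proof.
by case: bA => _ l _ dx dy; have := l 1 x y dx dy; rewrite !scale1r.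
Qed.

Lemma bop0 : A 0 = 0.
Proof.
by apply: addr_idem_eq0; rewrite -(bopD (dom0 ipH) (dom0 ipH)) addr0.
Qed.

Lemma bopZ (a : C) x : dom x -> A (a *: x) = a *: A x.
Proof.
case: bA => _ l _ dx; have := l a x 0 dx (dom0 ipH).
by rewrite bop0 !addr0.
Qed.

Lemma bopN x : dom x -> A (- x) = - A x.
Proof. by move=> dx; rewrite -scaleN1r bopZ// scaleN1r. Qed.

Lemma bopB x y : dom x -> dom y -> A (x - y) = A x - A y.
Proof. by move=> dx dy; rewrite bopD ?bopN//; exact: domN. Qed.

Lemma bop_bound : exists2 M : R, 0 <= M & forall x, dom x -> nrm (A x) <= M * nrm x.
Proof.
case: bA => _ _ [M AM]; exists `|M| => // x dx; apply: le_trans (AM x dx) _.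
by rewrite ler_wpM2r ?nrm_ge0// ler_norm.
Qed.

Lemma adjointP : is_adjoint H A (adjoint H A).
Proof.
rewrite /adjoint; case: xgetP => [B _ //|no].
have [M M0 AM] := bop_bound.
have /choice[B BP] y : exists z, dom y -> dom z /\ forall x, dom x -> ip (A x) y = ip x z.
  have [dy|ndy] := pselect (dom y); last by exists 0.
  have [|||||u [z [_ dz _ _ zP]]] := @riesz_along V dom id (fun x => ip (A x) y) (M * nrm y)
    (dom0 ipH) (ips_dom ipH).
  - by [].
  - by [].
  - move=> a x x' dx dx'; case: bA => _ -> // _.
    by rewrite ips_lin//; exact: bop_dom.
  - by rewrite mulr_ge0// nrm_ge0.
  - move=> x dx; apply: le_trans (normc_ip ipH _ dy) _; first exact: bop_dom.
    by rewrite mulrAC ler_wpM2r ?nrm_ge0//; exact: AM.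
  by exists z.
by case: (no B); split=> [y dy|x y dx dy]; have [] := BP y dy => // _ ->.
Qed.

Lemma adjoint_dom y : dom y -> dom (adjoint H A y).
Proof. by case: adjointP => + _; apply. Qed.

Lemma adjointE x y : dom x -> dom y -> ip (A x) y = ip x (adjoint H A y).
Proof. by case: adjointP => _; apply. Qed.

Lemma adjointE' x y : dom x -> dom y -> ip (adjoint H A y) x = ip y (A x).
Proof.
move=> dx dy; rewrite ips_conj//; last exact: adjoint_dom.
by rewrite -adjointE// -ips_conj//; exact: bop_dom.
Qed.

Lemma adjoint_eq (y z : V) : dom y -> dom z ->
  (forall x, dom x -> ip (A x) y = ip x z) -> adjoint H A y = z.
Proof.
move=> dy dz yz; apply: (ip_ext ipH) => //; first exact: adjoint_dom.
move=> x dx; rewrite adjointE'// [RHS](ips_conj ipH)// -yz//.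
by rewrite -ips_conj//; exact: bop_dom.
Qed.

(** Test the adjoint against its own value: |A^* y|^2 = (A A^* y, y). *)
Lemma adjoint_le (M : R) : (forall x, dom x -> nrm (A x) <= M * nrm x) ->
  forall y, dom y -> nrm (adjoint H A y) <= M * nrm y.
Proof.
move=> AM y dy; have da := adjoint_dom dy.
have [->|a0] := eqVneq (nrm (adjoint H A y)) 0.
  by apply: le_trans (nrm_ge0 H (A y)) _; exact: AM.
have ap : 0 < nrm (adjoint H A y) by rewrite lt_neqAle eq_sym a0 nrm_ge0.
rewrite -(ler_pM2r ap) -expr2 sqr_nrm// -adjointE//.
apply: le_trans (ler_norm _) _; apply: le_trans (Re_le_normc _) _.
apply: le_trans (normc_ip ipH _ dy) _; first exact: bop_dom.
by rewrite mulrAC; apply: ler_wpM2r; [exact: nrm_ge0|exact: AM].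
Qed.

Lemma adjoint_bounded : bounded_op H (adjoint H A).
Proof.
split; first exact: adjoint_dom.
  move=> a x y dx dy; apply: adjoint_eq => //.
  - exact: (ips_dom ipH).
  - by apply: (ips_dom ipH) => //; exact: adjoint_dom.
  move=> z dz; have dAz := bop_dom dz; have [dx' dy'] := (adjoint_dom dx, adjoint_dom dy).
  by rewrite !(ipDr ipH, ipZr ipH)// ?adjointE//; auto.
by have [M M0 AM] := bop_bound; exists M; exact: adjoint_le.
Qed.

End Bounded.
End Riesz.

(** * Positive square roots *)

Section Sqrt.
Variables (R : realType) (V : lmodType R[i]) (H : prehilbert V).
Local Notation C := R[i].
Local Notation normc := (Normc.normc).
Local Notation "x %:C" := (real_complex R x).
Local Notation dom := (hdom H).
Local Notation ip := (hip H).
Local Notation nrm := (hnorm H).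

Hypothesis ipH : inner_product_space H.
Let d0 := dom0 ipH.
Let dD := domD ipH.
Let dZ := domZ ipH.
Let dN := domN ipH.
Let dB := domB ipH.
Hint Resolve d0 dD dZ dN dB : core.

Definition symmetric_op (A : V -> V) : Prop :=
  forall x y, dom x -> dom y -> ip (A x) y = ip x (A y).

Lemma ge0_Im0 (z : C) : 0 <= z -> complex.Im z = 0.
Proof. by case: z => a b; rewrite lecE /= => /andP[/eqP]. Qed.

Lemma ge0_Re (z : C) : 0 <= z -> 0 <= complex.Re z.
Proof. by case: z => a b; rewrite lecE /= => /andP[]. Qed.

(** Over the complex numbers a positive operator is symmetric, by polarisation. *)
Lemma pos_symmetric A : bounded_op H A -> (forall x, dom x -> 0 <= ip (A x) x) ->
  symmetric_op A.
Proof.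
move=> bA pA x y dx dy; have dA z := bop_dom bA (x := z).
have E1 : complex.Im (ip (A x) y + ip (A y) x) = 0.
  have := ge0_Im0 (pA (x + y) (dD dx dy)); have := ge0_Im0 (pA x dx); have := ge0_Im0 (pA y dy).
  rewrite (bopD bA)// !(ipDl ipH) ?(ipDr ipH)//; auto.
  by case: (ip (A x) x) (ip (A y) y) (ip (A x) y) (ip (A y) x) => [? ?] [? ?] [? ?] [? ?] /=; lra.
have E2 : complex.Re (ip (A x) y - ip (A y) x) = 0.
  have diy : dom (Complex 0 1 *: y) by auto.
  have := ge0_Im0 (pA (x + Complex 0 1 *: y) (dD dx diy)); have := ge0_Im0 (pA x dx); have := ge0_Im0 (pA y dy).
  rewrite (bopD bA)// (bopZ ipH bA)// !(ipDl ipH) ?(ipDr ipH)//; auto.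
  rewrite !(ipZl ipH) ?(ipZr ipH)//; auto.
  by case: (ip (A x) x) (ip (A y) y) (ip (A x) y) (ip (A y) x) => [? ?] [? ?] [? ?] [? ?] /=; lra.
rewrite (ips_conj ipH (x := A y) (y := x)); auto.
case: (ip (A x) y) (ip (A y) x) E1 E2 => [a b] [c d] /= E1 E2.
by apply/eqP; rewrite eq_complex /=; apply/andP; split; apply/eqP; lra.
Qed.

(** First variation of the quadratic form of A at its minimum x, in the direction A x. *)
Lemma pos_eq0 A x : bounded_op H A -> (forall x, dom x -> 0 <= ip (A x) x) ->
  dom x -> ip (A x) x = 0 -> A x = 0.
Proof.
move=> bA pA dx Axx; have sA := pos_symmetric bA pA.
have dA z := bop_dom bA (x := z).
apply: (nrm_eq0 ipH); first exact: dA.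
apply/eqP; rewrite -sqrf_eq0; apply/eqP.
apply: (@quadratic_ge0 _ (complex.Re (ip (A (A x)) (A x)))); last first.
  by apply/ge0_Re/pA/dA.
move=> t; have dt : dom (t%:C *: A x) by auto.
have := ge0_Re (pA (x + t%:C *: A x) (dD dx dt)).
rewrite (bopD bA)// (bopZ ipH bA)//; last exact: dA.
rewrite !(ipDl ipH) ?(ipDr ipH)//; auto.
rewrite Axx !(ipZl ipH) ?(ipZr ipH)//; auto.
rewrite (sA _ x)//; last exact: dA.
rewrite !ReD conj_real !ReZ -!sqr_nrm//; last exact: dA.
move/le_trans; apply; rewrite le_eqVlt; apply/orP; left; apply/eqP => /=; ring.
Qed.

(** The vector representing G -> (G, F) along A is a preimage of F under A, by symmetry. *)
Lemma range_symmetric A F c : hcomplete H -> bounded_op H A -> symmetric_op A ->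
  dom F -> 0 <= c -> (forall G, dom G -> normc (ip G F) <= c * nrm (A G)) ->
  exists F', [/\ dom F', A F' = F & nrm F' <= c].
Proof.
move=> cH bA sA dF c0 AF.
have [|||u [F' [_ dF' _ Fc FP]]] := @riesz_along R V H ipH cH V dom A (fun G => ip G F) c
   (dom0 ipH) (ips_dom ipH) _ _ _ c0 AF.
- exact: bop_dom.
- by case: bA => _ + _ => l a x y dx dy; exact: l.
- by move=> a x y dx dy; rewrite (ips_lin ipH).
exists F'; split => //; apply: (ip_ext ipH) => //; first exact: bop_dom.
move=> G dG; rewrite sA// (ips_conj ipH (x := A G))//; last exact: bop_dom.
by rewrite -FP// -(ips_conj ipH).
Qed.

Section Iteration.
Variable X : V -> V.
Hypothesis bX : bounded_op H X.
Hypothesis sX : symmetric_op X.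
Hypothesis X1 : forall x, dom x -> nrm (X x) <= nrm x.
Hypothesis cH : hcomplete H.

(** Iterates of Y = (X + Y^2) / 2, whose fixed point is 1 - sqrt (1 - X), together
    with the same iteration for the number 1 in place of X, which controls the
    norms. *)
Fixpoint sqrt_iter n : V -> V :=
  if n is n'.+1 then fun x => (2^-1)%:C *: (X x + sqrt_iter n' (sqrt_iter n' x))
  else fun=> 0.

Fixpoint sqrt_iter1 n : R :=
  if n is n'.+1 then 2^-1 * (1 + sqrt_iter1 n' ^+ 2) else 0.

Local Notation Y := sqrt_iter.
Local Notation y := sqrt_iter1.

Lemma sqrt_iter1_bound n : 0 <= y n <= 1.
Proof.
elim: n => [|n /andP[y0 y1]] /=; first by rewrite lexx ler01.
have : y n ^+ 2 <= 1 by rewrite expr_le1.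
have := sqr_ge0 (y n); lra.
Qed.

Lemma sqrt_iter1_incr n : y n <= y n.+1.
Proof.
elim: n => [|n IH]; first by case/andP: (sqrt_iter1_bound 1).
have /andP[a _] := sqrt_iter1_bound n; have /andP[b _] := sqrt_iter1_bound n.+1.
have sq : y n ^+ 2 <= y n.+1 ^+ 2 by rewrite ler_sqr.
have E k : y k.+1 = 2^-1 * (1 + y k ^+ 2) by [].
rewrite (E n.+1) [leLHS](E n); lra.
Qed.

Lemma sqrt_iter_bounded n : bounded_op H (Y n) /\ forall x, dom x -> nrm (Y n x) <= y n * nrm x.
Proof.
elim: n => [|n [bn ln]].
  split => /=; last by move=> x dx; rewrite nrm0// mul0r.
  split; [by move=> *|by move=> a x z _ _; rewrite /= scaler0 addr0|].
  by exists 0 => x dx; rewrite nrm0// mul0r.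
have dn x := bop_dom bn (x := x); have dX x := bop_dom bX (x := x).
have bound x : dom x -> nrm (Y n.+1 x) <= y n.+1 * nrm x.
  move=> dx /=; rewrite (nrmZ ipH); last by auto.
  rewrite normc_real ger0_norm ?invr_ge0// -mulrA ler_wpM2l ?invr_ge0//.
  apply: le_trans (nrmD ipH _ _) _; auto.
  rewrite mulrDl mul1r; apply: lerD; first exact: X1.
  have /andP[y0 _] := sqrt_iter1_bound n.
  apply: le_trans (ln _ (dn _ dx)) _; rewrite expr2 -mulrA ler_wpM2l//; exact: ln.
split => //; split; first by move=> x dx /=; auto.
  move=> a x z dx dz /=; case: bX => _ -> // _.
  have [_ l _] := bn; rewrite !l//; auto.
  by rewrite addrACA -(scalerDr a) (scalerDr (2^-1)%:C) !scalerA [a * _]mulrC.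
by exists (y n.+1).
Qed.

Let bY n := (sqrt_iter_bounded n).1.
Let dY n x := bop_dom (bY n) (x := x).
Let dX x := bop_dom bX (x := x).
Hint Resolve dY dX : core.

Lemma sqrt_iter_sym n : symmetric_op (Y n).
Proof.
elim: n => [|n IH] x z dx dz /=; first by rewrite (ip0l ipH)// (ip0r ipH).
rewrite (ipZl ipH) ?(ipZr ipH)//; auto.
rewrite (ipDl ipH) ?(ipDr ipH)//; auto.
by rewrite conj_real sX// !IH//; auto.
Qed.

Lemma sqrt_iter_comm n A : bounded_op H A -> (forall x, dom x -> A (X x) = X (A x)) ->
  forall x, dom x -> A (Y n x) = Y n (A x).
Proof.
move=> bA AX; elim: n => [|n IH] x dx /=; first by rewrite (bop0 ipH bA).
have dA z := bop_dom bA (x := z).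
by rewrite (bopZ ipH bA) ?(bopD bA) ?AX ?IH//; auto.
Qed.

Lemma sqrt_iter_comm2 m n x : dom x -> Y m (Y n x) = Y n (Y m x).
Proof.
apply: sqrt_iter_comm => // z dz; apply/esym; exact: sqrt_iter_comm.
Qed.

(** As the iterates commute, Y_(n+2) - Y_(n+1) is half of (Y_(n+1) + Y_n) applied to
    Y_(n+1) - Y_n, and the same holds for the numbers y_n. *)
Lemma sqrt_iter_step n x : dom x -> nrm (Y n.+1 x - Y n x) <= (y n.+1 - y n) * nrm x.
Proof.
move=> dx; elim: n => [|n IH].
  by rewrite !subr0; have [_ /(_ x dx)] := sqrt_iter_bounded 1.
pose d := Y n.+1 x - Y n x; have dd : dom d by rewrite /d; auto.
have -> : Y n.+2 x - Y n.+1 x = (2^-1)%:C *: (Y n.+1 d + Y n d).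
  have E k z : Y k.+1 z = (2^-1)%:C *: (X z + Y k (Y k z)) by [].
  rewrite (E n.+1) [X in _ - X = _](E n) -scalerBr; congr (_ *: _).
  rewrite opprD addrACA subrr add0r /d.
  rewrite (bopB ipH (bY n.+1)) ?(bopB ipH (bY n))//; auto.
  by rewrite (sqrt_iter_comm2 n n.+1)// subrKA.
rewrite (nrmZ ipH); last by auto.
rewrite normc_real ger0_norm ?invr_ge0//.
have -> : y n.+2 - y n.+1 = 2^-1 * ((y n.+1 + y n) * (y n.+1 - y n)).
  have E k : y k.+1 = 2^-1 * (1 + y k ^+ 2) by [].
  by rewrite (E n.+1) [X in _ - X = _](E n); ring.
rewrite -mulrA ler_wpM2l ?invr_ge0//.
apply: le_trans (nrmD ipH _ _) _; auto.
have /andP[y0 _] := sqrt_iter1_bound n; have /andP[y0' _] := sqrt_iter1_bound n.+1.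
rewrite -mulrA mulrDl; apply: lerD.
  apply: le_trans ((sqrt_iter_bounded n.+1).2 _ dd) _; exact: ler_wpM2l.
apply: le_trans ((sqrt_iter_bounded n).2 _ dd) _; exact: ler_wpM2l.
Qed.

(** The numbers y_n increase and are bounded by 1, so the iterates converge in norm. *)
Lemma sqrt_iter_limit : exists (a : nat -> R) (Z : V -> V),
  [/\ a @ \oo --> (0 : R), forall n, a n.+1 <= a n, forall x, dom x -> dom (Z x) &
      forall n x, dom x -> nrm (Y n x - Z x) <= a n * nrm x].
Proof.
have incr : nondecreasing_seq y by apply/nondecreasing_seqP; exact: sqrt_iter1_incr.
have ubd : has_ubound (range y).
  by exists 1 => _ [n _ <-]; case/andP: (sqrt_iter1_bound n).
have cvy := nondecreasing_is_cvgn incr ubd; pose L := limn y.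
have yL n : y n <= L by exact: nondecreasing_cvgn_le.
pose a n := L - y n.
have a0 : a @ \oo --> (0 : R).
  by rewrite -(subrr L); apply: cvgB; [exact: cvg_cst|exact: cvy].
have cauchy x m n : dom x -> (n <= m)%N -> nrm (Y m x - Y n x) <= a n * nrm x.
  move=> dx nm; apply: (@le_trans _ _ ((y m - y n) * nrm x)); last first.
    by rewrite ler_wpM2r ?nrm_ge0// /a lerD2r.
  elim: m nm => [|m IH]; first by rewrite leqn0 => /eqP ->; rewrite !subrr mul0r nrm0.
  rewrite leq_eqVlt => /orP[/eqP ->|]; first by rewrite !subrr mul0r nrm0.
  rewrite ltnS => /IH {}IH; apply: le_trans (nrmB_tri ipH (z := Y m x) _ _ _) _; auto.
  rewrite [leRHS](_ : _ = (y m.+1 - y m) * nrm x + (y m - y n) * nrm x); last by ring.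
  by apply: lerD => //; exact: sqrt_iter_step.
have /choice[Z ZP] x : exists z, dom x -> dom z /\ forall n, nrm (Y n x - z) <= a n * nrm x.
  have [dx|ndx] := pselect (dom x); last by exists 0.
  have [||z [dz zP]] := @cH (fun n => Y n x) (fun n => a n * nrm x) (fun n => dY n dx).
  - by under eq_fun do rewrite mulrC; exact: cvg0Z.
  - by move=> m n; exact: cauchy.
  by exists z.
exists a, Z; split => //; first by move=> n; rewrite lerD2l lerN2 sqrt_iter1_incr.
  by move=> x /ZP[].
by move=> n x /ZP[].
Qed.

(** The root is Q = 1 - Z with Z the limit of the iterates: Z = (X + Z^2) / 2 means that
    Q Q = 1 - X, and |Z| <= 1 makes Q positive. *)
Lemma sqrt_exists : exists Q, is_pos_sqrt H (fun x => x - X x) Q /\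
  forall A, bounded_op H A -> (forall x, dom x -> A (X x) = X (A x)) ->
    forall x, dom x -> A (Q x) = Q (A x).
Proof.
have [a [Z [a0 ad dZ' YZ]]] := sqrt_iter_limit.
have zero (K : R) x : dom x -> (forall n, nrm x <= K * a n) -> x = 0.
  by move=> dx xa; apply: (nrm_le0 ipH) => //; apply: le0_cvg0 xa; exact: cvg0Z.
have eq0 (K : R) x x' : dom x -> dom x' -> (forall n, nrm (x - x') <= K * a n) -> x = x'.
  by move=> dx dx' xx'; apply/eqP; rewrite -subr_eq0; apply/eqP/(zero K); auto.
have y1 n x : nrm x * y n <= nrm x.
  by case/andP: (sqrt_iter1_bound n) => ? ?; rewrite ler_piMr// nrm_ge0.
have Zl (t : C) x z : dom x -> dom z -> Z (t *: x + z) = t *: Z x + Z z.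
  move=> dx dz; have dtx : dom (t *: x + z) by auto.
  apply: (eq0 (nrm (t *: x + z) + (normc t * nrm x + nrm z))); auto => n.
  apply: le_trans (nrmB_tri ipH (z := Y n (t *: x + z)) _ _ _) _; auto.
  rewrite mulrDl; apply: lerD; first by rewrite (nrmBC ipH) 1?mulrC; auto.
  have [_ -> // _] := bY n.
  rewrite opprD addrACA -scalerBr; apply: le_trans (nrmD ipH _ _) _; auto.
  rewrite mulrDl; apply: lerD; last by rewrite mulrC; auto.
  rewrite (nrmZ ipH); last by auto.
  by rewrite -mulrA ler_wpM2l ?normc_ge0// mulrC; auto.
have Zn x : dom x -> nrm (Z x) <= nrm x.
  move=> dx; rewrite -subr_le0; apply: (@le0_cvg0 _ _ (fun n => nrm x * a n)); first exact: cvg0Z.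
  move=> n; have : nrm (Z x) <= nrm (Z x - Y n x) + nrm (Y n x).
    by rewrite -[X in nrm X <= _](subrK (Y n x)); apply: nrmD; auto.
  have := YZ n x dx; rewrite (nrmBC ipH); [|by auto..].
  have := (sqrt_iter_bounded n).2 x dx; have := y1 n x.
  rewrite (mulrC (y n)) (mulrC (a n)); lra.
have bZ : bounded_op H Z by split => //; exists 1 => x dx; rewrite mul1r; exact: Zn.
have sZ : symmetric_op Z.
  move=> x z dx dz; apply/eqP; rewrite -subr_eq0; apply/eqP/Normc.eq0_normc/le_anti.
  rewrite normc_ge0 andbT.
  apply: (@le0_cvg0 _ _ (fun n => (nrm x * nrm z + nrm x * nrm z) * a n)); first exact: cvg0Z.
  move=> n; have -> : ip (Z x) z - ip x (Z z) = ip (Z x - Y n x) z + ip x (Y n z - Z z).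
    by rewrite (ipBl ipH) ?(ipBr ipH) -?sqrt_iter_sym//; auto; ring.
  apply: le_trans (le_normcD _ _) _; rewrite mulrDl; apply: lerD.
    apply: le_trans (normc_ip ipH _ _) _; auto.
    rewrite mulrAC; apply: ler_wpM2r; first exact: nrm_ge0.
    by rewrite (nrmBC ipH) 1?mulrC; auto.
  apply: le_trans (normc_ip ipH _ _) _; auto.
  by rewrite -mulrA; apply: ler_wpM2l; [exact: nrm_ge0|rewrite mulrC; auto].
have ZZ x : dom x -> Z x = (2^-1)%:C *: (X x + Z (Z x)).
  move=> dx; apply: (eq0 (nrm x + 2^-1 * (nrm x + nrm (Z x)))); auto => n.
  apply: le_trans (nrmB_tri ipH (z := Y n.+1 x) _ _ _) _; auto.
  rewrite mulrDl; apply: lerD.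
    rewrite (nrmBC ipH); [|by auto..]; apply: le_trans (YZ n.+1 x dx) _.
    by rewrite mulrC; apply: ler_wpM2l; [exact: nrm_ge0|exact: ad].
  rewrite /= -scalerBr (nrmZ ipH); last by auto.
  rewrite normc_real ger0_norm ?invr_ge0// -mulrA ler_wpM2l ?invr_ge0//.
  rewrite opprD addrACA subrr add0r.
  apply: le_trans (nrmB_tri ipH (z := Y n (Z x)) _ _ _) _; auto.
  rewrite mulrDl; apply: lerD; last by rewrite mulrC; auto.
  rewrite -(bopB ipH (bY n)); [|by auto..].
  apply: le_trans ((sqrt_iter_bounded n).2 _ _) _; auto.
  rewrite mulrC; apply: le_trans (_ : nrm (Y n x - Z x) <= _); last by rewrite mulrC; auto.
  by case/andP: (sqrt_iter1_bound n) => ? ?; rewrite ler_piMr// nrm_ge0.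
exists (fun x => x - Z x); split; last first.
  move=> A bA AX x dx; have dA z := bop_dom bA (x := z).
  rewrite (bopB ipH bA); [|by auto..]; congr (_ - _).
  have [M M0 AM] := bop_bound bA.
  apply: (eq0 (M * nrm x + nrm (A x))); auto => n.
  apply: le_trans (nrmB_tri ipH (z := Y n (A x)) _ _ _) _; auto.
  rewrite mulrDl; apply: lerD; last by rewrite mulrC; auto.
  rewrite -sqrt_iter_comm// -(bopB ipH bA); [|by auto..].
  apply: le_trans (AM _ _) _; first by auto.
  rewrite -mulrA; apply: ler_wpM2l => //.
  by rewrite (nrmBC ipH) 1?mulrC; auto.
split.
- split; first by move=> x dx; auto.
    by move=> t x z dx dz; rewrite Zl// opprD addrACA -scalerBr.
  exists 2 => x dx; apply: le_trans (nrmD ipH _ _) _; auto.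
  by rewrite (nrmN ipH) ?mulr2n ?mulrDl ?mul1r ?lerD ?Zn; auto.
- move=> x dx; rewrite (ipBl ipH); [|by auto..].
  have ZxE : ip (Z x) x = (complex.Re (ip (Z x) x))%:C.
    have : complex.Im (ip (Z x) x) = 0.
      have := sZ x x dx dx; rewrite (ips_conj ipH (x := Z x) (y := x)); auto.
      by case: (ip (Z x) x) => u v [] /=; lra.
    by case: (ip (Z x) x) => u v /= ->.
  rewrite ZxE (ipxx ipH)// subr_ge0 lecR.
  apply: le_trans (ler_norm _) _; apply: le_trans (Re_le_normc _) _.
  apply: le_trans (normc_ip ipH _ _) _; auto.
  by rewrite expr2 ler_wpM2r ?nrm_ge0// Zn.
- move=> x dx; rewrite (bopB ipH bZ); [|by auto..].
  have E : X x + Z (Z x) = Z x + Z x.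
    rewrite [in RHS](ZZ _ dx) -scalerDl -[LHS]scale1r; congr (_ *: _).
    by rewrite -rmorphD /= -[in LHS](rmorph1 (real_complex R)); congr (_%:C); field.
  have -> : X x = Z x + Z x - Z (Z x) by rewrite -E addrK.
  by rewrite !opprB opprD !addrA (addrAC x (- Z x)).
Qed.

End Iteration.

(** For w = P x - Q x one has (P w, w) + (Q w, w) = ((P P - Q Q) x, w) = 0, hence
    P w = Q w = 0 and |w|^2 = (x, P w - Q w) = 0. *)
Lemma pos_sqrt_unique (B P Q : V -> V) : is_pos_sqrt H B P -> is_pos_sqrt H B Q ->
  (forall x, dom x -> P (Q x) = Q (P x)) -> forall x, dom x -> P x = Q x.
Proof.
move=> [bP pP PP] [bQ pQ QQ] PQ x dx.
have dP z := bop_dom bP (x := z); have dQ z := bop_dom bQ (x := z).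
pose w := P x - Q x; have dw : dom w by rewrite /w; auto.
have E : ip (P w) w + ip (Q w) w = 0.
  rewrite -(ipDl ipH); [|by auto..].
  rewrite /w (bopB ipH bP) ?(bopB ipH bQ) ?PP ?QQ ?PQ; auto.
  by rewrite subrKA subrr (ip0l ipH).
have pw := pP w dw; have qw := pQ w dw.
have Pw : P w = 0.
  apply: pos_eq0 => //; apply/le_anti; rewrite pw andbT.
  by move: E => /eqP; rewrite addr_eq0 => /eqP ->; rewrite oppr_le0.
have Qw : Q w = 0.
  apply: pos_eq0 => //; apply/le_anti; rewrite qw andbT.
  by move: E => /eqP; rewrite addrC addr_eq0 => /eqP ->; rewrite oppr_le0.
apply/eqP; rewrite -subr_eq0; apply/eqP/(ips_eq0 ipH) => //.
rewrite -/w {1}/w (ipBl ipH); [|by auto..].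
rewrite (pos_symmetric bP pP)// (pos_symmetric bQ pQ)// Pw Qw.
by rewrite (ip0r ipH)// subrr.
Qed.

(** [pos_sqrt] is an unspecified positive square root; uniqueness identifies it with the
    limit of the iteration, whose commutation property it inherits. *)
Lemma pos_sqrtP (X B : V -> V) : hcomplete H -> bounded_op H X -> symmetric_op X ->
  (forall x, dom x -> nrm (X x) <= nrm x) ->
  (forall x, dom x -> B x = x - X x) ->
  is_pos_sqrt H B (pos_sqrt H B) /\ forall A, bounded_op H A -> (forall x, dom x -> A (X x) = X (A x)) ->
    forall x, dom x -> A (pos_sqrt H B x) = pos_sqrt H B (A x).
Proof.
move=> cH bX sX X1 BX; have [Q [QP Qc]] := sqrt_exists bX sX X1 cH.
have QB : is_pos_sqrt H B Q by case: QP => bQ pQ QQ; split => // x dx; rewrite QQ// BX.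
have PB : is_pos_sqrt H B (pos_sqrt H B).
  by rewrite /pos_sqrt; case: xgetP => [P _ //|/(_ Q)].
split => // A bA AX x dx.
have PQ z : dom z -> pos_sqrt H B z = Q z.
  move: z; apply: (pos_sqrt_unique PB QB) => z dz.
  case: PB => bP _ PP; have dP v := bop_dom bP (x := v); have dX v := bop_dom bX (x := v).
  apply: Qc => // v dv.
  have E u : dom u -> X u = u - B u by move=> du; rewrite BX// subKr.
  rewrite !E; auto; rewrite (bopB ipH bP) -?PP; auto.
by rewrite !PQ ?Qc//; exact: bop_dom bA _ dx.
Qed.

End Sqrt.

(** * Construction of Hilbert spaces *)

Section Constructions.
Variable R : realType.

(** A limit with any rate is also approached with the rate of the Cauchy condition. *)
Lemma hcomplete_of_hcvg (V : lmodType R[i]) (H : prehilbert V) : inner_product_space H ->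
  (forall (u : nat -> V) (a : nat -> R), (forall n, hdom H (u n)) -> a @ \oo --> (0 : R) ->
    (forall m n, (n <= m)%N -> hnorm H (u m - u n) <= a n) ->
    exists x, hdom H x /\ hcvg H u x) ->
  hcomplete H.
Proof.
move=> ipH cH u a du a0 ua; have [x [dx [b b0 ub]]] := cH u a du a0 ua.
exists x; split => // n; rewrite -subr_le0.
apply: (@le0_cvg0 _ _ (fun m => b (m + n)%N)); first by rewrite cvg_shiftn.
move=> m; rewrite lerBlDl; apply: le_trans (nrmB_tri ipH (z := u (m + n)%N) _ _ _) _ => //.
by apply: lerD => //; rewrite (nrmBC ipH)// ua// leq_addl.
Qed.

(** Pull the structure back along an isometry with closed image. The Hilbert
    spaces of operators below descend in this way from square-summable families. *)
Lemma hilbert_transfer (V W : lmodType R[i]) (H : prehilbert V) (K : prehilbert W)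
    (Phi : V -> W) : inner_product_space K -> hcomplete K ->
  hdom H 0 -> (forall a x y, hdom H x -> hdom H y -> hdom H (a *: x + y)) ->
  (forall x, hdom H x -> hdom K (Phi x)) ->
  (forall a x y, hdom H x -> hdom H y -> Phi (a *: x + y) = a *: Phi x + Phi y) ->
  (forall x y, hdom H x -> hdom H y -> hip H x y = hip K (Phi x) (Phi y)) ->
  (forall x, hdom H x -> Phi x = 0 -> x = 0) ->
  (forall u w, (forall n, hdom H (u n)) -> hdom K w -> hcvg K (Phi \o u) w ->
    exists x, hdom H x /\ Phi x = w) ->
  inner_product_space H /\ hcomplete H.
Proof.
move=> ipK cK d0 dl dP Pl Pip P0 Pc.
have ipH : inner_product_space H.
  split => //.
  - move=> a x y z dx dy dz; rewrite !Pip//; last exact: dl.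
    by rewrite Pl// (ips_lin ipK)//; exact: dP.
  - by move=> x y dx dy; rewrite !Pip// (ips_conj ipK)//; exact: dP.
  - by move=> x dx; rewrite Pip// (ips_ge0 ipK)//; exact: dP.
  - move=> x dx; rewrite Pip// => /(ips_eq0 ipK (dP _ dx)); exact: P0.
split => // u a du a0 ua.
have PB x y : hdom H x -> hdom H y -> Phi (x - y) = Phi x - Phi y.
  move=> dx dy; rewrite addrC -scaleN1r Pl// scaleN1r addrC //.
have nB x y : hdom H x -> hdom H y -> hnorm K (Phi x - Phi y) = hnorm H (x - y).
  by move=> dx dy; rewrite /hnorm (Pip (x - y)) ?PB//; exact: (domB ipH).
have [m n nm|w [dw uw]] := cK (Phi \o u) a (fun n => dP _ (du n)) a0.
  by rewrite /= nB//; exact: ua.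
have [x [dx xw]] := Pc u w du dw (ex_intro2 _ _ a a0 uw).
by exists x; split => // n; rewrite -nB// xw; exact: uw.
Qed.

Section DirectSum.
Variables (V W : lmodType R[i]) (H : prehilbert V) (K : prehilbert W).
Hypotheses (ipH : inner_product_space H) (ipK : inner_product_space K).

Lemma hsum_ip : inner_product_space (hsum H K).
Proof.
split => /=.
- by split; exact: dom0.
- by move=> a [x1 x2] [y1 y2] /= [? ?] [? ?]; split; exact: ips_dom.
- move=> a [x1 x2] [y1 y2] [z1 z2] /= [? ?] [? ?] [? ?].
  by rewrite (ips_lin ipH)// (ips_lin ipK)// mulrDr addrACA.
- move=> [x1 x2] [y1 y2] /= [? ?] [? ?].
  by rewrite (ips_conj ipH)// (ips_conj ipK (x := x2))// rmorphD.
- by move=> [x1 x2] /= [? ?]; rewrite addr_ge0 ?(ips_ge0 ipH) ?(ips_ge0 ipK).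
- move=> [x1 x2] /= [d1 d2] /eqP.
  rewrite paddr_eq0 ?(ips_ge0 ipH) ?(ips_ge0 ipK)// => /andP[/eqP e1 /eqP e2].
  by rewrite (ips_eq0 ipH d1 e1) (ips_eq0 ipK d2 e2).
Qed.

Lemma sqr_hsum_nrm x : hdom (hsum H K) x ->
  hnorm (hsum H K) x ^+ 2 = hnorm H x.1 ^+ 2 + hnorm K x.2 ^+ 2.
Proof.
move=> [d1 d2]; rewrite (sqr_nrm hsum_ip)// (sqr_nrm ipH)// (sqr_nrm ipK)//.
by rewrite /= ReD.
Qed.

Lemma hsum_nrm1 x : hdom (hsum H K) x -> hnorm H x.1 <= hnorm (hsum H K) x.
Proof.
by move=> dx; rewrite -ler_sqr ?nnegrE ?nrm_ge0// sqr_hsum_nrm// lerDl sqr_ge0.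
Qed.

Lemma hsum_nrm2 x : hdom (hsum H K) x -> hnorm K x.2 <= hnorm (hsum H K) x.
Proof.
by move=> dx; rewrite -ler_sqr ?nnegrE ?nrm_ge0// sqr_hsum_nrm// lerDr sqr_ge0.
Qed.

Lemma hsum_nrm_le x : hdom (hsum H K) x -> hnorm (hsum H K) x <= hnorm H x.1 + hnorm K x.2.
Proof.
move=> dx; rewrite -ler_sqr ?nnegrE ?addr_ge0 ?nrm_ge0// sqr_hsum_nrm// sqrrD.
by rewrite lerD2r lerDl mulrn_wge0// mulr_ge0 ?nrm_ge0.
Qed.

Lemma hsum_complete : hcomplete H -> hcomplete K -> hcomplete (hsum H K).
Proof.
move=> cH cK; apply: hcomplete_of_hcvg; first exact: hsum_ip.
move=> u a du a0 ua.
have dB m n : hdom (hsum H K) (u m - u n) by apply: (domB hsum_ip).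
have [|m n nm|x [dx ux]] := cH (fun n => (u n).1) a _ a0.
- by move=> n; case: (du n).
- exact: le_trans (hsum_nrm1 (dB m n)) (ua _ _ nm).
have [|m n nm|y [dy uy]] := cK (fun n => (u n).2) a _ a0.
- by move=> n; case: (du n).
- exact: le_trans (hsum_nrm2 (dB m n)) (ua _ _ nm).
exists (x, y); split => //; exists (fun n => a n + a n); first exact: cvg0D.
move=> n; apply: le_trans (hsum_nrm_le _) _.
  by apply: (domB hsum_ip).
by apply: lerD; [exact: ux|exact: uy].
Qed.

End DirectSum.

(** ** Square-summable families *)

Section L2.
Variable I : choiceType.
Local Notation normc := (Normc.normc).
Local Notation "x %:C" := (real_complex R x).
Local Notation L := (L2space R I).
Implicit Types f g h : l2 R I.

Lemma l2_summable f : nnsummable (fun i => normc (f i) ^+ 2).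
Proof. exact: (l2valP f). Qed.

Lemma l2P f g : (forall i, f i = g i) -> f = g.
Proof. by move=> fg; apply/val_inj/funext. Qed.

Lemma to_l2E (f : I -> R[i]^o) : nnsummable (fun i => normc (f i) ^+ 2) -> to_l2 f = f :> (I -> R[i]^o).
Proof. by move=> sf; rewrite /to_l2 -[RHS](@insubdK _ _ _ (0 : l2 R I))//. Qed.

Lemma l2DE f g i : (f + g) i = f i + g i. Proof. by []. Qed.
Lemma l2BE f g i : (f - g) i = f i - g i. Proof. by []. Qed.
Lemma l2ZE (a : R[i]) f i : (a *: f) i = a * f i. Proof. by []. Qed.
Lemma l20E i : (0 : l2 R I) i = 0. Proof. by []. Qed.

Lemma normc_mul_le (z w : R[i]) : normc (z * w^*) <= normc z ^+ 2 + normc w ^+ 2.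
Proof.
rewrite Normc.normcM normc_conj.
have := sqr_ge0 (normc z - normc w); have := sqr_ge0 (normc z + normc w).
rewrite sqrrB sqrrD; lra.
Qed.

Lemma l2_ip_summable f g : abs_summable (fun i => f i * (g i)^*).
Proof.
apply: abs_summable_le (fun i => normc_mul_le _ _) _.
by apply: nnsummableD (l2_summable f) (l2_summable g) => i; exact: sqr_ge0.
Qed.

Lemma l2_ipxx f : hip L f f = (nnsum (fun i => normc (f i) ^+ 2))%:C.
Proof.
rewrite -csum_nneg; [|by move=> i; exact: sqr_ge0|exact: l2_summable].
by congr csum; apply/funext => i; rewrite mulc_conj.
Qed.

Lemma sqr_l2_nrm f : hnorm L f ^+ 2 = nnsum (fun i => normc (f i) ^+ 2).
Proof.
by rewrite /hnorm l2_ipxx /= sqr_sqrtr// nnsum_ge0// => i; exact: sqr_ge0.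
Qed.

Lemma l2_ip : inner_product_space L.
Proof.
split => //.
- move=> a f g h _ _ _.
  have sf := l2_ip_summable f h; have sg := l2_ip_summable g h.
  rewrite [RHS](_ : _ = csum (fun i => a * (f i * (h i)^* )) + hip L g h); last first.
    by rewrite [in RHS](csumZ a sf).
  rewrite -(csumD (abs_summableZ a sf) sg).
  by congr csum; apply/funext => i; rewrite l2DE l2ZE mulrDl mulrA.
- move=> f g _ _ /=; rewrite -csum_conj.
  by congr csum; apply/funext => i; rewrite rmorphM/= conjCK mulrC.
- move=> f _; rewrite l2_ipxx ler0c nnsum_ge0// => i; exact: sqr_ge0.
- move=> f _; rewrite l2_ipxx => /complexI f0; apply: l2P => i.
  apply: Normc.eq0_normc; apply/eqP; rewrite -sqrf_eq0; apply/eqP.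
  exact: (nnsum_eq0 (fun=> sqr_ge0 _) (l2_summable f) f0).
Qed.

Lemma l2_coord_le f i : normc (f i) <= hnorm L f.
Proof.
rewrite -ler_sqr ?nnegrE ?normc_ge0 ?nrm_ge0// sqr_l2_nrm.
by apply: (nnsum_ge (a := fun i => normc (f i) ^+ 2)) (l2_summable f) => j; exact: sqr_ge0.
Qed.

(** The limit is the infimum of the upper bounds v_n + a_n, which dominate all the
    lower bounds v_n - a_n. *)
Lemma cauchy_limit (v a : nat -> R) :
  (forall m n, (n <= m)%N -> `|v m - v n| <= a n) ->
  exists l, forall n, `|v n - l| <= a n.
Proof.
move=> va; have a0 n : 0 <= a n by apply: le_trans (va n n (leqnn _)).
have cmp m n : v m - a m <= v n + a n.
  have [mn|/ltnW nm] := leqP m n.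
    by have := va _ _ mn; rewrite ler_norml => /andP[+ _]; have := a0 n; lra.
  by have := va _ _ nm; rewrite ler_norml => /andP[_ +]; have := a0 m; lra.
pose A := [set v n + a n | n in setT].
have A0 : A !=set0 by exists (v 0%N + a 0%N), 0%N.
have lA m : lbound A (v m - a m) by move=> _ [n _ <-]; exact: cmp.
exists (inf A) => n; rewrite ler_norml; apply/andP; split.
  rewrite lerBrDr addrC; have : inf A <= v n + a n.
    by apply: ge_inf; [exists (v 0%N - a 0%N)|exists n].
  lra.
by have := lb_le_inf A0 (lA n); lra.
Qed.

Lemma esum_le_fin (b : I -> R) (M : R) :
  (forall s : seq I, uniq s -> \sum_(i <- s) b i <= M) ->
  (\esum_(i in [set: I]) (b i)%:E <= M%:E)%E.
Proof.
move=> H; apply: ge_ereal_sup => _ [F [finF _] <-].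
by rewrite fsbig_finite//= sumEFin lee_fin; apply: H; exact: fset_uniq.
Qed.

Lemma seq_le_nnsum (b : I -> R) (s : seq I) : uniq s -> (forall i, 0 <= b i) ->
  nnsummable b -> \sum_(i <- s) b i <= nnsum b.
Proof.
move=> us b0 sb; rewrite -lee_fin -nnsumE//; apply: esum_ge; exists [set` s].
  by split => //; exact: finite_seq.
by rewrite -fsbig_seq// sumEFin.
Qed.

(** The coordinatewise limit f is approached in norm since all finite partial sums of
    |u_n - f|^2 are limits of those of |u_n - u_m|^2. *)
Lemma l2_complete : hcomplete L.
Proof.
move=> u a du a0 ua.
have ag0 n : 0 <= a n by apply: le_trans (ua n n (leqnn _)); exact: nrm_ge0.
have uai i m n : (n <= m)%N -> normc (u m i - u n i) <= a n.
  by move=> nm; apply: le_trans (ua m n nm); have := l2_coord_le (u m - u n) i.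
have /choice[f fP] i : exists z : R[i], forall n, normc (u n i - z) <= 2 * a n.
  have [m n nm|x xP] := @cauchy_limit (fun n => complex.Re (u n i)) a.
    by rewrite -ReB; apply: le_trans (Re_le_normc _) (uai i m n nm).
  have [m n nm|y yP] := @cauchy_limit (fun n => complex.Im (u n i)) a.
    have -> : complex.Im (u m i) - complex.Im (u n i) = complex.Im (u m i - u n i).
      by case: (u m i) (u n i) => ? ? [].
    exact: le_trans (Im_le_normc _) (uai i m n nm).
  exists (Complex x y) => n; apply: le_trans (normc_le _) _.
  have := xP n; have := yP n; case: (u n i) => p q /=; lra.
have bound n (s : seq I) : uniq s -> \sum_(i <- s) normc (u n i - f i) ^+ 2 <= a n ^+ 2.
  move=> us; rewrite -subr_le0.
  pose N : R := (size s)%:R.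
  pose b m := (4 * N * a n) * a (m + n)%N + (4 * N) * (a (m + n)%N * a (m + n)%N).
  apply: (@le0_cvg0 _ _ b).
    have a0n : (fun m => a (m + n)%N) @ \oo --> (0 : R) by rewrite cvg_shiftn.
    apply: cvg0D; first exact: cvg0Z.
    by apply: cvg0Z; rewrite -[X in _ --> X](mulr0 (0 : R)); apply: cvgM.
  move=> m; rewrite lerBlDl.
  have unm : nnsum (fun i => normc ((u (m + n)%N - u n) i) ^+ 2) <= a n ^+ 2.
    rewrite -sqr_l2_nrm ler_sqr ?nnegrE ?nrm_ge0 ?ag0//; apply: ua; exact: leq_addl.
  have := seq_le_nnsum us (fun=> sqr_ge0 _) (l2_summable (u (m + n)%N - u n)).
  move=> /le_trans /(_ unm) {}unm.
  apply: le_trans (_ : \sum_(i <- s) (normc ((u (m + n)%N - u n) i) ^+ 2 +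
     (4 * a n * a (m + n)%N + 4 * (a (m + n)%N * a (m + n)%N))) <= _).
    apply: ler_sum => i _; rewrite l2BE.
    have tri : normc (u n i - f i) <= normc (u (m + n)%N i - u n i) + 2 * a (m + n)%N.
      have -> : u n i - f i = - (u (m + n)%N i - u n i) + (u (m + n)%N i - f i).
        by rewrite opprB subrKA.
      apply: le_trans (le_normcD _ _) _; rewrite normcN lerD2l; exact: fP.
    have uin := uai i (m + n)%N n (leq_addl _ _).
    have nn := normc_ge0 (u n i - f i).
    have n1 := normc_ge0 (u (m + n)%N i - u n i).
    have am := ag0 (m + n)%N.
    have {}tri : normc (u n i - f i) ^+ 2 <= (normc (u (m + n)%N i - u n i) + 2 * a (m + n)%N) ^+ 2.
      by rewrite ler_sqr ?nnegrE ?addr_ge0 ?mulr_ge0.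
    apply: le_trans tri _.
    have := ler_wpM2r am uin; set p := normc _; set q := a (m + n)%N.
    rewrite sqrrD exprMn -mulr_natl; nra.
  rewrite big_split /= lerD// big_const_seq count_predT iter_addr_0 -mulr_natr /b /N.
  by rewrite le_eqVlt; apply/orP; left; apply/eqP; ring.
have sf0 n : (\esum_(i in [set: I]) (normc (u n i - f i) ^+ 2)%:E <= (a n ^+ 2)%:E)%E.
  by apply: esum_le_fin => s; exact: bound.
have sf n : nnsummable (fun i => normc (u n i - f i) ^+ 2).
  by apply: le_lt_trans (sf0 n) _; exact: ltry.
pose g n : l2 R I := to_l2 (fun i => u n i - f i).
have gE n i : g n i = u n i - f i by rewrite /g to_l2E.
have ug n : u n - (u 0%N - g 0%N) = g n.
  by apply: l2P => i; rewrite !l2BE !gE subKr.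
exists (u 0%N - g 0%N); split => // n; rewrite ug.
rewrite -ler_sqr ?nnegrE ?nrm_ge0// sqr_l2_nrm -lee_fin -nnsumE//.
- by apply: le_trans (sf0 n); apply: le_esum => i _; rewrite gE.
- by move=> i; exact: sqr_ge0.
- exact: l2_summable.
Qed.

End L2.
End Constructions.

(** * Defect operators and their range spaces *)

Section Defect.
Variables (R : realType) (V : lmodType R[i]) (H : prehilbert V).
Local Notation C := R[i].
Local Notation dom := (hdom H).
Local Notation ip := (hip H).
Local Notation nrm := (hnorm H).

Hypothesis ipH : inner_product_space H.
Hypothesis cH : hcomplete H.
Let d0 := dom0 ipH.
Let dD := domD ipH.
Let dZ := domZ ipH.
Let dN := domN ipH.
Let dB := domB ipH.
Hint Resolve d0 dD dZ dN dB : core.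

Variable M : V -> V.
Hypothesis bM : bounded_op H M.
Hypothesis M1 : forall x, dom x -> nrm (M x) <= nrm x.

Local Notation M' := (adjoint H M).

Let M1' x : dom x -> nrm (M x) <= 1 * nrm x.
Proof. by rewrite mul1r; exact: M1. Qed.

Definition defect_op x := x - M (M' x).

Let dM := bop_dom bM.
Let bM' := adjoint_bounded ipH cH bM.
Let dM' := bop_dom bM'.
Hint Resolve dM dM' : core.

Lemma adjoint_contractive x : dom x -> nrm (M' x) <= nrm x.
Proof. by move=> dx; rewrite -[leRHS]mul1r; exact: (adjoint_le ipH cH bM M1'). Qed.

Let MM'_bounded : bounded_op H (M \o M').
Proof.
split.
- by move=> x dx /=; auto.
- move=> a x y dx dy; have [_ l _] := bM'; have [_ l' _] := bM.
  by rewrite /= (l a x y dx dy) l'//; auto.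
- exists 1 => x dx; apply: le_trans (M1' (dM' dx)) _.
  by rewrite !mul1r adjoint_contractive.
Qed.

Let MM'_symmetric : symmetric_op H (M \o M').
Proof.
move=> x y dx dy /=; rewrite (adjointE ipH cH bM); auto.
by rewrite (adjointE' ipH cH bM); auto.
Qed.

Local Notation P := (pos_sqrt H defect_op).

Lemma sqrt_defect_pos : is_pos_sqrt H defect_op P /\
  forall A, bounded_op H A -> (forall x, dom x -> A (M (M' x)) = M (M' (A x))) ->
    forall x, dom x -> A (P x) = P (A x).
Proof.
apply: (pos_sqrtP ipH cH MM'_bounded MM'_symmetric) => // x dx.
by apply: le_trans (M1 (dM' dx)) _; exact: adjoint_contractive.
Qed.

Let bP : bounded_op H P. Proof. by case: sqrt_defect_pos => -[]. Qed.
Let dP := bop_dom bP.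
Hint Resolve dP : core.

Lemma sqrt_defect_sym x y : dom x -> dom y -> ip (P x) y = ip x (P y).
Proof. by case: sqrt_defect_pos => -[_ pP _] _; exact: (pos_symmetric ipH bP pP). Qed.

(** |P x|^2 = (P P x, x) = |x|^2 - (M M' x, x). *)
Lemma sqr_nrm_sqrt_defect x : dom x -> nrm (P x) ^+ 2 = nrm x ^+ 2 - nrm (M' x) ^+ 2.
Proof.
move=> dx; have dPx := dP dx; have dM'x := dM' dx.
have [[_ _ PP] _] := sqrt_defect_pos.
rewrite (sqr_nrm ipH dPx) (sqrt_defect_sym dx dPx) (PP _ dx).
rewrite (ipBr ipH dx (dM dM'x) dx) ReB -(adjointE' ipH cH bM dM'x dx).
by rewrite -(sqr_nrm ipH dx) -(sqr_nrm ipH dM'x).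
Qed.

Lemma sqrt_defect_contractive x : dom x -> nrm (P x) <= nrm x.
Proof.
move=> dx; rewrite -ler_sqr ?nnegrE ?nrm_ge0// (sqr_nrm_sqrt_defect dx).
by rewrite gerBl sqr_ge0.
Qed.

(** Both |x|^2 and |M' x|^2 split orthogonally along E and 1 - E, hence so does their
    difference |P x|^2. *)
Lemma sqrt_defect_proj (E : V -> V) x : bounded_op H E ->
  (forall x y, dom x -> dom y -> ip (E x) y = ip x (E y)) ->
  (forall x, dom x -> E (E x) = E x) -> (forall x, dom x -> M' (E x) = E (M' x)) ->
  dom x -> nrm (P (E x)) <= nrm (P x).
Proof.
move=> bE sE EE EM dx; have dE := bop_dom bE.
have split y : dom y -> nrm y ^+ 2 = nrm (E y) ^+ 2 + nrm (y - E y) ^+ 2.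
  move=> dy; have dEy := dE _ dy; have dy' := dB dy dEy.
  have -> : nrm y ^+ 2 = nrm (E y + (y - E y)) ^+ 2 by rewrite addrC subrK.
  rewrite (sqr_nrmD ipH dEy dy') (sE _ _ dy dy') (bopB ipH bE dy dEy) (EE _ dy) subrr.
  by rewrite (ip0r ipH dy) mulr0 addr0.
have dEx := dE _ dx; have dx' := dB dx dEx.
rewrite -ler_sqr ?nnegrE ?nrm_ge0// (sqr_nrm_sqrt_defect dEx) (sqr_nrm_sqrt_defect dx).
rewrite (split _ dx) (split _ (dM' dx)) -(EM _ dx) -(bopB ipH bM' dx dEx).
have := sqr_ge0 (nrm (P (x - E x))); rewrite (sqr_nrm_sqrt_defect dx'); lra.
Qed.

End Defect.

Section RangeSpace.
Variables (R : realType) (V : lmodType R[i]) (H : prehilbert V).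
Local Notation C := R[i].
Local Notation dom := (hdom H).
Local Notation ip := (hip H).
Local Notation nrm := (hnorm H).

Hypothesis ipH : inner_product_space H.
Hypothesis cH : hcomplete H.

Variables (B P pr pre : V -> V).

(** The range of P with the norm carried over from the orthogonal complement of the
    kernel of P. *)
Definition range_space : prehilbert V :=
  Prehilbert (P @` dom) (fun x y =>
    let x' := pre x in let y' := pre y in ip (x' - pr x') (y' - pr y')).

Hypothesis BP : is_pos_sqrt H B P.
Hypothesis P1 : forall x, dom x -> nrm (P x) <= nrm x.
Hypothesis P_sym : forall x y, dom x -> dom y -> ip (P x) y = ip x (P y).

Local Notation K := [set x | dom x /\ B x = 0].
Let bP : bounded_op H P. Proof. by case: BP. Qed.
Let dP := bop_dom bP.

Let kerP x : K x <-> dom x /\ P x = 0.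
Proof.
have [_ _ PP] := BP; split=> -[dx x0]; split => //; last by rewrite -PP// x0 (bop0 ipH bP).
apply: (nrm_eq0 ipH (dP dx)); apply/eqP; rewrite -sqrf_eq0; apply/eqP.
by rewrite (sqr_nrm ipH (dP dx)) (P_sym dx (dP dx)) PP// x0 (ip0r ipH dx).
Qed.

(** The kernel of P P equals that of P, and it is closed since P is bounded. *)
Lemma ker_sqrt_proj : is_orth_proj H K (orth_proj H K).
Proof.
apply: (orth_projP ipH cH).
- by move=> x [].
- by apply/kerP; split; [exact: (dom0 ipH)|exact: (bop0 ipH bP)].
- move=> a x y /kerP[dx x0] /kerP[dy y0]; apply/kerP.
  split; first exact: (ips_dom ipH).
  by case: bP => _ l _; rewrite (l a x y dx dy) x0 y0 scaler0 addr0.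
- move=> u x Ku dx [a a0 ux]; apply/kerP; split => //.
  apply: (nrm_le0 ipH (dP dx)); apply: (le0_cvg0 a0) => n.
  have /kerP[du u0] := Ku n; apply: le_trans (ux n).
  have dB := domB ipH du dx; apply: le_trans (P1 dB).
  by rewrite (bopB ipH bP du dx) u0 sub0r (nrmN ipH (dP dx)).
Qed.

Hypothesis prP : is_orth_proj H K pr.
Hypothesis preP : forall x, (P @` dom) x -> dom (pre x) /\ P (pre x) = x.

Definition coker x : Prop := forall y, dom y -> P y = 0 -> ip x y = 0.

Lemma coker_range x : dom x -> coker (P x).
Proof. by move=> dx y dy y0; rewrite (P_sym dx dy) y0 (ip0r ipH dx). Qed.

Lemma coker_inj x y : dom x -> dom y -> coker x -> coker y -> P x = P y -> x = y.
Proof.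
move=> dx dy cx cy Pxy; have dB := domB ipH dx dy.
have P0 : P (x - y) = 0 by rewrite (bopB ipH bP dx dy) Pxy subrr.
apply/eqP; rewrite -subr_eq0; apply/eqP/(ips_eq0 ipH dB).
by rewrite {1}(ipBl ipH dx dy dB) (cx _ dB P0) (cy _ dB P0) subrr.
Qed.

Lemma coker_part x : dom x ->
  [/\ dom (x - pr x), P (x - pr x) = P x, coker (x - pr x) & nrm (x - pr x) <= nrm x].
Proof.
move=> dx; have [/kerP[dK K0] perp] := prP dx; have dB := domB ipH dx dK.
have cB : coker (x - pr x) by move=> y dy y0; apply: perp; exact/kerP.
split => //; first by rewrite (bopB ipH bP dx dK) K0 subr0.
rewrite -ler_sqr ?nnegrE ?nrm_ge0// -[in leRHS](subrK (pr x) x).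
by rewrite (sqr_nrmD ipH dB dK) (cB _ dK K0) mulr0 addr0 lerDl sqr_ge0.
Qed.

Definition coker_lift x := pre x - pr (pre x).

Lemma coker_liftP x : hdom range_space x ->
  [/\ dom (coker_lift x), P (coker_lift x) = x & coker (coker_lift x)].
Proof.
move=> /preP[dp px]; have [d1 d2 d3 _] := coker_part dp.
by split => //; rewrite [LHS]d2.
Qed.

Lemma range_dom x : dom x -> hdom range_space (P x).
Proof. by move=> dx; exists x. Qed.

Lemma coker_lift_eq x y : dom y -> coker y -> P y = x -> coker_lift x = y.
Proof.
move=> dy cy yx; have dx : hdom range_space x by exists y.
have [d1 d2 d3] := coker_liftP dx.
by apply: (coker_inj d1 dy d3 cy); rewrite d2 yx.
Qed.

Lemma range_sub x : hdom range_space x -> dom x.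
Proof. by move=> [y dy <-]; exact: dP. Qed.

Lemma range_ipE x y : hip range_space x y = ip (coker_lift x) (coker_lift y). Proof. by []. Qed.

Lemma range_lin (a : C) x y : hdom range_space x -> hdom range_space y ->
  hdom range_space (a *: x + y) /\ coker_lift (a *: x + y) = a *: coker_lift x + coker_lift y.
Proof.
move=> dx dy; have [d1 d2 d3] := coker_liftP dx; have [e1 e2 e3] := coker_liftP dy.
have dl := ips_dom ipH a d1 e1.
have E : P (a *: coker_lift x + coker_lift y) = a *: x + y.
  by case: bP => _ l _; rewrite (l a _ _ d1 e1) d2 e2.
split; first by rewrite -E; exact: range_dom.
apply: coker_lift_eq => // z dz z0; rewrite (ips_lin ipH a d1 e1 dz) (d3 _ dz z0) (e3 _ dz z0).
by rewrite mulr0 addr0.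
Qed.

(** [coker_lift] is an isometry onto the orthogonal complement of the kernel of P. *)
Lemma range_hilbert : inner_product_space range_space /\ hcomplete range_space.
Proof.
apply: (hilbert_transfer ipH cH (Phi := coker_lift)).
- by rewrite -(bop0 ipH bP); apply: range_dom; exact: (dom0 ipH).
- by move=> a x y dx dy; case: (range_lin a dx dy).
- by move=> x /coker_liftP[].
- by move=> a x y dx dy; case: (range_lin a dx dy).
- by move=> x y _ _; exact: range_ipE.
- by move=> x /coker_liftP[_ Px _] x0; rewrite -Px x0; exact: (bop0 ipH bP).
- move=> u w du dw uw; exists (P w); split; first exact: range_dom.
  apply: coker_lift_eq => // y dy y0.
  apply: (hcvg_ip0 ipH (u := coker_lift \o u) _ dw dy uw).
    by move=> n; have [] := coker_liftP (du n).
  by move=> n; have [_ _ c] := coker_liftP (du n); exact: c.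
Qed.

Lemma range_nrm_le x : dom x -> hnorm range_space (P x) <= nrm x.
Proof.
move=> dx; have [d1 d2 d3 d4] := coker_part dx.
have -> : hnorm range_space (P x) = nrm (coker_lift (P x)) by [].
by rewrite (coker_lift_eq d1 d3 d2).
Qed.

Lemma range_nrmE x : hnorm range_space x = nrm (coker_lift x). Proof. by []. Qed.

Lemma nrm_le_range x : hdom range_space x -> nrm x <= hnorm range_space x.
Proof.
by move=> dx; have [d1 d2 _] := coker_liftP dx; rewrite range_nrmE -{1}d2; exact: P1.
Qed.

(** The vector P y lies in the orthogonal complement of the kernel, so it is the lift
    of P (P y). *)
Lemma range_reproducing x y : hdom range_space x -> dom y ->
  hip range_space x (P (P y)) = ip x y.
Proof.
move=> dx dy; have [d1 d2 d3] := coker_liftP dx; have dPy := dP dy.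
by rewrite range_ipE (coker_lift_eq dPy (coker_range dy) erefl) -(P_sym d1 dy) d2.
Qed.

End RangeSpace.

(** * Bounded operators on square-summable families and their matrices *)

Section Operators.
Variables (R : realType) (T : choiceType).
Local Notation C := R[i].
Local Notation normc := (Normc.normc).
Local Notation "x %:C" := (real_complex R x).
Local Notation L := (L2space R T).
Local Notation op := (l2 R T -> l2 R T).
Local Notation chi := (chi R).
Local Notation ip := (hip L).
Local Notation nrm := (hnorm L).
Local Notation bounded := (@bounded_operator R T).
Implicit Types (A B F G : op) (f g : l2 R T) (s t : T).

Lemma chiE t s : chi t s = (s == t)%:R :> C.
Proof.
rewrite /chi to_l2E//.
apply: (nnsum_single (i0 := t) _ _).1; first exact: sqr_ge0.
by move=> i /negPf ->; rewrite Normc.normc0 expr0n.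
Qed.

Lemma ip_chi f s : ip f (chi s) = f s.
Proof.
rewrite /= (csum_single (i0 := s) _).2 ?chiE ?eqxx ?conjC1 ?mulr1// => t ts.
by rewrite chiE (negPf ts) conjC0 mulr0.
Qed.

Section OneOperator.
Variable A : op.
Hypothesis bA : bounded A.

Lemma opD f g : A (f + g) = A f + A g. Proof. exact: (bopD bA). Qed.
Lemma opZ (a : C) f : A (a *: f) = a *: A f. Proof. exact: (bopZ (l2_ip R T) bA). Qed.
Lemma op0 : A 0 = 0. Proof. exact: (bop0 (l2_ip R T) bA). Qed.
Lemma op_bound : exists2 M : R, 0 <= M & forall f, nrm (A f) <= M * nrm f.
Proof. by have [M M0 AM] := bop_bound bA; exists M => // f; exact: AM. Qed.

Lemma adjE f g : ip (A f) g = ip f (adj A g).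
Proof. exact: (adjointE (l2_ip R T) (@l2_complete R T) bA). Qed.

Lemma adjE' f g : ip (adj A g) f = ip g (A f).
Proof. exact: (adjointE' (l2_ip R T) (@l2_complete R T) bA). Qed.

Lemma bounded_adj : bounded (adj A).
Proof. exact: (adjoint_bounded (l2_ip R T) (@l2_complete R T) bA). Qed.

Lemma adj_entry s t : adj A (chi s) t = (A (chi t) s)^*.
Proof.
rewrite -ip_chi adjE' (ips_conj (l2_ip R T) (x := A (chi t)))// ip_chi //.
Qed.

Lemma op_coord f s : A f s = ip f (adj A (chi s)).
Proof. by rewrite -adjE ip_chi. Qed.

Lemma op_csum f s : A f s = csum (fun t => f t * A (chi t) s).
Proof.
by rewrite op_coord; congr csum; apply/funext => t; rewrite adj_entry conjCK.
Qed.

Lemma op_csum_summable f s : abs_summable (fun t => f t * A (chi t) s).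
Proof.
have := l2_ip_summable f (adj A (chi s)).
by congr abs_summable; apply/funext => t; rewrite adj_entry conjCK.
Qed.

End OneOperator.

Lemma adj_eq A B : bounded A -> (forall f g, ip (A f) g = ip f (B g)) -> adj A = B.
Proof.
move=> bA AB; apply/funext => g.
by apply: (adjoint_eq (l2_ip R T) (@l2_complete R T) bA).
Qed.

(** An operator is determined by its matrix, since each coordinate of A f is the inner
    product of f with a column of the adjoint. *)
Lemma op_ext A B : bounded A -> bounded B ->
  (forall s t, A (chi t) s = B (chi t) s) -> A = B.
Proof.
move=> bA bB AB; apply/funext => f; apply: l2P => s.
by rewrite !op_csum//; congr csum; apply/funext => t; rewrite AB.
Qed.

Lemma bounded_of A (M : R) : (forall (a : C) f g, A (a *: f + g) = a *: A f + A g) ->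
  (forall f, nrm (A f) <= M * nrm f) -> bounded A.
Proof. by move=> l b; split => //; exists M => f _; exact: b. Qed.

Lemma bounded_comp A B : bounded A -> bounded B -> bounded (A \o B).
Proof.
move=> bA bB; have [M M0 AM] := op_bound bA; have [N N0 BN] := op_bound bB.
apply: (@bounded_of _ (M * N)) => [a f g|f] /=.
  by rewrite (opD bB) (opZ bB) (opD bA) (opZ bA).
by apply: le_trans (AM _) _; rewrite -mulrA ler_wpM2l.
Qed.

Lemma bounded_lin (a : C) A B : bounded A -> bounded B -> bounded (a *: A + B).
Proof.
move=> bA bB; have [M M0 AM] := op_bound bA; have [N N0 BN] := op_bound bB.
apply: (@bounded_of _ (normc a * M + N)) => [b f g|f].
  have -> : (a *: A + B) (b *: f + g) = a *: A (b *: f + g) + B (b *: f + g) by [].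
  rewrite (opD bA) (opZ bA) (opD bB) (opZ bB).
  have -> : (a *: A + B) f = a *: A f + B f by [].
  have -> : (a *: A + B) g = a *: A g + B g by [].
  by rewrite !scalerDr !scalerA (mulrC a) addrACA.
have -> : (a *: A + B) f = a *: A f + B f by [].
apply: le_trans (nrmD (l2_ip R T) _ _) _ => //.
rewrite (nrmZ (l2_ip R T))// mulrDl lerD// -mulrA ler_wpM2l// normc_ge0//.
Qed.

Lemma bounded0 : bounded 0.
Proof.
apply: (@bounded_of _ 0) => [a f g|f].
  by have E h : (0 : op) h = 0 by []; rewrite !E scaler0 addr0.
by rewrite mul0r (nrm0 (l2_ip R T)).
Qed.

Lemma bounded_id : bounded id.
Proof. by apply: (@bounded_of _ 1) => // f; rewrite mul1r. Qed.

Lemma boundedB A B : bounded A -> bounded B -> bounded (A - B).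
Proof. by move=> bA bB; rewrite addrC -scaleN1r; exact: bounded_lin. Qed.

Lemma adjK A : bounded A -> adj (adj A) = A.
Proof.
move=> bA; apply: adj_eq; first exact: bounded_adj.
by move=> f g; rewrite adjE'.
Qed.

Lemma adj_comp A B : bounded A -> bounded B -> adj (A \o B) = adj B \o adj A.
Proof.
move=> bA bB; apply: adj_eq; first exact: bounded_comp.
by move=> f g; rewrite -[(A \o B) f]/(A (B f)) (adjE bA) (adjE bB).
Qed.

(** ** Hilbert-Schmidt operators *)

Definition sqmat F : T * T -> R := fun p => normc (F (chi p.2) p.1) ^+ 2.

Definition hs F : Prop := bounded F /\ nnsummable (sqmat F).

Lemma sqmat_ge0 F p : 0 <= sqmat F p. Proof. exact: sqr_ge0. Qed.

Lemma nrm_col F t : nrm (F (chi t)) ^+ 2 = nnsum (fun s => sqmat F (s, t)).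
Proof. by rewrite sqr_l2_nrm. Qed.

Lemma nrm_row F s : bounded F -> nrm (adj F (chi s)) ^+ 2 = nnsum (fun t => sqmat F (s, t)).
Proof.
move=> bF; rewrite sqr_l2_nrm; congr nnsum; apply/funext => t.
by rewrite adj_entry// normc_conj.
Qed.

Lemma sqmat_swap F : (nnsummable (fun p => sqmat F (p.2, p.1)) <-> nnsummable (sqmat F)) /\
  nnsum (fun p => sqmat F (p.2, p.1)) = nnsum (sqmat F).
Proof. by rewrite /nnsummable /nnsum esum_swap. Qed.

Lemma hs_cols F : nnsummable (sqmat F) <-> nnsummable (fun t => nrm (F (chi t)) ^+ 2).
Proof.
rewrite -(sqmat_swap F).1; under [in X in _ <-> X]eq_fun do rewrite nrm_col.
split => [/nnsum_pair[] //=|s].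
  by move=> p; exact: sqmat_ge0.
apply: nnsummable_pair => //=; first by move=> p; exact: sqmat_ge0.
by move=> t; exact: (l2_summable (F (chi t))).
Qed.

Lemma hs_rows F : bounded F ->
  nnsummable (sqmat F) <-> nnsummable (fun s => nrm (adj F (chi s)) ^+ 2).
Proof.
move=> bF; under [in X in _ <-> X]eq_fun do rewrite (nrm_row _ bF).
split => [/nnsum_pair[] //=|s].
  by move=> p; exact: sqmat_ge0.
apply: nnsummable_pair => //=; first by move=> p; exact: sqmat_ge0.
move=> t; have := l2_summable (adj F (chi t)).
by congr nnsummable; apply/funext => u; rewrite adj_entry// normc_conj.
Qed.

Lemma trace_entryE F t : bounded F ->
  trace_entry (adj F \o F) t = (nrm (F (chi t)) ^+ 2)%:C.
Proof. by move=> bF; rewrite /trace_entry /= -(ipxx (l2_ip R T))// -adjE'. Qed.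

Lemma hs_trace_class F : bounded F -> trace_class (adj F \o F) <-> nnsummable (sqmat F).
Proof.
move=> bF; rewrite (hs_cols F) /trace_class /abs_summable.
have -> // : (fun t => (normc (trace_entry (adj F \o F) t))%:E) = (fun t => (nrm (F (chi t)) ^+ 2)%:E).
by apply/funext => t; rewrite trace_entryE// normc_real ger0_norm// sqr_ge0.
Qed.

Definition mat F : l2 R (T * T)%type := to_l2 (fun p => F (chi p.2) p.1).

Lemma matE F p : hs F -> mat F p = F (chi p.2) p.1.
Proof. by case=> bF sF; rewrite /mat to_l2E. Qed.

Lemma hs_ipE F G : hs F -> hs G ->
  trace (adj G \o F) = hip (L2space R (T * T)%type) (mat F) (mat G).
Proof.
move=> hF hG; have sum := l2_ip_summable (mat F) (mat G).
rewrite /= -csum_swap; have [_ _ ->] := csum_pair (abs_summable_swap sum).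
congr csum; apply/funext => t; case: (hG) => bG _.
rewrite /trace_entry -[(adj G \o F) (chi t)]/(adj G (F (chi t))) (adjE' bG).
by congr csum; apply/funext => s; rewrite !matE.
Qed.

Lemma hs_ip_rows F G : hs F -> hs G ->
  trace (adj G \o F) = csum (fun s => ip (adj G (chi s)) (adj F (chi s))).
Proof.
move=> hF hG; rewrite hs_ipE// [LHS]/=.
have [_ _ ->] := csum_pair (l2_ip_summable (mat F) (mat G)).
congr csum; apply/funext => s; congr csum; apply/funext => t.
case: (hF) (hG) => bF _ [bG _].
by rewrite !matE//= !adj_entry// conjCK mulrC.
Qed.

Lemma hs_compl A F : bounded A -> hs F -> hs (A \o F).
Proof.
move=> bA [bF /hs_cols sF]; split; first exact: bounded_comp.
have [M M0 AM] := op_bound bA.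
apply/hs_cols; apply: nnsummable_le (nnsummableZ (c := M ^+ 2) _ _ sF) => [t|t|].
- by rewrite /= -exprMn ler_sqr ?nnegrE ?mulr_ge0 ?nrm_ge0.
- exact: sqr_ge0.
- exact: sqr_ge0.
Qed.

Lemma hs_compr A F : bounded A -> hs F -> hs (F \o A).
Proof.
move=> bA [bF /(hs_rows bF) sF]; have bFA := bounded_comp bF bA.
split => //; have [M M0 AM] := op_bound (bounded_adj bA).
apply/(hs_rows bFA); apply: nnsummable_le (nnsummableZ (c := M ^+ 2) _ _ sF) => [t|t|].
- by rewrite adj_comp//= -exprMn ler_sqr ?nnegrE ?mulr_ge0 ?nrm_ge0.
- exact: sqr_ge0.
- exact: sqr_ge0.
Qed.

(** Read along rows, the inner product sees F A only through A^* F^*. *)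
Lemma hs_ip_compr A F G : bounded A -> hs F -> hs G ->
  trace (adj G \o (F \o A)) = trace (adj (G \o adj A) \o F).
Proof.
move=> bA hF hG; have [bF _] := hF; have [bG _] := hG; have bA' := bounded_adj bA.
rewrite (hs_ip_rows (hs_compr bA hF) hG) (hs_ip_rows hF (hs_compr bA' hG)).
apply: eq_csum => s.
rewrite (adj_comp bF bA) (adj_comp bG bA') (adjK bA).
by rewrite -[(A \o adj G) (chi s)]/(A (adj G (chi s))) (adjE bA).
Qed.

Lemma hs_nrm_compl (M : R) A F : bounded A -> (forall f, nrm (A f) <= M * nrm f) -> hs F ->
  nnsum (sqmat (A \o F)) <= M ^+ 2 * nnsum (sqmat F).
Proof.
move=> bA AM hF; have [_ sAF] := hs_compl bA hF; have [bF sF] := hF.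
have E B : nnsummable (sqmat B) -> nnsum (sqmat B) = nnsum (fun t => nrm (B (chi t)) ^+ 2).
  move=> /(sqmat_swap B).1 sB; rewrite -(sqmat_swap B).2.
  have [_ _ ->] := nnsum_pair (fun p => sqmat_ge0 B (p.2, p.1)) sB.
  by congr nnsum; apply/funext => t; rewrite nrm_col.
rewrite !E//; move/hs_cols: sF => sF.
rewrite -nnsumZ//; [|by move=> t; exact: sqr_ge0|exact: sqr_ge0].
apply: nnsum_le => [t|t|]; first exact: sqr_ge0.
  have AMt := AM (F (chi t)); have nAF := nrm_ge0 L (A (F (chi t))).
  by rewrite -exprMn ler_sqr ?nnegrE// (le_trans nAF).
by apply: nnsummableZ => //; [move=> t|]; exact: sqr_ge0.
Qed.

(** The rows of F A are the images of the rows of F under A^*. *)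
Lemma hs_nrm_compr (M : R) A F : bounded A -> (forall f, nrm (adj A f) <= M * nrm f) -> hs F ->
  nnsum (sqmat (F \o A)) <= M ^+ 2 * nnsum (sqmat F).
Proof.
move=> bA AM hF; have [bFA sFA] := hs_compr bA hF; have [bF sF] := hF.
have E B : bounded B -> nnsummable (sqmat B) ->
    nnsum (sqmat B) = nnsum (fun s => nrm (adj B (chi s)) ^+ 2).
  move=> bB sB; have [_ _ ->] := nnsum_pair (sqmat_ge0 B) sB.
  by congr nnsum; apply/funext => t; rewrite (nrm_row _ bB).
rewrite (E _ bFA sFA) (E _ bF sF); move/(hs_rows bF): sF => sF.
rewrite -nnsumZ//; [|by move=> t; exact: sqr_ge0|exact: sqr_ge0].
apply: nnsum_le => [t|t|]; first exact: sqr_ge0.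
  rewrite (adj_comp bF bA) -[(adj A \o adj F) (chi t)]/(adj A (adj F (chi t))).
  have AMt := AM (adj F (chi t)); have nAF := nrm_ge0 L (adj A (adj F (chi t))).
  by rewrite -exprMn ler_sqr ?nnegrE// (le_trans nAF).
by apply: nnsummableZ => //; [move=> t|]; exact: sqr_ge0.
Qed.

(** The value of F f at s is the inner product of f with the conjugate of the row of s,
    so that Cauchy-Schwarz on each row bounds F. *)
Lemma op_of_mat (a : l2 R (T * T)%type) : exists F, hs F /\ mat F = a.
Proof.
have [s1 s2 _] := nnsum_pair (fun=> sqr_ge0 _) (l2_summable a).
pose r s : l2 R T := to_l2 (fun t => (a (s, t))^*).
have rE s t : r s t = (a (s, t))^*.
  rewrite /r to_l2E//; have := s1 s.
  by congr nnsummable; apply/funext => u; rewrite normc_conj.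
have rn s : nrm (r s) ^+ 2 = nnsum (fun t => normc (a (s, t)) ^+ 2).
  rewrite sqr_l2_nrm; congr nnsum; apply/funext => t; by rewrite rE normc_conj.
have b1 f s : normc (ip f (r s)) ^+ 2 <= nrm f ^+ 2 * nrm (r s) ^+ 2.
  by rewrite -exprMn ler_sqr ?nnegrE ?mulr_ge0 ?nrm_ge0 ?normc_ge0// (normc_ip (l2_ip R T)).
have sr : nnsummable (fun s => nrm (r s) ^+ 2).
  by move: s2; congr nnsummable; apply/funext => s; rewrite rn.
have srf f : nnsummable (fun s => nrm f ^+ 2 * nrm (r s) ^+ 2).
  by apply: nnsummableZ => // *; exact: sqr_ge0.
pose F : op := fun f => to_l2 (fun s => ip f (r s)).
have FE f s : F f s = ip f (r s).
  by rewrite /F to_l2E//; exact: nnsummable_le (b1 f) (srf f).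
have bF : bounded F.
  apply: (@bounded_of _ (Num.sqrt (nnsum (fun s => nrm (r s) ^+ 2)))) => [c f g|f].
    by apply: l2P => s; rewrite l2DE l2ZE !FE (ips_lin (l2_ip R T)).
  have N0 : 0 <= nnsum (fun s => nrm (r s) ^+ 2) by apply: nnsum_ge0 => s; exact: sqr_ge0.
  rewrite -ler_sqr ?nnegrE ?mulr_ge0 ?sqrtr_ge0 ?nrm_ge0// exprMn (sqr_sqrtr N0).
  rewrite [leRHS]mulrC -nnsumZ//; [|by move=> s; exact: sqr_ge0|exact: sqr_ge0].
  rewrite sqr_l2_nrm; apply: nnsum_le (srf f) => s; first exact: sqr_ge0.
  by rewrite FE b1.
have Fa p : F (chi p.2) p.1 = a p.
  case: p => s t /=; rewrite FE (ips_conj (l2_ip R T) (x := r s))// ip_chi rE conjCK //.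
have hF : hs F.
  split => //; have := l2_summable a.
  by congr nnsummable; apply/funext => p; rewrite /sqmat Fa.
by exists F; split => //; apply: l2P => p; rewrite matE.
Qed.

Lemma mat_lin (a : C) F G : hs F -> hs G ->
  hs (a *: F + G) /\ mat (a *: F + G) = a *: mat F + mat G.
Proof.
move=> hF hG; have [bF _] := hF; have [bG _] := hG.
have E p : (a *: F + G) (chi p.2) p.1 = (a *: mat F + mat G) p.
  by rewrite -[RHS]/(a * mat F p + mat G p) (matE p hF) (matE p hG).
have h : hs (a *: F + G).
  split; first exact: bounded_lin.
  have := l2_summable (a *: mat F + mat G).
  by congr nnsummable; apply/funext => p; rewrite -E.
by split => //; apply: l2P => p; rewrite matE// E.
Qed.

End Operators.

(** * Causality, constants and block diagonals *)

Section Causal.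
Variables (R : realType) (T : choiceType) (q : nat).
Variables (xi : set (nat -> T)) (alpha : 'I_q -> T -> T) (lev : T -> int) (par : T -> T).
Hypothesis lv : leveled xi alpha lev par.

Local Notation C := R[i].
Local Notation normc := (Normc.normc).
Local Notation "x %:C" := (real_complex R x).
Local Notation L := (L2space R T).
Local Notation op := (l2 R T -> l2 R T).
Local Notation chi := (chi R).
Local Notation ip := (hip L).
Local Notation nrm := (hnorm L).
Local Notation bounded := (@bounded_operator R T).
Local Notation al := (@shift_op R T q alpha).
Implicit Types (A B F G S c d : op) (f g : l2 R T) (s t : T) (w v : seq 'I_q).

Lemma act_inj w : injective (fun t => act alpha t w).
Proof.
elim: w => [|j w IH] s t //= /IH E.
by rewrite -(par_alpha lv j s) E (par_alpha lv).
Qed.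

Lemma lev_act w t : lev (act alpha t w) = lev t + (size w)%:Z.
Proof.
elim: w t => [|j w IH] t /=; first by rewrite addr0.
rewrite -/(act alpha (alpha j t) w) IH (lev_alpha lv); lia.
Qed.

Lemma act_cat t v w : act alpha t (v ++ w) = act alpha (act alpha t v) w.
Proof. exact: foldl_cat. Qed.

Lemma word_opE w f t : word_op alpha w f t = f (act alpha t w).
Proof.
rewrite /word_op to_l2E//.
exact: (nnsum_inj (@act_inj w) (fun=> sqr_ge0 _) (l2_summable f)).1.
Qed.

Lemma word_op_bounded w : bounded (word_op alpha w).
Proof.
apply: (@bounded_of _ _ _ 1) => [a f g|f].
  by apply: l2P => t; rewrite l2DE l2ZE !word_opE.
rewrite mul1r -ler_sqr ?nnegrE ?nrm_ge0// !sqr_l2_nrm.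
have [_] := nnsum_inj (@act_inj w) (fun=> sqr_ge0 _) (l2_summable f).
apply: le_trans; rewrite le_eqVlt; apply/orP; left; apply/eqP.
by congr nnsum; apply/funext => t; rewrite word_opE.
Qed.

Lemma adj_word_chi w t : adj (word_op alpha w) (chi t) = chi (act alpha t w).
Proof.
apply: l2P => s; rewrite (adj_entry (word_op_bounded w)) word_opE !chiE eq_sym.
by case: eqP => _; rewrite ?conjC1 ?conjC0.
Qed.

Lemma adj_word_bounded w : bounded (adj (word_op alpha w)).
Proof. exact/bounded_adj/word_op_bounded. Qed.

Lemma word_op_chi w t : word_op alpha w (chi (act alpha t w)) = chi t.
Proof.
apply: l2P => s; rewrite word_opE !chiE; congr (_%:R).
by congr nat_of_bool; apply/eqP/eqP => [/act_inj|->].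
Qed.

(** The action of w on nodes is injective, so w is a coisometry. *)
Lemma word_opK w : word_op alpha w \o adj (word_op alpha w) = id :> op.
Proof.
apply: op_ext; [|exact: bounded_id|].
  apply: bounded_comp; [exact: word_op_bounded|exact: adj_word_bounded].
by move=> s t /=; rewrite adj_word_chi word_op_chi.
Qed.

Lemma shift_bounded j : bounded (al j). Proof. exact: word_op_bounded. Qed.

Lemma adj_shift_bounded j : bounded (adj (al j)). Proof. exact: adj_word_bounded. Qed.

Lemma shiftK j : al j \o adj (al j) = id :> op. Proof. exact: word_opK. Qed.

Lemma adj_shift_chi j t : adj (al j) (chi t) = chi (alpha j t).
Proof. exact: adj_word_chi. Qed.

Lemma shift_chi j t : al j (chi t) = if alpha j (par t) == t then chi (par t) else 0.
Proof.
case: eqP => [E|ne]; first by rewrite -[in LHS]E; exact: (@word_op_chi [:: j]).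
apply: l2P => s; rewrite /shift_op word_opE /= chiE; case: eqP => // E.
by case: ne; rewrite -E (par_alpha lv).
Qed.

Lemma lev_par t : lev (par t) = lev t - 1.
Proof. by have [j E] := alpha_par lv t; rewrite -[in RHS]E (lev_alpha lv) addrK. Qed.

(** Lower triangular, strictly lower triangular and block diagonal matrices with
    respect to the levels. *)
Definition lower A : Prop := forall s t, lev s < lev t -> A (chi t) s = 0.
Definition slower A : Prop := forall s t, lev s <= lev t -> A (chi t) s = 0.
Definition bdiag A : Prop := forall s t, lev s != lev t -> A (chi t) s = 0.

Lemma lower_support A f (n : int) : bounded A -> lower A ->
  (forall u, lev u <= n -> f u = 0) -> forall s, lev s <= n -> A f s = 0.
Proof.
move=> bA lA f0 s sn; rewrite (op_csum bA) -[RHS](@csum0 R T); congr csum.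
apply/funext => u; have [un|nu] := leP (lev u) n; first by rewrite f0 ?mul0r.
by rewrite lA ?mulr0//; exact: le_lt_trans nu.
Qed.

Lemma lower_comp A B : bounded A -> lower A -> lower B -> lower (A \o B).
Proof.
move=> bA lA lB s t st; apply: (@lower_support A _ (lev t - 1)) => //; last by lia.
by move=> u ut; apply: lB; lia.
Qed.

Lemma slower_compl A B : bounded A -> lower A -> slower B -> slower (A \o B).
Proof.
by move=> bA lA lB s t st; apply: (@lower_support A _ (lev t)) => // u; exact: lB.
Qed.

Lemma bdiag_lower A : bdiag A -> lower A.
Proof. by move=> dA s t st; apply: dA; rewrite lt_eqF. Qed.

Lemma slower_lower A : slower A -> lower A.
Proof. by move=> lA s t st; apply/lA/ltW. Qed.

Lemma comp_entry0 A B s t : bounded A -> (forall u, B (chi t) u * A (chi u) s = 0) ->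
  (A \o B) (chi t) s = 0.
Proof.
move=> bA AB0; rewrite /= (op_csum bA) -[RHS](@csum0 R T); congr csum; exact/funext.
Qed.

Lemma bdiag_comp A B : bounded A -> bdiag A -> bdiag B -> bdiag (A \o B).
Proof.
move=> bA lA dB s t st; apply: comp_entry0 => // u.
have [E|ne] := eqVneq (lev u) (lev t); last by rewrite dB// mul0r.
by rewrite lA ?mulr0// E.
Qed.

Lemma bdiag_adj A : bounded A -> bdiag A -> bdiag (adj A).
Proof. by move=> bA dA s t st; rewrite adj_entry// dA ?conjC0// eq_sym. Qed.

Lemma lower_lin (a : C) A B : lower A -> lower B -> lower (a *: A + B).
Proof.
move=> lA lB s t st; have -> : (a *: A + B) (chi t) s = a * A (chi t) s + B (chi t) s by [].
by rewrite lA// lB// mulr0 addr0.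
Qed.

Lemma bdiag_lin (a : C) A B : bdiag A -> bdiag B -> bdiag (a *: A + B).
Proof.
move=> lA lB s t st; have -> : (a *: A + B) (chi t) s = a * A (chi t) s + B (chi t) s by [].
by rewrite lA// lB// mulr0 addr0.
Qed.

(** Causality on the basis vectors is triangularity; conversely the expansion of A f at s
    only involves levels up to that of s. *)
Lemma causal_operatorP A : causal_operator xi A <-> bounded A /\ lower A.
Proof.
split=> [[bA cA]|[bA lA]]; split => //.
  move=> s t st; apply: (cA s) => [u|]; last by rewrite (preceq_lev lv).
  rewrite (preceq_lev lv) chiE => us; case: eqP => // ut.
  by move: us st; rewrite ut => /le_lt_trans h /h; rewrite ltxx.
move=> s f f0 t; rewrite (preceq_lev lv); apply: lower_support => // u us.
by apply: f0; rewrite (preceq_lev lv).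
Qed.

Lemma constant_operatorP A : constant_operator xi A <-> bounded A /\ bdiag A.
Proof.
split=> [[/causal_operatorP[bA lA] /causal_operatorP[bA' lA']]|[bA dA]].
  split => // s t; rewrite neq_lt => /orP[]; first exact: lA.
  move=> ts; have := lA' t s ts; rewrite adj_entry// => /eqP.
  by rewrite conjC_eq0 => /eqP.
split; apply/causal_operatorP; split => //; first exact: bdiag_lower.
  exact: bounded_adj.
exact/bdiag_lower/bdiag_adj.
Qed.

Definition level_cut f (n : int) : l2 R T := to_l2 (fun t => if lev t == n then f t else 0).

Lemma level_cutE f n t : level_cut f n t = if lev t == n then f t else 0.
Proof.
rewrite /level_cut to_l2E//; apply: nnsummable_le (l2_summable f) => u.
by case: ifP => // _; rewrite Normc.normc0 expr0n sqr_ge0.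
Qed.

Definition block_diag A : op := fun f => to_l2 (fun s => A (level_cut f (lev s)) s).

(** Restricting to the blocks does not increase the norm: the images of the cuts of
    f are compared with the cuts, level by level. *)
Lemma block_diag_summable A (M : R) f : bounded A -> 0 <= M ->
  (forall f, nrm (A f) <= M * nrm f) ->
  nnsummable (fun s => normc (A (level_cut f (lev s)) s) ^+ 2) /\
  nnsum (fun s => normc (A (level_cut f (lev s)) s) ^+ 2) <= (M * nrm f) ^+ 2.
Proof.
move=> bA M0 AM.
pose cut (p : T * int) := normc (level_cut f p.2 p.1) ^+ 2.
have cut0 p : 0 <= cut p by exact: sqr_ge0.
have row s : nnsummable (fun n => cut (s, n)) /\ nnsum (fun n => cut (s, n)) = normc (f s) ^+ 2.
  have := @nnsum_single R _ (fun n => cut (s, n)) (lev s) (cut0 _).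
  have -> : cut (s, lev s) = normc (f s) ^+ 2 by rewrite /cut level_cutE eqxx.
  apply => n ns.
  by rewrite /cut level_cutE /= eq_sym (negPf ns) Normc.normc0 expr0n.
have rowE : (fun s => nnsum (fun n => cut (s, n))) = (fun s => normc (f s) ^+ 2).
  by apply/funext => s; case: (row s).
have scut : nnsummable cut.
  apply: nnsummable_pair => //; first by move=> s; case: (row s).
  by rewrite rowE; exact: l2_summable f.
have ncut : nnsum cut = nrm f ^+ 2.
  by have [_ _ ->] := nnsum_pair cut0 scut; rewrite rowE sqr_l2_nrm.
pose cut' (p : int * T) := cut (p.2, p.1).
have scut' : nnsummable cut' by move: scut; rewrite /nnsummable -esum_swap.
have ncut' : nnsum cut' = nrm f ^+ 2 by rewrite -ncut /nnsum -[in RHS]esum_swap.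
have [_ s2 E2] := nnsum_pair (fun p : int * T => cut0 (p.2, p.1)) scut'.
have colE : (fun n => nnsum (fun s => cut' (n, s))) = (fun n => nrm (level_cut f n) ^+ 2).
  by apply/funext => n; rewrite sqr_l2_nrm.
rewrite -/cut' in E2; rewrite E2 colE in ncut'; rewrite colE in s2.
pose img (p : int * T) := normc (A (level_cut f p.1) p.2) ^+ 2.
have img0 p : 0 <= img p by exact: sqr_ge0.
have imgE : (fun n => nnsum (fun s => img (n, s))) = (fun n => nrm (A (level_cut f n)) ^+ 2).
  by apply/funext => n; rewrite sqr_l2_nrm.
have imgle n : nrm (A (level_cut f n)) ^+ 2 <= M ^+ 2 * nrm (level_cut f n) ^+ 2.
  by rewrite -exprMn ler_sqr ?nnegrE ?mulr_ge0 ?nrm_ge0.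
have sM : nnsummable (fun n => M ^+ 2 * nrm (level_cut f n) ^+ 2).
  by apply: nnsummableZ => // *; exact: sqr_ge0.
have simg : nnsummable img.
  apply: nnsummable_pair => //; first by move=> n; exact: (l2_summable (A (level_cut f n))).
  by rewrite imgE; exact: nnsummable_le sM.
have nimg : nnsum img <= (M * nrm f) ^+ 2.
  have [_ _ ->] := nnsum_pair img0 simg; rewrite imgE exprMn -ncut' -nnsumZ//.
  - by apply: nnsum_le => // n; exact: sqr_ge0.
  - by move=> n; exact: sqr_ge0.
  - exact: sqr_ge0.
have einj : injective (fun s => (lev s, s)) by move=> s t [].
have [s3 n3] := nnsum_inj einj img0 simg.
by split; [exact: s3|exact: le_trans n3 nimg].
Qed.

Lemma block_diagE A f s : bounded A -> block_diag A f s = A (level_cut f (lev s)) s.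
Proof.
move=> bA; have [M M0 AM] := op_bound bA.
by rewrite /block_diag to_l2E//; case: (block_diag_summable f bA M0 AM).
Qed.

Lemma block_diag_bounded A : bounded A -> bounded (block_diag A).
Proof.
move=> bA; have [M M0 AM] := op_bound bA; apply: (@bounded_of _ _ _ M) => [a f g|f].
  apply: l2P => s; rewrite l2DE l2ZE !block_diagE//.
  have -> : level_cut (a *: f + g) (lev s) = a *: level_cut f (lev s) + level_cut g (lev s).
    apply: l2P => t; rewrite l2DE l2ZE !level_cutE l2DE l2ZE.
    by case: ifP => // _; rewrite mulr0 addr0.
  by rewrite (opD bA) (opZ bA).
rewrite -ler_sqr ?nnegrE ?mulr_ge0 ?nrm_ge0//.
have [_] := block_diag_summable f bA M0 AM; rewrite sqr_l2_nrm.
apply: le_trans; rewrite le_eqVlt; apply/orP; left; apply/eqP.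
by congr nnsum; apply/funext => s; rewrite block_diagE.
Qed.

Lemma level_cut_id f n : (forall t, lev t != n -> f t = 0) -> level_cut f n = f.
Proof. by move=> f0; apply: l2P => t; rewrite level_cutE; case: eqVneq => // /f0. Qed.

Lemma level_cut_0 f m n : m != n -> (forall t, lev t != n -> f t = 0) -> level_cut f m = 0.
Proof.
move=> mn f0; apply: l2P => t; rewrite level_cutE; case: eqVneq => // E.
by rewrite f0// E.
Qed.

Lemma block_diag_level A f n s : bounded A -> (forall t, lev t != n -> f t = 0) ->
  block_diag A f s = if lev s == n then A f s else 0.
Proof.
move=> bA f0; rewrite block_diagE//; case: eqVneq => [->|ne]; first by rewrite level_cut_id.
by rewrite (level_cut_0 ne f0) (op0 bA).
Qed.

Lemma chi_level t u : lev u != lev t -> chi t u = 0 :> C.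
Proof. by rewrite chiE; case: (eqVneq u t) => // ->; rewrite eqxx. Qed.

Lemma block_diag_entry A s t : bounded A ->
  block_diag A (chi t) s = if lev s == lev t then A (chi t) s else 0.
Proof. by move=> bA; apply: block_diag_level => // u; exact: chi_level. Qed.

Lemma block_diag_bdiag A : bounded A -> bdiag (block_diag A).
Proof. by move=> bA s t st; rewrite block_diag_entry// (negPf st). Qed.

Lemma block_diag_const A : bounded A -> constant_operator xi (block_diag A).
Proof.
by move=> bA; apply/constant_operatorP; split; [exact: block_diag_bounded|exact: block_diag_bdiag].
Qed.

(** The coefficient S_[w] is the block diagonal of w S: moving a row from s to sw shifts
    the blocks |w| levels below the diagonal onto the diagonal. *)
Lemma coef_block_diag A w : bounded A -> coef xi alpha A w = block_diag (word_op alpha w \o A).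
Proof.
move=> bA; have bwA := bounded_comp (word_op_bounded w) bA.
have entry s t : block_diag (word_op alpha w \o A) (chi t) s =
    if asymp xi t s then A (chi t) (act alpha s w) else 0.
  by rewrite block_diag_entry// (asymp_lev lv) eq_sym /= word_opE.
rewrite /coef; case: xgetP => [B _ [/constant_operatorP[bB dB] BE]|].
  by apply: (op_ext bB (block_diag_bounded bwA)) => s t; rewrite BE entry.
move=> /(_ (block_diag (word_op alpha w \o A)))[].
by split; [exact: block_diag_const|exact: entry].
Qed.

Lemma eval0E A : bounded A -> eval0 xi alpha A = block_diag A.
Proof.
move=> bA; rewrite /eval0 coef_block_diag//; congr block_diag.
by apply/funext => f; apply: l2P => t; rewrite /= word_opE.
Qed.

Lemma block_diag_lin (a : C) A B : bounded A -> bounded B ->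
  block_diag (a *: A + B) = a *: block_diag A + block_diag B.
Proof.
move=> bA bB; have bAB := bounded_lin a bA bB.
apply/funext => f; apply: l2P => s.
have -> : (a *: block_diag A + block_diag B) f s = a * block_diag A f s + block_diag B f s by [].
by rewrite !block_diagE.
Qed.

Lemma block_diagD A B : bounded A -> bounded B ->
  block_diag (A + B) = block_diag A + block_diag B.
Proof. by move=> bA bB; rewrite -[A]scale1r block_diag_lin// !scale1r. Qed.

Lemma block_diag_id A : bounded A -> bdiag A -> block_diag A = A.
Proof.
move=> bA dA; apply: op_ext => //; first exact: block_diag_bounded.
by move=> s t; rewrite block_diag_entry//; case: eqVneq => // /dA.
Qed.

Lemma block_diag_0 A : bounded A -> slower A -> block_diag A = 0.
Proof.
move=> bA lA; apply: op_ext; [exact: block_diag_bounded|exact: bounded0|].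
by move=> s t; rewrite block_diag_entry//; case: eqP => // E; rewrite lA// E.
Qed.

Lemma block_diag_comp A c : bounded A -> bounded c -> bdiag c ->
  block_diag (A \o c) = block_diag A \o c.
Proof.
move=> bA bc dc; have bAc := bounded_comp bA bc; have bB := block_diag_bounded bA.
apply: op_ext; [exact: block_diag_bounded|exact: bounded_comp|].
move=> s t; rewrite block_diag_entry//= (@block_diag_level A _ (lev t))//.
by move=> u; exact: dc.
Qed.

Lemma slower_sub_block_diag A : bounded A -> lower A -> slower (A - block_diag A).
Proof.
move=> bA lA s t st.
have -> : (A - block_diag A) (chi t) s = A (chi t) s - block_diag A (chi t) s by [].
rewrite block_diag_entry//; case: eqVneq => [_|ne]; first by rewrite subrr.
by rewrite subr0 lA// lt_neqAle ne.
Qed.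

Lemma slower_adj_shift F j : lower F -> slower (F \o adj (al j)).
Proof.
move=> lF s t st; rewrite /= adj_shift_chi; apply: lF; rewrite (lev_alpha lv); lia.
Qed.

Lemma lower_shift F j : bounded F -> slower F -> lower (F \o al j).
Proof.
move=> bF lF s t st; rewrite /= shift_chi; case: ifP => _; last by rewrite (op0 bF).
by apply: lF; rewrite lev_par; lia.
Qed.

End Causal.

(** * The Hilbert space of causal Hilbert-Schmidt operators *)

Section HardySpace.
Variables (R : realType) (T : choiceType) (q : nat).
Variables (xi : set (nat -> T)) (alpha : 'I_q -> T -> T) (lev : T -> int) (par : T -> T).
Hypothesis lv : leveled xi alpha lev par.

Local Notation C := R[i].
Local Notation normc := (Normc.normc).
Local Notation "x %:C" := (real_complex R x).
Local Notation L := (L2space R T).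
Local Notation op := (l2 R T -> l2 R T).
Local Notation chi := (chi R).
Local Notation bounded := (@bounded_operator R T).
Local Notation al := (@shift_op R T q alpha).
Local Notation H2 := (H2 R xi).
Local Notation C2 := (C2 R xi).
Local Notation "⟪ F , G ⟫" := (hip H2 F G) (at level 0, F at level 99, G at level 99).
Local Notation nH := (hnorm H2).
Implicit Types (A F G S c d : op).

Local Notation LL := (L2space R (T * T)%type).

Lemma H2P F : hdom H2 F <-> hs F /\ lower lev F.
Proof.
split=> [[/(causal_operatorP lv)[bF lF] /(hs_trace_class bF) sF]|[[bF sF] lF]] //.
by split; [exact/(causal_operatorP lv)|exact/(hs_trace_class bF)].
Qed.

Lemma H2_hs F : hdom H2 F -> hs F. Proof. by case/H2P. Qed.
Lemma H2_lower F : hdom H2 F -> lower lev F. Proof. by case/H2P. Qed.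
Lemma H2_bounded F : hdom H2 F -> bounded F. Proof. by case/H2P => -[]. Qed.

Lemma H2_ipE F G : hdom H2 F -> hdom H2 G -> ⟪F, G⟫ = hip LL (mat F) (mat G).
Proof. by move=> /H2_hs hF /H2_hs hG; exact: hs_ipE. Qed.

(** Vanishing of a matrix entry is a closed condition. *)
Lemma mat_coord0 (u : nat -> op) (w : l2 R (T * T)%type) p :
  (forall n, hs (u n)) -> hcvg LL (@mat R T \o u) w ->
  (forall n, u n (chi p.2) p.1 = 0) -> w p = 0.
Proof.
move=> hu [a a0 ua] u0; apply/Normc.eq0_normc/le_anti; rewrite normc_ge0 andbT.
apply: (le0_cvg0 a0) => n; apply: le_trans (ua n).
have := l2_coord_le ((@mat R T \o u) n - w) p.
by rewrite l2BE [(_ \o _) n]/= (matE p (hu n)) u0 sub0r normcN.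
Qed.

Lemma H2_hilbert : inner_product_space H2 /\ hcomplete H2.
Proof.
have lin (a : C) F G : hdom H2 F -> hdom H2 G -> hdom H2 (a *: F + G).
  move=> /H2P[hF lF] /H2P[hG lG]; apply/H2P; split; last exact: lower_lin.
  by case: (mat_lin a hF hG).
apply: (hilbert_transfer (l2_ip R _) (@l2_complete R _) (Phi := @mat R T)) => //.
- apply/H2P; split; last by move=> s t _.
  have [F [hF _]] := op_of_mat (0 : l2 R (T * T)%type).
  by have := (mat_lin (-1) hF hF).1; rewrite scaleN1r addNr.
- by move=> a F G /H2_hs hF /H2_hs hG; case: (mat_lin a hF hG).
- exact: H2_ipE.
- move=> F dF mF; have hF := H2_hs dF; have bF := H2_bounded dF.
  apply: (op_ext bF (bounded0 R T)) => s t.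
  by rewrite -(matE (s, t) hF) mF.
- move=> u w du _ uw; have [F [hF Fw]] := op_of_mat w; exists F; split => //.
  apply/H2P; split => // s t st; rewrite -(matE (s, t) hF) Fw.
  apply: (mat_coord0 (fun n => H2_hs (du n)) uw) => n; exact: (H2_lower (du n)).
Qed.

Lemma H2_ip : inner_product_space H2. Proof. by case: H2_hilbert. Qed.
Lemma H2_complete : hcomplete H2. Proof. by case: H2_hilbert. Qed.

Lemma sqr_H2_nrm F : hdom H2 F -> nH F ^+ 2 = nnsum (sqmat F).
Proof.
move=> dF; rewrite (sqr_nrm H2_ip)// H2_ipE// -(sqr_nrm (l2_ip R _))// sqr_l2_nrm.
by congr nnsum; apply/funext => p; rewrite (matE p (H2_hs dF)).
Qed.

Lemma C2P d : hdom C2 d <-> hdom H2 d /\ bdiag lev d.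
Proof.
split=> [[/(constant_operatorP lv)[_ dd]]|[dH dd]] //.
by split => //; apply/(constant_operatorP lv); split => //; exact: H2_bounded.
Qed.

(** Block diagonal matrices are closed among the square-summable ones. *)
Lemma C2_hilbert : inner_product_space C2 /\ hcomplete C2.
Proof.
apply: (hilbert_transfer H2_ip H2_complete (Phi := id)).
- by apply/C2P; split; [exact: (dom0 H2_ip)|move=> s t _].
- move=> a F G /C2P[dF bF] /C2P[dG bG]; apply/C2P; split; last exact: bdiag_lin.
  exact: (ips_dom H2_ip).
- by move=> F /C2P[].
- by [].
- by [].
- by [].
- move=> u w du dw [a a0 uw]; exists w; split => //; apply/C2P; split => // s t st.
  have dn n : hdom H2 (u n) by case/C2P: (du n).
  rewrite -(matE (s, t) (H2_hs dw)).
  apply: (mat_coord0 (fun n => H2_hs (dn n))) => [|n]; last by case/C2P: (du n) => _; exact.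
  exists a => // n; apply: le_trans (uw n).
  have -> : (@mat R T \o u) n - mat w = mat (u n - w).
    have := (mat_lin (-1) (H2_hs dw) (H2_hs (dn n))).2.
    by rewrite !scaleN1r => E; rewrite addrC -E addrC.
  have dnw : hdom H2 (u n - w) by exact: (domB H2_ip).
  by rewrite /hnorm -(H2_ipE dnw dnw).
Qed.

(** ** Multiplications *)

Lemma H2_compl S F : bounded S -> lower lev S -> hdom H2 F -> hdom H2 (S \o F).
Proof.
move=> bS lS /H2P[hF lF]; apply/H2P; split; first exact: hs_compl.
exact: lower_comp.
Qed.

Lemma H2_const c F : bounded c -> bdiag lev c -> hdom H2 F -> hdom H2 (F \o c).
Proof.
move=> bc dc /H2P[hF lF]; apply/H2P; split; first exact: hs_compr.
by case: hF => bF _; apply: lower_comp => //; exact: bdiag_lower.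
Qed.

Lemma H2_adj_shift j F : hdom H2 F -> hdom H2 (F \o adj (al j)).
Proof.
move=> /H2P[hF lF]; apply/H2P; split.
  exact: (hs_compr (adj_shift_bounded R lv j)).
exact/slower_lower/(slower_adj_shift lv).
Qed.

Lemma H2_shift j F : hdom H2 F -> slower lev F -> hdom H2 (F \o al j).
Proof.
move=> /H2P[hF _] sF; apply/H2P; split.
  exact: (hs_compr (shift_bounded R lv j)).
by case: hF => bF _; exact: (lower_shift lv).
Qed.

Lemma H2_ip_compr A F G : bounded A -> hdom H2 F -> hdom H2 G ->
  ⟪F \o A, G⟫ = ⟪F, G \o adj A⟫.
Proof. by move=> bA /H2_hs hF /H2_hs hG; exact: hs_ip_compr. Qed.

Lemma H2_ip_adj_shift j F G : hdom H2 F -> hdom H2 G ->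
  ⟪F \o adj (al j), G⟫ = ⟪F, G \o al j⟫.
Proof.
move=> dF dG; rewrite (H2_ip_compr (adj_shift_bounded R lv j) dF dG).
by rewrite (adjK (shift_bounded R lv j)).
Qed.

Lemma H2_nrm_compl (M : R) S F : bounded S -> lower lev S -> 0 <= M ->
  (forall f, hnorm L (S f) <= M * hnorm L f) -> hdom H2 F -> nH (S \o F) <= M * nH F.
Proof.
move=> bS lS M0 SM dF; have dSF := H2_compl bS lS dF.
have := hs_nrm_compl bS SM (H2_hs dF); rewrite -(sqr_H2_nrm dF) -(sqr_H2_nrm dSF).
by rewrite -exprMn ler_sqr ?nnegrE ?mulr_ge0 ?nrm_ge0.
Qed.

Lemma H2_const_bounded c : bounded c -> bdiag lev c -> bounded_op H2 (fun F => F \o c).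
Proof.
move=> bc dc; split; [by move=> F; exact: H2_const|by []|].
have [M M0 cM] := op_bound (bounded_adj bc); exists M => F dF.
have dFc := H2_const bc dc dF.
have := hs_nrm_compr bc cM (H2_hs dF); rewrite -(sqr_H2_nrm dF) -(sqr_H2_nrm dFc).
by rewrite -exprMn ler_sqr ?nnegrE ?mulr_ge0 ?nrm_ge0.
Qed.

Lemma H2_block_diag F : hdom H2 F -> hdom C2 (block_diag lev F).
Proof.
move=> /H2P[[bF sF] lF]; apply/C2P; have dd := block_diag_bdiag (lev := lev) bF.
split => //; apply/H2P; split; last exact: bdiag_lower.
split; first exact: block_diag_bounded.
apply: nnsummable_le sF => -[s t]; rewrite /sqmat (block_diag_entry lev s t bF)/=.
by case: ifP => // _; rewrite Normc.normc0 expr0n sqr_ge0.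
Qed.

Lemma H2_ip0 F G : hdom H2 F -> hdom H2 G ->
  (forall s t, F (chi t) s * (G (chi t) s)^* = 0) -> ⟪F, G⟫ = 0.
Proof.
move=> dF dG FG; rewrite H2_ipE//= -[RHS](@csum0 R (T * T)%type).
by apply: eq_csum => -[s t]; rewrite (matE _ (H2_hs dF)) (matE _ (H2_hs dG)) FG.
Qed.

Lemma H2_slower_bdiag F d : hdom H2 F -> slower lev F -> hdom H2 d -> bdiag lev d ->
  ⟪F, d⟫ = 0.
Proof.
move=> dF sF dd bd; apply: H2_ip0 => // s t.
have [E|ne] := eqVneq (lev s) (lev t); first by rewrite sF ?mul0r// E.
by rewrite (bd s t)// conjC0 mulr0.
Qed.

Lemma H2_bdiag_slower F d : hdom H2 F -> slower lev F -> hdom H2 d -> bdiag lev d ->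
  ⟪d, F⟫ = 0.
Proof.
by move=> dF sF dd bd; rewrite (ips_conj H2_ip (x := F))// H2_slower_bdiag// conjC0.
Qed.

Definition strict_part F := F - block_diag lev F.

Lemma strict_part_def F : strict_part F = F - block_diag lev F. Proof. by []. Qed.

Lemma H2_strict F : hdom H2 F -> hdom H2 (strict_part F) /\ slower lev (strict_part F).
Proof.
move=> dF; have [dd _] := (C2P _).1 (H2_block_diag dF).
split; first exact: (domB H2_ip).
apply: slower_sub_block_diag; [exact: H2_bounded|exact: H2_lower].
Qed.

Lemma strict_partE F : F = strict_part F + block_diag lev F.
Proof. by rewrite /strict_part subrK. Qed.

Lemma H2_ip_block_diag F d : hdom H2 F -> hdom C2 d -> ⟪F, d⟫ = ⟪block_diag lev F, d⟫.
Proof.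
move=> dF /C2P[dd bd]; have [dS sS] := H2_strict dF.
have [dB _] := (C2P _).1 (H2_block_diag dF).
by rewrite {1}[F]strict_partE (ipDl H2_ip)// (H2_slower_bdiag dS sS dd bd) add0r.
Qed.

Lemma H2_ip_strict F G : hdom H2 F -> hdom H2 G -> slower lev G ->
  ⟪F, G⟫ = ⟪strict_part F, G⟫.
Proof.
move=> dF dG sG; have [dS sS] := H2_strict dF.
have [dB bB] := (C2P _).1 (H2_block_diag dF).
by rewrite {1}[F]strict_partE (ipDl H2_ip)// (H2_bdiag_slower dG sG dB bB) addr0.
Qed.

Lemma sqr_H2_nrm_strict F : hdom H2 F ->
  nH F ^+ 2 = nH (strict_part F) ^+ 2 + nH (block_diag lev F) ^+ 2.
Proof.
move=> dF; have [dS sS] := H2_strict dF; have [dB bB] := (C2P _).1 (H2_block_diag dF).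
have E := sqr_nrmD H2_ip dS dB; rewrite (H2_slower_bdiag dS sS dB bB) mulr0 addr0 in E.
by rewrite -E -strict_partE.
Qed.

End HardySpace.

(** * The de Branges-Rovnyak space *)

Section DeBrangesRovnyak.
Variables (R : realType) (T : choiceType) (q : nat).
Variables (xi : set (nat -> T)) (alpha : 'I_q -> T -> T) (lev : T -> int) (par : T -> T).
Hypothesis lv : leveled xi alpha lev par.
Variable S : l2 R T -> l2 R T.
Hypothesis schurS : schur_multiplier xi S.

Local Notation C := R[i].
Local Notation normc := (Normc.normc).
Local Notation "x %:C" := (real_complex R x).
Local Notation L := (L2space R T).
Local Notation op := (l2 R T -> l2 R T).
Local Notation chi := (chi R).
Local Notation bounded := (@bounded_operator R T).
Local Notation al := (@shift_op R T q alpha).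
Local Notation H2 := (H2 R xi).
Local Notation C2 := (C2 R xi).
Local Notation HS := (dBR xi S).
Local Notation "⟪ F , G ⟫" := (hip H2 F G) (at level 0, F at level 99, G at level 99).
Local Notation nH := (hnorm H2).
Implicit Types (A F G c d : op).

Local Notation M := (@mulop R T S).
Local Notation M' := (adjoint H2 M).
Local Notation P := (sqrt_defect xi S).

Let ipH : inner_product_space H2 := H2_ip R lv.
Let cH : hcomplete H2 := H2_complete lv.

Lemma schur_bounded : bounded S. Proof. by case: schurS => -[]. Qed.

Lemma schur_lower : lower lev S.
Proof. by case: schurS => /(causal_operatorP lv)[]. Qed.

(** The operator norm is a supremum over the unit ball, extended by homogeneity. *)
Lemma schur_contractive f : hnorm L (S f) <= hnorm L f.
Proof.
have bS := schur_bounded; have [K K0 SK] := op_bound bS.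
have [_ S1] := schurS.
have unit g : hnorm L g <= 1 -> hnorm L (S g) <= 1.
  move=> g1; apply: le_trans S1; apply: ub_le_sup; last by exists g.
  exists K => _ [h [_ h1] <-]; apply: le_trans (SK h) _.
  by rewrite -[leRHS]mulr1 ler_wpM2l.
have [f0|f0] := eqVneq (hnorm L f) 0.
  by rewrite (nrm_eq0 (l2_ip R T) I f0) (op0 bS).
have fp : 0 < hnorm L f by rewrite lt_neqAle eq_sym f0 nrm_ge0.
have := unit ((hnorm L f)^-1%:C *: f).
rewrite (opZ bS) !(nrmZ (l2_ip R T))// normc_real ger0_norm ?invr_ge0 ?nrm_ge0//.
by rewrite mulVf// => /(_ (lexx _)); rewrite mulrC ler_pdivrMr// mul1r.
Qed.

Lemma M_dom F : hdom H2 F -> hdom H2 (M F).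
Proof. exact: (H2_compl lv schur_bounded schur_lower). Qed.

Lemma M_contractive F : hdom H2 F -> nH (M F) <= 1 * nH F.
Proof.
apply: (H2_nrm_compl lv schur_bounded schur_lower ler01) => f.
by rewrite mul1r; exact: schur_contractive.
Qed.

Lemma M_lin (a : C) F G : M (a *: F + G) = a *: M F + M G.
Proof. by apply/funext => f; rewrite /mulop /= (opD schur_bounded) (opZ schur_bounded). Qed.

Lemma M_bounded : bounded_op H2 M.
Proof.
split; [exact: M_dom|by move=> a F G _ _; exact: M_lin|].
by exists 1; exact: M_contractive.
Qed.

Lemma M'_dom F : hdom H2 F -> hdom H2 (M' F).
Proof. exact: (adjoint_dom ipH cH M_bounded). Qed.

Lemma M'E F G : hdom H2 F -> hdom H2 G -> ⟪M F, G⟫ = ⟪F, M' G⟫.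
Proof. exact: (adjointE ipH cH M_bounded). Qed.

Lemma M'E' F G : hdom H2 F -> hdom H2 G -> ⟪M' G, F⟫ = ⟪G, M F⟫.
Proof. exact: (adjointE' ipH cH M_bounded). Qed.

Let M1 F : hdom H2 F -> nH (M F) <= nH F.
Proof. by move=> dF; rewrite -[leRHS]mul1r; exact: (M_contractive dF). Qed.

Lemma sqrt_defectP : is_pos_sqrt H2 (defect xi S) P /\
  forall A : op -> op, bounded_op H2 A ->
    (forall F, hdom H2 F -> A (M (M' F)) = M (M' (A F))) ->
    forall F, hdom H2 F -> A (P F) = P (A F).
Proof. exact: (sqrt_defect_pos ipH cH M_bounded M1). Qed.

Let P_pos : is_pos_sqrt H2 (defect xi S) P. Proof. by case: sqrt_defectP. Qed.

Lemma P_bounded : bounded_op H2 P.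
Proof. by case: P_pos. Qed.

Lemma P_dom F : hdom H2 F -> hdom H2 (P F).
Proof. exact: (bop_dom P_bounded). Qed.

Lemma PPE F : hdom H2 F -> P (P F) = F - M (M' F).
Proof. by case: P_pos => _ _ PP /PP. Qed.

Lemma P_symmetric F G : hdom H2 F -> hdom H2 G -> ⟪P F, G⟫ = ⟪F, P G⟫.
Proof. exact: (sqrt_defect_sym ipH cH M_bounded M1). Qed.

Lemma sqr_nrm_P F : hdom H2 F -> nH (P F) ^+ 2 = nH F ^+ 2 - nH (M' F) ^+ 2.
Proof. exact: (sqr_nrm_sqrt_defect ipH cH M_bounded M1). Qed.

Let P1 F : hdom H2 F -> nH (P F) <= nH F.
Proof. exact: (sqrt_defect_contractive ipH cH M_bounded M1). Qed.

Let prP := ker_sqrt_proj ipH cH P_pos P1 P_symmetric.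

Let preP F : (P @` hdom H2) F -> hdom H2 (sqrt_preim xi S F) /\ P (sqrt_preim xi S F) = F.
Proof.
move=> [G dG GF]; rewrite /sqrt_preim; case: xgetP => [F' _ []//|/(_ G)]; by case.
Qed.

Definition dBR_lift := coker_lift (ker_proj xi S) (sqrt_preim xi S).

Lemma dBR_liftP F : hdom HS F -> hdom H2 (dBR_lift F) /\ P (dBR_lift F) = F.
Proof. by move=> dF; have [] := coker_liftP ipH P_pos P_symmetric prP preP dF. Qed.

Lemma dBR_hilbert : inner_product_space HS /\ hcomplete HS.
Proof. exact: (range_hilbert ipH cH P_pos P_symmetric prP preP). Qed.

Lemma dBR_P G : hdom H2 G -> hdom HS (P G).
Proof. by move=> dG; exists G. Qed.

Lemma dBR_H2 F : hdom HS F -> hdom H2 F.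
Proof. exact: (range_sub P_pos). Qed.

Lemma dBR_nrmE F : hnorm HS F = nH (dBR_lift F). Proof. by []. Qed.

Lemma dBR_nrm_le G : hdom H2 G -> hnorm HS (P G) <= nH G.
Proof. exact: (range_nrm_le ipH P_pos P_symmetric prP preP). Qed.

Lemma H2_le_dBR F : hdom HS F -> nH F <= hnorm HS F.
Proof. exact: (nrm_le_range ipH P_pos P1 P_symmetric prP preP). Qed.

Lemma dBR_reproducing F G : hdom HS F -> hdom H2 G -> hip HS F (P (P G)) = ⟪F, G⟫.
Proof. exact: (range_reproducing ipH P_pos P_symmetric prP preP). Qed.

Lemma H2_nrm_eq F G : ⟪F, F⟫ = ⟪G, G⟫ -> nH F = nH G.
Proof. by rewrite /hnorm => ->. Qed.

Lemma P_proj (E : op -> op) F : bounded_op H2 E ->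
  (forall F G, hdom H2 F -> hdom H2 G -> ⟪E F, G⟫ = ⟪F, E G⟫) ->
  (forall F, hdom H2 F -> E (E F) = E F) -> (forall F, hdom H2 F -> M' (E F) = E (M' F)) ->
  hdom H2 F -> nH (P (E F)) <= nH (P F).
Proof. exact: (sqrt_defect_proj ipH cH M_bounded M1). Qed.

Lemma C2_nrmE d : hnorm C2 d = nH d. Proof. by []. Qed.

Lemma H2_nrm_le F G : nH F ^+ 2 <= nH G ^+ 2 -> nH F <= nH G.
Proof. by rewrite ler_sqr ?nnegrE ?nrm_ge0. Qed.

#[local] Opaque hnorm adjoint sqrt_defect trace adj block_diag strict_part.
#[local] Opaque shift_op.

(** ** Right multiplication by constants *)

Lemma M'_const c F : bounded c -> bdiag lev c -> hdom H2 F -> M' (F \o c) = M' F \o c.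
Proof.
move=> bc dc dF; have bc' := bounded_adj bc; have dc' := bdiag_adj bc dc.
have dFc := H2_const lv bc dc dF; have dM'F := M'_dom dF.
apply: (ip_ext ipH (M'_dom dFc) (H2_const lv bc dc dM'F)) => G dG.
have dGc := H2_const lv bc' dc' dG.
rewrite (M'E' dG dFc) (H2_ip_compr lv bc dF (M_dom dG)).
by rewrite (H2_ip_compr lv bc dM'F dG) (M'E' dGc dF).
Qed.

(** Right multiplication by a constant commutes with M and M', hence with the square root. *)
Lemma P_const c F : bounded c -> bdiag lev c -> hdom H2 F -> P (F \o c) = P F \o c.
Proof.
move=> bc dc dF; case: sqrt_defectP => _ comm.
apply/esym; apply: (comm _ (H2_const_bounded lv bc dc) _ F dF) => G dG.
by rewrite (M'_const bc dc dG).
Qed.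

Lemma dBR_const c F : bounded c -> bdiag lev c -> hdom HS F -> hdom HS (F \o c).
Proof.
move=> bc dc dF; have [d1 d2] := dBR_liftP dF.
by rewrite -d2 -(P_const bc dc d1); apply/dBR_P/(H2_const lv bc dc d1).
Qed.

(** ** The backward shift realisation *)

Lemma MF_slower F : hdom H2 F -> slower lev F -> slower lev (M F).
Proof. by move=> dF sF; apply: slower_compl => //; [exact: schur_bounded|exact: schur_lower]. Qed.

(** Multiplication by S commutes with right multiplication by alpha_j^*, its adjoint
    does so up to a constant. *)
Lemma M'_adj_shift j G y : hdom H2 G -> hdom C2 y ->
  strict_part lev (M' (G \o adj (al j) + y)) = M' G \o adj (al j).
Proof.
move=> dG /(C2P lv)[dy by_]; have dGa := H2_adj_shift lv j dG.
have dK := domD ipH dGa dy; have dM'K := M'_dom dK; have dM'G := M'_dom dG.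
have dM'Ga := H2_adj_shift lv j dM'G.
have sM'Ga := slower_adj_shift lv j (H2_lower lv dM'G).
have [dZ sZ] := H2_strict lv dM'K.
have key F : hdom H2 F -> slower lev F ->
    ⟪strict_part lev (M' (G \o adj (al j) + y)), F⟫ = ⟪M' G \o adj (al j), F⟫.
  move=> dF sF; have dFa := H2_shift lv j dF sF; have sMF := MF_slower dF sF.
  rewrite -(H2_ip_strict lv dM'K dF sF) (M'E' dF dK).
  rewrite (ipDl ipH dGa dy (M_dom dF)) (H2_bdiag_slower lv (M_dom dF) sMF dy by_) addr0.
  rewrite (H2_ip_adj_shift lv j dG (M_dom dF)) (H2_ip_adj_shift lv j dM'G dF).
  by rewrite (M'E' dFa dG).
apply: (ip_ext ipH dZ dM'Ga) => F dF.
have [dFs sFs] := H2_strict lv dF; have /(C2P lv)[dFd bFd] := H2_block_diag lv dF.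
rewrite (strict_partE lev F) (ipDr ipH dFs dFd dZ) (ipDr ipH dFs dFd dM'Ga) (key _ dFs sFs).
by rewrite (H2_slower_bdiag lv dZ sZ dFd bFd) (H2_slower_bdiag lv dM'Ga sM'Ga dFd bFd).
Qed.

Local Notation HC := (hsum HS C2).
Let ipHS : inner_product_space HS. Proof. by case: dBR_hilbert. Qed.
Let cHS : hcomplete HS. Proof. by case: dBR_hilbert. Qed.
Let ipC2 : inner_product_space C2. Proof. by case: (C2_hilbert R lv). Qed.
Let cC2 : hcomplete C2. Proof. by case: (C2_hilbert R lv). Qed.
Let ipHC : inner_product_space HC := hsum_ip ipHS ipC2.
Let cHC : hcomplete HC := hsum_complete ipHS ipC2 cHS cC2.

Definition child_proj j : op := adj (al j) \o al j.

Lemma child_proj_chi j t : child_proj j (chi t) = if alpha j (par t) == t then chi t else 0.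
Proof.
rewrite /child_proj /= (shift_chi R lv); case: eqP => [E|_]; last first.
  exact: (op0 (adj_shift_bounded R lv j)).
by rewrite (adj_shift_chi R lv) E.
Qed.

Lemma child_proj_bounded j : bounded (child_proj j).
Proof. exact: bounded_comp (adj_shift_bounded R lv j) (shift_bounded R lv j). Qed.

Lemma child_proj_bdiag j : bdiag lev (child_proj j).
Proof.
move=> s t st; rewrite child_proj_chi; case: ifP => _; last by [].
exact: (chi_level R st).
Qed.

Lemma child_proj_adj j : adj (child_proj j) = child_proj j.
Proof.
rewrite /child_proj (adj_comp (adj_shift_bounded R lv j) (shift_bounded R lv j)).
by rewrite (adjK (shift_bounded R lv j)).
Qed.

Lemma child_proj_idem j F : F \o child_proj j \o child_proj j = F \o child_proj j.
Proof.
apply/funext => f; rewrite /child_proj /=.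
by have /(congr1 (fun h => h (al j f))) /= -> := shiftK R lv j.
Qed.

(** Both norms are the one of the columns of F at the j-th children. *)
Lemma nrm_adj_shift j F : hdom H2 F -> nH (F \o adj (al j)) = nH (F \o child_proj j).
Proof.
move=> dF; have dFa := H2_adj_shift lv j dF.
have bE := child_proj_bounded j; have dE := child_proj_bdiag j.
have dFE := H2_const lv bE dE dF.
apply: H2_nrm_eq.
rewrite (H2_ip_adj_shift lv j dF dFa) (H2_ip_compr lv bE dF dFE) child_proj_adj.
by rewrite child_proj_idem.
Qed.

Lemma nrm_P_child_proj j G : hdom H2 G -> nH (P (G \o child_proj j)) <= nH (P G).
Proof.
have bE := child_proj_bounded j; have dE := child_proj_bdiag j.
apply: (P_proj (E := fun F => F \o child_proj j) (H2_const_bounded lv bE dE)).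
- by move=> F F' dF dF'; rewrite (H2_ip_compr lv bE dF dF') child_proj_adj.
- by move=> F dF; exact: child_proj_idem.
- by move=> F dF; exact: (M'_const bE dE dF).
Qed.

Let energy_alg (a b c s d p r : R) : a = b - c -> c = s + d -> p ^+ 2 = b - s ->
  0 <= p -> p <= r -> a + d <= r ^+ 2.
Proof.
move=> -> -> E p0 pr; have : p ^+ 2 <= r ^+ 2 by rewrite ler_sqr ?nnegrE ?(le_trans p0).
by rewrite E; lra.
Qed.

(** The computation behind the coisometry: on the range of right multiplication by
    alpha_j^*, what M' loses by not commuting with it is the constant part. *)
Lemma energy j G : hdom H2 G ->
  nH (P (G \o adj (al j))) ^+ 2 + nH (block_diag lev (M' (G \o adj (al j)))) ^+ 2
    <= nH (P G) ^+ 2.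
Proof.
move=> dG; have dGa := H2_adj_shift lv j dG; have dM'Ga := M'_dom dGa.
have bE := child_proj_bounded j; have dE := child_proj_bdiag j.
have dGE := H2_const lv bE dE dG.
have h1 := sqr_nrm_P dGa; have h2 := sqr_nrm_P dGE.
have h3 := sqr_H2_nrm_strict lv dM'Ga.
have h4 : strict_part lev (M' (G \o adj (al j))) = M' G \o adj (al j).
  by have := M'_adj_shift j dG (dom0 ipC2); rewrite addr0.
have h5 := nrm_adj_shift j (M'_dom dG); rewrite -(M'_const bE dE dG) in h5.
rewrite h4 h5 in h3; rewrite (nrm_adj_shift j dG) in h1.
have h6 := nrm_P_child_proj j dG.
exact: (energy_alg h1 h3 h2 (nrm_ge0 _ _) h6).
Qed.

Lemma domY F d : hdom H2 F -> hdom C2 d -> hdom H2 (F + (S \o d)).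
Proof. by move=> dF /(C2P lv)[dd _]; apply: (domD ipH dF); exact: (M_dom dd). Qed.

(** Both components of V depend only on Y = F + S d: they are Y without its constant
    term, shifted back along alpha_j, and the constant term of Y. *)
Lemma colVE j F d : hdom H2 F -> hdom C2 d ->
  colV xi alpha S j (F, d) =
    (strict_part lev (F + (S \o d)) \o al j, block_diag lev (F + (S \o d))).
Proof.
move=> dF /(C2P lv)[dd bd]; have bS := schur_bounded.
have bF := H2_bounded lv dF; have bd' := H2_bounded lv dd.
have bSd := bounded_comp bS bd'.
have E : block_diag lev (F + (S \o d)) = block_diag lev F + (block_diag lev S \o d).
  by rewrite (block_diagD lev bF bSd) (block_diag_comp bS bd' bd).
rewrite /colV /colA /colB /colC /colD (eval0E lv bF) (eval0E lv bS) /= E; congr (_, _).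
rewrite strict_part_def E; apply/funext => f.
rewrite -[RHS]/((F (al j f) + S (d (al j f))) -
  (block_diag lev F (al j f) + block_diag lev S (d (al j f)))).
by rewrite opprD addrACA.
Qed.

(** Right multiplication by alpha_j is adjoint to that by alpha_j^*, whose values are
    strictly lower triangular. *)
Lemma strict_shift_ip j Y G : hdom H2 Y -> hdom H2 G ->
  ⟪strict_part lev Y \o al j, G⟫ = ⟪Y, G \o adj (al j)⟫.
Proof.
move=> dY dG; have [dS sS] := H2_strict lv dY; have dSa := H2_shift lv j dS sS.
have dGa := H2_adj_shift lv j dG.
rewrite (ips_conj ipH dG dSa) -(H2_ip_adj_shift lv j dG dS) -(ips_conj ipH dGa dS).
by rewrite -(H2_ip_strict lv dY dGa (slower_adj_shift lv j (H2_lower lv dG))).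
Qed.

(** The inner product of this element with G is that of Y = F + S d with G alpha_j^*,
    which [energy] bounds in terms of |P G|. *)
Lemma colV1_dBR j F d : hdom HS F -> hdom C2 d ->
  hdom HS (strict_part lev (F + (S \o d)) \o al j) /\
  hnorm HS (strict_part lev (F + (S \o d)) \o al j) <= hnorm HS F + nH d.
Proof.
move=> dF dd; have [dF' PF'] := dBR_liftP dF; have dFH := dBR_H2 dF.
have [ddH bd] := (C2P lv d).1 dd.
have dY := domY dFH dd; have [dS sS] := H2_strict lv dY; have dSa := H2_shift lv j dS sS.
have c0 : 0 <= hnorm HS F + nH d by rewrite addr_ge0 ?nrm_ge0.
have bound G : hdom H2 G ->
    normc ⟪G, strict_part lev (F + (S \o d)) \o al j⟫ <= (hnorm HS F + nH d) * nH (P G).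
  move=> dG; have dGa := H2_adj_shift lv j dG; have dM'Ga := M'_dom dGa.
  have [dBN bBN] := (C2P lv _).1 (H2_block_diag lv dM'Ga).
  rewrite (ips_conj ipH dSa dG) normc_conj (strict_shift_ip j dY dG).
  rewrite (ipDl ipH dFH (M_dom ddH) dGa) (M'E ddH dGa) -{1}PF' (P_symmetric dF' dGa).
  have -> : ⟪d, M' (G \o adj (al j))⟫ = ⟪d, block_diag lev (M' (G \o adj (al j)))⟫.
    by rewrite (ips_conj ipH dM'Ga ddH) (H2_ip_block_diag lv dM'Ga dd) -(ips_conj ipH dBN ddH).
  have en := energy j dG.
  have e1 : nH (P (G \o adj (al j))) <= nH (P G).
    by apply: H2_nrm_le; apply: le_trans en; rewrite lerDl sqr_ge0.
  have e2 : nH (block_diag lev (M' (G \o adj (al j)))) <= nH (P G).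
    by apply: H2_nrm_le; apply: le_trans en; rewrite lerDr sqr_ge0.
  apply: le_trans (le_normcD _ _) _; rewrite mulrDl; apply: lerD.
    apply: le_trans (normc_ip ipH dF' (P_dom dGa)) _.
    by rewrite dBR_nrmE; apply: ler_wpM2l e1; exact: nrm_ge0.
  apply: le_trans (normc_ip ipH ddH dBN) _.
  by apply: ler_wpM2l e2; exact: nrm_ge0.
have [Z [dZ <- nZ]] := range_symmetric ipH cH P_bounded P_symmetric dSa c0 bound.
by split; [exact: dBR_P|exact: le_trans (dBR_nrm_le dZ) nZ].
Qed.

Lemma colV_dom j x : hdom HC x -> hdom HC (colV xi alpha S j x).
Proof.
case: x => F d [dF dd]; have dFH := dBR_H2 dF; rewrite (colVE j dFH dd); split.
  by case: (colV1_dBR j dF dd).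
exact: (H2_block_diag lv (domY dFH dd)).
Qed.

Let bound_alg (z b y f g s d x : R) : z <= g + d -> b <= y -> y <= f + s -> s <= 1 * d ->
  f <= g -> g <= x -> d <= x -> z + b <= 4 * x.
Proof. by lra. Qed.

Lemma colV_bounded j : bounded_op HC (colV xi alpha S j).
Proof.
split.
- exact: colV_dom.
- move=> a [F d] [G c] [dF dd] [dG dc]; have bS := schur_bounded.
  have [dFH dGH] := (dBR_H2 dF, dBR_H2 dG).
  have dl : hdom HC (a *: (F, d) + (G, c)) by apply: (ips_dom ipHC).
  have [dl1 dl2] := dl; rewrite (colVE j dFH dd) (colVE j dGH dc).
  rewrite -[a *: (F, d) + (G, c)]/(a *: F + G, a *: d + c) (colVE j (dBR_H2 dl1) dl2).
  have -> : (a *: F + G) + (S \o (a *: d + c)) = a *: (F + (S \o d)) + (G + (S \o c)).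
    by rewrite -[S \o _]/(M (a *: d + c)) M_lin scalerDr addrACA.
  have bY1 := H2_bounded lv (domY dFH dd); have bY2 := H2_bounded lv (domY dGH dc).
  rewrite !strict_part_def (block_diag_lin lev a bY1 bY2); congr (_, _).
  by rewrite opprD addrACA -scalerBr.
- exists 4 => -[F d] dx; have [dF dd] := dx; have dFH := dBR_H2 dF.
  have [ddH bd] := (C2P lv d).1 dd.
  have n1 : hnorm HS F <= hnorm HC (F, d) := hsum_nrm1 ipHS ipC2 dx.
  have n2 : hnorm C2 d <= hnorm HC (F, d) := hsum_nrm2 ipHS ipC2 dx.
  rewrite C2_nrmE in n2.
  have dV := colV_dom j dx; apply: le_trans (hsum_nrm_le ipHS ipC2 dV) _.
  have dY := domY dFH dd; rewrite (colVE j dFH dd) [in leLHS]/=.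
  have [_ e1] := colV1_dBR j dF dd.
  have e2 : hnorm C2 (block_diag lev (F + (S \o d))) <= nH (F + (S \o d)).
    rewrite C2_nrmE; apply: H2_nrm_le.
    by rewrite [leRHS](sqr_H2_nrm_strict lv dY) lerDr sqr_ge0.
  have e3 := nrmD ipH dFH (M_dom ddH); have e4 := M_contractive ddH.
  have e5 := H2_le_dBR dF.
  exact: (bound_alg e1 e2 e3 e4 e5 n1 n2).
Qed.

(** On the vectors (P P G, y) both inner products are evaluated by
    [dBR_reproducing], so that V^* can be read off. *)
Lemma adj_colV j G y : hdom H2 G -> hdom C2 y ->
  let K := G \o adj (al j) + y in
  adjoint HC (colV xi alpha S j) (P (P G), y) = (P (P K), block_diag lev (M' K)).
Proof.
move=> dG dy K; have [dyH by_] := (C2P lv y).1 dy.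
have dGa := H2_adj_shift lv j dG; have dK : hdom H2 K := domD ipH dGa dyH.
have dM'K := M'_dom dK; have dBM := H2_block_diag lv dM'K; have [dBMH bBM] := (C2P lv _).1 dBM.
apply: (adjoint_eq ipHC cHC (colV_bounded j)).
- exact: conj (dBR_P (P_dom dG)) dy.
- exact: conj (dBR_P (P_dom dK)) dBM.
move=> [F d] [dF dd]; have dFH := dBR_H2 dF; have [ddH bd] := (C2P lv d).1 dd.
have dY := domY dFH dd; rewrite (colVE j dFH dd).
have [dZ _] := colV1_dBR j dF dd; have [dBY _] := (C2P lv _).1 (H2_block_diag lv dY).
rewrite -[LHS]/(hip HS (strict_part lev (F + (S \o d)) \o al j) (P (P G)) +
  ⟪block_diag lev (F + (S \o d)), y⟫).
rewrite -[RHS]/(hip HS F (P (P K)) + ⟪d, block_diag lev (M' K)⟫).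
rewrite (dBR_reproducing dZ dG) (dBR_reproducing dF dK).
rewrite (strict_shift_ip j dY dG) -(H2_ip_block_diag lv dY dy) -(ipDr ipH dGa dyH dY).
rewrite (ipDl ipH dFH (M_dom ddH) dK); congr (_ + _).
rewrite (M'E ddH dK) (ips_conj ipH dM'K ddH) (H2_ip_block_diag lv dM'K dd).
by rewrite -(ips_conj ipH dBMH ddH).
Qed.

Lemma colV_adj_dense j G y : hdom H2 G -> hdom C2 y ->
  colV xi alpha S j (adjoint HC (colV xi alpha S j) (P (P G), y)) =
    (P (P G) \o child_proj j, y).
Proof.
move=> dG dy; have [dyH by_] := (C2P lv y).1 dy.
rewrite (adj_colV j dG dy); set K := _ + y.
have dGa := H2_adj_shift lv j dG; have dK : hdom H2 K := domD ipH dGa dyH.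
have dM'K := M'_dom dK; have dBM := H2_block_diag lv dM'K.
rewrite (colVE j (P_dom (P_dom dK)) dBM).
have dPPG := P_dom (P_dom dG).
have YE : P (P K) + (S \o block_diag lev (M' K)) = P (P G) \o adj (al j) + y.
  rewrite (PPE dK) (PPE dG) -[S \o _]/(M (block_diag lev (M' K))).
  have [dBMH _] := (C2P lv _).1 dBM.
  have -> : M (block_diag lev (M' K)) = M (M' K) - M (M' G \o adj (al j)).
    rewrite -(M'_adj_shift j dG dy) -/K -(bopB ipH M_bounded dM'K); last first.
      by case: (H2_strict lv dM'K).
    by rewrite strict_part_def subKr.
  rewrite addrA subrK /K addrAC; congr (_ + _).
have dA := H2_adj_shift lv j dPPG.
have sA := slower_adj_shift lv j (H2_lower lv dPPG).
have BE : block_diag lev (P (P G) \o adj (al j) + y) = y.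
  rewrite (block_diagD lev (H2_bounded lv dA) (H2_bounded lv dyH)).
  by rewrite (block_diag_0 (H2_bounded lv dA) sA) add0r (block_diag_id (H2_bounded lv dyH) by_).
by rewrite YE strict_part_def BE addrK.
Qed.

(** The vectors (P P G, y) separate the points of the direct sum, and V V^* is known on
    them; symmetry of V V^* transfers this to all vectors. *)
Lemma colV_coisometry j F d : hdom HS F -> hdom C2 d ->
  colV xi alpha S j (adjoint HC (colV xi alpha S j) (F, d)) = (F \o child_proj j, d).
Proof.
move=> dF dd; have bV := colV_bounded j.
have bE := child_proj_bounded j; have dE := child_proj_bdiag j.
have dx : hdom HC (F, d) := conj dF dd.
have dV'x := adjoint_dom ipHC cHC bV dx; have dVV'x := bop_dom bV dV'x.
have dFE := dBR_const bE dE dF; have dFH := dBR_H2 dF; have dFEH := dBR_H2 dFE.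
have dz : hdom HC (F \o child_proj j, d) := conj dFE dd.
set u := colV _ _ _ _ _ in dVV'x *; set z := (_, d) in dz *.
have dD := domB ipHC dVV'x dz; have [dD1 dD2] := dD.
have dD1H := dBR_H2 dD1.
have perp G y : hdom H2 G -> hdom C2 y -> hip HC (u - z) (P (P G), y) = 0.
  move=> dG dy; have dw : hdom HC (P (P G), y) by split => //; exact/dBR_P/P_dom.
  have dGE := H2_const lv bE dE dG.
  rewrite (ipBl ipHC dVV'x dz dw) (adjointE ipHC cHC bV dV'x dw).
  have dV'w := adjoint_dom ipHC cHC bV dw.
  rewrite (adjointE' ipHC cHC bV dV'w dx) (colV_adj_dense j dG dy).
  rewrite -[X in X - _]/(hip HS F (P (P G) \o child_proj j) + ⟪d, y⟫).
  rewrite -[X in _ - X]/(hip HS (F \o child_proj j) (P (P G)) + ⟪d, y⟫).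
  rewrite -(P_const bE dE (P_dom dG)) -(P_const bE dE dG).
  rewrite (dBR_reproducing dF dGE) (dBR_reproducing dFE dG).
  by rewrite (H2_ip_compr lv bE dFH dG) child_proj_adj subrr.
apply/eqP; rewrite -subr_eq0; apply/eqP.
have /eqP := perp _ _ dD1H dD2.
rewrite -[X in X == 0]/(hip HS (u - z).1 (P (P (u - z).1)) + hip C2 (u - z).2 (u - z).2).
rewrite (dBR_reproducing dD1 dD1H) paddr_eq0 ?(ips_ge0 ipH dD1H) ?(ips_ge0 ipC2 dD2)//.
move=> /andP[/eqP e1 /eqP e2].
rewrite [LHS]surjective_pairing (ips_eq0 ipH dD1H e1) (ips_eq0 ipC2 dD2 e2) //.
Qed.

Lemma colA_dBR j F : hdom HS F -> hdom HS (colA xi alpha j F).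
Proof.
move=> dF; have d0 := dom0 ipC2; have dFH := dBR_H2 dF.
have [+ _] := colV1_dBR j dF d0.
have -> : F + (S \o 0) = F.
  by rewrite -[S \o 0]/(M 0) (bop0 ipH M_bounded) addr0.
by rewrite /colA (eval0E lv (H2_bounded lv dFH)).
Qed.

End DeBrangesRovnyak.

(** * Coefficients *)

Section Coefficients.
Variables (R : realType) (T : choiceType) (q : nat).
Variables (xi : set (nat -> T)) (alpha : 'I_q -> T -> T) (lev : T -> int) (par : T -> T).
Hypothesis lv : leveled xi alpha lev par.

Local Notation C := R[i].
Local Notation normc := (Normc.normc).
Local Notation op := (l2 R T -> l2 R T).
Local Notation chi := (chi R).
Local Notation bounded := (@bounded_operator R T).
Local Notation al := (@shift_op R T q alpha).
Implicit Types (F S c d : op) (f : l2 R T) (s t u : T) (w v : seq 'I_q).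

Lemma act_rcons t w j : act alpha t (rcons w j) = alpha j (act alpha t w).
Proof. by rewrite -cats1 act_cat. Qed.

Lemma par_act t w : iter (size w) par (act alpha t w) = t.
Proof.
elim/last_ind: w => [//|w j IH].
by rewrite size_rcons iterSr act_rcons (par_alpha lv).
Qed.

Lemma act_word_inj t w w' : size w = size w' -> act alpha t w = act alpha t w' -> w = w'.
Proof.
elim/last_ind: w w' => [|w j IH] w'; first by case: w'.
case/lastP: w' => [|w' j']; rewrite !size_rcons // => -[sw]; rewrite !act_rcons => E.
have Ew : act alpha t w = act alpha t w'.
  by have := congr1 par E; rewrite !(par_alpha lv).
by rewrite (IH _ sw Ew) (alpha_inj2 lv (t := act alpha t w) (i := j) (j := j'))// E Ew.
Qed.

Lemma word_to t n : exists w, size w = n /\ act alpha (iter n par t) w = t.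
Proof.
elim: n t => [|n IH] t; first by exists [::].
have [w [sw wt]] := IH (par t); have [j jt] := alpha_par lv t.
by exists (rcons w j); rewrite size_rcons sw act_rcons iterSr wt.
Qed.

(** The value at t of w^* g involves only the ancestor of t from which w leads to t. *)
Lemma adj_word_opE w f t : adj (word_op alpha w) f t =
  if act alpha (iter (size w) par t) w == t then f (iter (size w) par t) else 0.
Proof.
have bw := word_op_bounded R lv w.
rewrite (op_coord (bounded_adj bw)) (adjK bw).
have [E|ne] := eqVneq.
  by rewrite -[in X in word_op _ _ (chi X)]E (word_op_chi R lv) ip_chi.
have -> : word_op alpha w (chi t) = 0; last exact: (ip0r (l2_ip R T) (z := f) I).
apply: l2P => s; rewrite (word_opE lv) chiE l20E; case: eqP => // E.
by move: ne; rewrite -E par_act eqxx.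
Qed.

(** For fixed t, each length admits exactly one word leading to t, and its term collects
    the entries of the row of S at t from one level. The expansion thus regroups by
    levels the absolutely convergent sum (S f)(t). *)
Lemma expansion S : bounded S -> lower lev S -> ptwise_abs_expansion alpha S (coef xi alpha S).
Proof.
move=> bS lS f t.
pose leads w := act alpha (iter (size w) par t) w == t.
pose h u := f u * S (chi u) t.
pose G (p : T * seq 'I_q) : C :=
  if leads p.2 && (lev p.1 == lev t - (size p.2)%:Z) then h p.1 else 0.
have single u : exists w0, G (u, w0) = h u /\ forall w, w != w0 -> G (u, w) = 0.
  have [ut|tu] := leP (lev u) (lev t); last first.
    have h0 : h u = 0 by rewrite /h lS ?mulr0.
    by exists [::]; split => [|w _]; rewrite /G h0 if_same.
  have [w0 [s0 a0]] := word_to t `|lev t - lev u|%N.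
  exists w0; split.
    rewrite /G /leads /= s0 a0 eqxx /= ifT//; apply/eqP; lia.
  move=> w ww0; rewrite /G /=; case: ifP => // /andP[/eqP aw /eqP lw].
  have sw : size w = size w0 by lia.
  by case/eqP: ww0; apply: (act_word_inj (t := iter (size w0) par t)) => //; rewrite -{1}sw aw s0.
have sh : abs_summable h := op_csum_summable bS f t.
have row u : nnsummable (fun w => normc (G (u, w))) /\ nnsum (fun w => normc (G (u, w))) = normc (h u).
  have [w0 [G0 Gw]] := single u.
  have := @nnsum_single R _ (fun w => normc (G (u, w))) w0 (normc_ge0 _).
  by rewrite G0; apply => w /Gw ->; exact: Normc.normc0.
have sG : abs_summable G.
  apply: (nnsummable_pair (f := fun p => normc (G p))) => [p|u|].
  - exact: normc_ge0.
  - by case: (row u).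
  - by have -> : (fun u => nnsum (fun w => normc (G (u, w)))) = (fun u => normc (h u));
      [apply/funext => u; case: (row u)|exact: sh].
have SE : csum G = S f t.
  have [_ _ ->] := csum_pair sG; rewrite (op_csum bS); apply: eq_csum => u.
  have [w0 [G0 Gw]] := single u.
  by have [_ ->] := csum_single Gw.
have [_ s2 E2] := csum_pair (abs_summable_swap sG).
have aE w : adj (word_op alpha w) (coef xi alpha S w f) t = csum (fun u => G (u, w)).
  rewrite adj_word_opE (coef_block_diag lv w bS) (block_diagE lev); last first.
    exact: bounded_comp (word_op_bounded R lv w) bS.
  rewrite /= (word_opE lv) /G /= -/(leads w).
  have [lw|_] := boolP (leads w); last by rewrite csum0.
  rewrite (eqP lw) (op_csum bS); apply: eq_csum => u; rewrite level_cutE.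
  have -> : lev (iter (size w) par t) = lev t - (size w)%:Z.
    by rewrite -[in RHS](eqP lw) (lev_act lv) addrK.
  by rewrite /h; case: ifP => // _; rewrite mul0r.
have aE' : (fun w => adj (word_op alpha w) (coef xi alpha S w f) t) =
    (fun w => csum (fun u => G (u, w))) by exact/funext.
by rewrite /= aE'; split; [exact: s2|rewrite -E2 csum_swap].
Qed.

Lemma colA_bounded_lower j F : bounded F -> lower lev F ->
  bounded (colA xi alpha j F) /\ lower lev (colA xi alpha j F).
Proof.
move=> bF lF; have bB := block_diag_bounded lev bF; have bFB := boundedB bF bB.
rewrite /colA (eval0E lv bF); split.
  exact: bounded_comp bFB (shift_bounded R lv j).
exact: (lower_shift lv j bFB (slower_sub_block_diag bF lF)).
Qed.

Lemma colA_word_bounded_lower v F : bounded F -> lower lev F ->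
  bounded (colA_word xi alpha v F) /\ lower lev (colA_word xi alpha v F).
Proof.
elim: v F => [//|j v IH] F bF lF.
have [bA lA] := colA_bounded_lower j bF lF; exact: IH.
Qed.

(** Backward shifting along v reads off the columns of F at the nodes tv, keeping
    the entries on and below the level of tv. *)
Lemma colA_word_entry v F s t : bounded F -> lower lev F -> lev (act alpha t v) <= lev s ->
  colA_word xi alpha v F (chi (act alpha t v)) s = F (chi t) s.
Proof.
elim: v F t => [//|j v IH] F t bF lF lvs.
have [bA lA] := colA_bounded_lower j bF lF.
rewrite [LHS](IH _ (alpha j t) bA lA lvs) /colA (eval0E lv bF) /=.
rewrite (shift_chi R lv) (par_alpha lv) eqxx.
rewrite -[LHS]/(F (chi t) s - block_diag lev F (chi t) s) (block_diag_entry lev s t bF).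
case: eqP => [E|_]; last by rewrite subr0.
by move: lvs; rewrite (lev_act lv) E /=; lia.
Qed.

Lemma colB_colA S j d : bounded S -> bounded d -> bdiag lev d ->
  colB xi alpha S j d = colA xi alpha j (S \o d).
Proof.
move=> bS bd dd; rewrite /colB /colA (eval0E lv bS) (eval0E lv (bounded_comp bS bd)).
by rewrite (block_diag_comp bS bd dd).
Qed.

(** Both sides have the entry (S d)(sw, t) at (s, t) when s and t have the same level and
    0 otherwise. On the right, v^* alpha_j^* moves the column t to the column tjv, where
    [colA_word_entry] recovers S d, and the hypothesis on lengths matches the levels. *)
Lemma coef_realisation S d w v j : bounded S -> lower lev S -> bounded d -> bdiag lev d ->
  size w = (size v).+1 ->
  coef xi alpha S w \o d =
    word_op alpha w \o colC xi alpha (colA_word xi alpha v (colB xi alpha S j d))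
      \o adj (word_op alpha v) \o adj (al j).
Proof.
move=> bS lS bd dd sw; have bw := word_op_bounded R lv w.
have bSd := bounded_comp bS bd; have lSd := lower_comp bS lS (bdiag_lower dd).
rewrite (colB_colA j bS bd dd) -[colA_word _ _ v _]/(colA_word xi alpha (j :: v) (S \o d)).
have [bN lN] := colA_word_bounded_lower (j :: v) bSd lSd.
rewrite /colC (eval0E lv bN) (coef_block_diag lv w bS) -(block_diag_comp (bounded_comp bw bS) bd dd).
have bwSd : bounded (word_op alpha w \o S \o d) := bounded_comp (bounded_comp bw bS) bd.
apply: op_ext.
- exact: (block_diag_bounded lev bwSd).
- apply: bounded_comp (adj_shift_bounded R lv j).
  apply: bounded_comp (adj_word_bounded R lv v).
  exact: bounded_comp bw (block_diag_bounded lev bN).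
move=> s t; rewrite (block_diag_entry lev s t bwSd).
set N := colA_word _ _ _ _ in bN *.
have -> : (word_op alpha w \o block_diag lev N \o adj (word_op alpha v) \o adj (al j)) (chi t) s
    = block_diag lev N (chi (act alpha t (j :: v))) (act alpha s w).
  rewrite /comp (adj_shift_chi R lv) (adj_word_chi R lv).
  exact: (word_opE lv w _ s).
have -> : (word_op alpha w \o S \o d) (chi t) s = (S \o d) (chi t) (act alpha s w).
  exact: (word_opE lv w _ s).
rewrite (block_diag_entry lev _ _ bN) (lev_act lv w s) (lev_act lv (j :: v) t) /= sw.
have -> : (lev s + (size v).+1%:Z == lev t + (size v).+1%:Z) = (lev s == lev t) by lia.
case: eqP => // E; rewrite /N (colA_word_entry bSd lSd)//.
by rewrite (lev_act lv w s) (lev_act lv (j :: v) t) /= sw E.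
Qed.

End Coefficients.

Theorem theorem6p7 (R : realType) (q : nat) (T : choiceType) (e : rel T)
    (xi : set (nat -> T)) (alpha : 'I_q -> T -> T) (S : l2 R T -> l2 R T)
    (q_ge1 : (1 <= q)%N)
    (treeT : homogeneous_tree q e)
    (xi_boundary : boundary_point e xi)
    (alpha_shifts : primitive_shifts xi alpha)
    (schurS : schur_multiplier xi S) :
  let op := l2 R T -> l2 R T in
  let HS := dBR xi S in
  let C2 := C2 R xi in
  let A : 'I_q -> op -> op := colA xi alpha in
  let B : 'I_q -> op -> op := colB xi alpha S in
  let C : op -> op := colC xi alpha in
  let D : op -> op := colD xi alpha S in
  let V : 'I_q -> op * op -> op * op := colV xi alpha S in
  let al : 'I_q -> op := shift_op alpha in
  let HC := hsum HS C2 in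
  [/\ (* (I) *)
      forall j,
        [/\ bounded_op HC (V j),
            (forall F d, hdom HS F -> hdom C2 d ->
               V j (adjoint HC (V j) (F, d)) = (F \o (adj (al j) \o al j), d)) &
            (forall F, hdom HS F -> hdom HS (A j F))],
      (* (II) *)
      forall F c d j l,
        hdom HS F -> constant_operator xi c -> hdom C2 d ->
        [/\ A l F = A j F \o adj (al j) \o al l /\
            B l d = B j d \o adj (al j) \o al l,
            hdom HS (F \o c) /\ hdom C2 (d \o c),
            A j (F \o c) = A j F \o adj (al j) \o c \o al j /\
            B j (d \o c) = B j d \o adj (al j) \o c \o al j &
            C (F \o c) = C F \o c /\ D (d \o c) = D d \o c] &
      (* (III) *)
      [/\ (forall w, constant_operator xi (coef xi alpha S w)),
          ptwise_abs_expansion alpha S (coef xi alpha S) &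
          forall d, hdom C2 d ->
            coef xi alpha S [::] \o d = D d /\
            forall w v j, size w = (size v).+1 ->
              coef xi alpha S w \o d =
              word_op alpha w \o C (colA_word xi alpha v (B j d))
                \o adj (word_op alpha v) \o adj (al j)]].
Proof.
have [lev [par lv]] := tree_leveled treeT xi_boundary alpha_shifts.
have bS := schur_bounded schurS; have lS := schur_lower lv schurS.
move=> op HS C2' A B C D V al HC.
have alK j (f : l2 R T) : al j (adj (al j) f) = f.
  exact: (congr1 (fun h => h f) (shiftK R lv j)).
split; last split.
- move=> j; split.
  + exact: (colV_bounded lv schurS j).
  + move=> F d dF dd; exact: (colV_coisometry lv schurS j dF dd).
  + move=> F dF; exact: (colA_dBR lv schurS j dF).
- move=> F c d j l dF /(constant_operatorP lv)[bc dc] /(C2P lv)[dd bd].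
  have bF := H2_bounded lv (dBR_H2 lv schurS dF).
  have AE i G : A i G = (G - eval0 xi alpha G) \o al i by [].
  have BE i G : B i G = (S - eval0 xi alpha S) \o G \o al i by [].
  split.
  + by split; apply/funext => f; rewrite ?AE ?BE /= alK.
  + split; first exact: (dBR_const lv schurS bc dc dF).
    apply/(C2P lv); split; first exact: (H2_const lv bc dc dd).
    exact: (bdiag_comp (H2_bounded lv dd) bd dc).
  + split; apply/funext => f; last by rewrite !BE /= alK.
    rewrite !AE (eval0E lv (bounded_comp bF bc)) (eval0E lv bF) (block_diag_comp bF bc dc).
    by rewrite /= alK.
  + split; last by [].
    rewrite /C /colC (eval0E lv (bounded_comp bF bc)) (eval0E lv bF).
    exact: (block_diag_comp bF bc dc).
- move=> w; rewrite (coef_block_diag lv w bS); apply: (block_diag_const lv).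
  exact: bounded_comp (word_op_bounded R lv w) bS.
- exact: (expansion lv bS lS).
- move=> d /(C2P lv)[dd bd]; split; first by [].
  move=> w v j sw; exact: (coef_realisation lv j bS lS (H2_bounded lv dd) bd sw).
Qed.
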